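(* Let $\ell\ge1$. There is an isomorphism of algebras $$\bigoplus_{N\ge0}H^0(L_N,\nabla_N^{\overline\partial})\;\simeq\;\frac{\mathbb{C}\langle z_1,z_2,\dots,z_{\ell+1}\rangle}{\langle\, z_iz_j-qz_jz_i:\ 1\le i<j\le\ell+1\,\rangle},$$ where the product on the left-hand side (the quantum homogeneous coordinate ring of $\mathbb{C}P^\ell_q$) is induced by the multiplication isomorphisms $L_{N_1}\otimes_{\mathcal A(\mathbb{C}P^\ell_q)}L_{N_2}\simeq L_{N_1+N_2}$, $\xi\otimes\eta\mapsto\xi\eta$.
   Context: Throughout $0<q<1$, $\ell\ge 1$ is an integer, $[n]=\frac{q^n-q^{-n}}{q-q^{-1}}$, $[n]!=[n][n-1]\cdots[1]$. $U_q(\mathfrak{su}(\ell+1))$ is the Hopf $*$-algebra generated by $K_i,K_i^{-1},E_i,F_i$ ($1\le i\le\ell$) with $K_i^*=K_i$, $E_i^*=F_i$ and relations (together with their adjoints) $K_iK_j=K_jK_i$, $E_iK_i=q^{-1}K_iE_i$, $E_iK_j=q^{1/2}K_jE_i$ if $|i-j|=1$, $E_iK_j=K_jE_i$ if $|i-j|>1$, $E_iF_j-F_jE_i=\delta_{ij}\frac{K_i^2-K_i^{-2}}{q-q^{-1}}$, $E_iE_j=E_jE_i$ if $|i-j|>1$, $E_i^2E_j-(q+q^{-1})E_iE_jE_i+E_jE_i^2=0$ if $|i-j|=1$; $\Delta(K_i)=K_i\otimes K_i$, $\Delta(E_i)=E_i\otimes K_i+K_i^{-1}\otimes E_i$, $\Delta(F_i)=F_i\otimes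 K_i+K_i^{-1}\otimes F_i$, $\epsilon(K_i)=1$, $\epsilon(E_i)=0$, $S(K_i)=K_i^{-1}$, $S(E_i)=-qE_i$. $\mathcal A(SU_q(\ell+1))$ is the Hopf $*$-algebra generated by $u^i_j$ ($1\le i,j\le\ell+1$) with $u^i_ku^j_k=qu^j_ku^i_k$ and $u^k_iu^k_j=qu^k_ju^k_i$ for $i<j$; $[u^i_l,u^j_k]=0$ and $[u^i_k,u^j_l]=(q-q^{-1})u^i_lu^j_k$ for $i<j$, $k<l$; quantum determinant $\sum_{\pi\in S_{\ell+1}}(-q)^{\|\pi\|}u^1_{\pi(1)}\cdots u^{\ell+1}_{\pi(\ell+1)}=1$ ($\|\pi\|$ the number of inversions); $\Delta(u^i_j)=\sum_k u^i_k\otimes u^k_j$, $\epsilon(u^i_j)=\delta^i_j$, $S(u^i_j)=(u^j_i)^*$. The Hopf pairing is determined by $\langle K_r,u^i_j\rangle=\delta^i_jq^{\frac12(\delta_{r+1,i}-\delta_{r,i})}$, $\langle E_r,u^i_j\rangle=\delta^i_{r+1}\delta^r_j$, $\langle F_r,u^i_j\rangle=\delta^i_{r}\delta^{r+1}_j$, and $a\triangleleft h=\sum\langle h,a_{(1)}\rangle a_{(2)}$ is the induced right action of $U_q(\mathfrak{su}(\ell+1))$ on $\mathcal A(SU_q(\ell+1))$. Put $z_j=u^{\ell+1}_j$. For $N\in\mathbb Z$, $L_N$ is the set of $a\in\mathcal A(SU_q(\ell+1))$ with $a\triangleleft K_i=a$, $a\triangleleft E_i=a\triangleleft F_i=0$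 for $1\le i\le\ell-1$ and $a\triangleleft(K_1K_2^2\cdots K_\ell^\ell)=q^{N\ell/2}a$. $\mathcal A(\mathbb{C}P^\ell_q):=L_0$; each $L_N$ is an $\mathcal A(\mathbb{C}P^\ell_q)$-bimodule. $\Omega^{(0,1)}$ is the $\mathcal A(\mathbb{C}P^\ell_q)$-bimodule of $v=(v_1,\dots,v_\ell)\in\mathcal A(SU_q(\ell+1))^\ell$ such that for $1\le r\le\ell-1$: $v_I\triangleleft K_r=q^{\frac12(\delta_{I,r}-\delta_{I,r+1})}v_I$, $v_I\triangleleft E_r=\delta_{I,r}v_{r+1}$, $v_I\triangleleft F_r=\delta_{I,r+1}v_r$, and $v_I\triangleleft(K_1K_2^2\cdots K_\ell^\ell)=q^{(\ell+1)/2}v_I$. For $a\in\mathcal A(\mathbb{C}P^\ell_q)$, $\overline\partial a=-(a\triangleleft F_\ell F_{\ell-1}\cdots F_1,\ a\triangleleft F_\ell\cdots F_2,\ \dots,\ a\triangleleft F_\ell)\in\Omega^{(0,1)}$. Identify $\Omega^{(0,1)}\otimes_{\mathcal A(\mathbb{C}P^\ell_q)}L_N$ with a subspace of $\mathcal A(SU_q(\ell+1))^\ell$ by $v\otimes\xi\mapsto(v_1\xi,\dots,v_\ell\xi)$. For $N\ge0$ the holomorphic connection $\nabla_N^{\overline\partial}:L_N\to\Omega^{(0,1)}\otimes_{\mathcal A(\mathbb{C}P^\ell_q)}L_N$ is $\nabla_N^{\overline\partial}(\xi)=q^{-N}\Psi_N^\dagger\,\overline\partial(\Psi_N\xi)$,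 where $\Psi_N$ is the column vector with entries $\psi^N_{j_1,\dots,j_{\ell+1}}=[j_1,\dots,j_{\ell+1}]!^{1/2}(z_1^{j_1}\cdots z_{\ell+1}^{j_{\ell+1}})^*$, $j_1+\dots+j_{\ell+1}=N$, and $[j_1,\dots,j_k]!=q^{-\sum_{r<s}j_rj_s}\frac{[j_1+\cdots+j_k]!}{[j_1]!\cdots[j_k]!}$. $H^0(L_N,\nabla_N^{\overline\partial}):=\ker\nabla_N^{\overline\partial}$. *)

(* Defs.v *)
From HB Require Import structures.
From mathcomp Require Import all_boot all_order all_algebra all_fingroup.
From mathcomp Require Import finmap generic_quotient ring_quotient.
From mathcomp Require Import monalg.
From mathcomp Require Import mathcomp_extra boolp classical_sets reals complex.

Set Implicit Arguments.
Unset Strict Implicit.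
Unset Printing Implicit Defensive.

Import Order.TTheory GRing.Theory Num.Theory.
Import Quotient.Exports.

Local Open Scope ring_scope.
Local Open Scope quotient_scope.
Local Open Scope classical_set_scope.

Section QuotientModule.
Variables (F : fieldType) (V : lmodType F).

Definition lspan (S : set V) : {pred V} := fun x =>
  `[< exists n (c : 'I_n -> F) (s : 'I_n -> V),
        (forall i, S (s i)) /\ x = \sum_(i < n) c i *: s i >].

Variable S : set V.

Lemma lspan_ge x : S x -> x \in lspan S.
Proof.
move=> Sx; apply/asboolP; exists 1%N, (fun=> 1), (fun=> x).
by rewrite big_ord1 scale1r.
Qed.

Lemma lspan0 : 0 \in lspan S.
Proof.
by apply/asboolP; exists 0%N, (fun=> 0), (fun=> 0); split=> [[]|]; rewrite ?big_ord0.
Qed.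

Lemma lspanZ a x : x \in lspan S -> a *: x \in lspan S.
Proof.
move=> /asboolP[n [c [s [Ss ->]]]]; apply/asboolP.
exists n, (fun i => a * c i), s; split=> //.
by rewrite scaler_sumr; apply: eq_bigr => i _; rewrite scalerA.
Qed.

Lemma lspanD x y : x \in lspan S -> y \in lspan S -> x + y \in lspan S.
Proof.
move=> /asboolP[n [c [s [Ss ->]]]] /asboolP[m [d [t [St ->]]]]; apply/asboolP.
exists (n + m)%N, (fun i => match split i with inl j => c j | inr j => d j end),
  (fun i => match split i with inl j => s j | inr j => t j end); split.
  by move=> i; case: split.
rewrite big_split_ord /=; congr (_ + _); apply: eq_bigr => i _.
  by rewrite (unsplitK (inl i)).
by rewrite (unsplitK (inr i)).
Qed.

Lemma lspan_zmod : zmod_closed (lspan S).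
Proof.
split=> [|x y Sx Sy]; first exact: lspan0.
by rewrite -scaleN1r lspanD// lspanZ.
Qed.

HB.instance Definition _ := GRing.isZmodClosed.Build V (lspan S) lspan_zmod.

Definition quotmod : Type := Quotient.quot (lspan S : zmodClosed V).

HB.instance Definition _ := GRing.Zmodule.on quotmod.

Definition qpi (x : V) : quotmod := \pi_(Quotient.quot (lspan S : zmodClosed V)) x.

Lemma qpi_eq x y : (qpi x = qpi y) <-> x - y \in lspan S.
Proof.
by rewrite (Quotient.idealrBE (lspan S : zmodClosed V)); split=> [/eqP|/eqP].
Qed.

Definition qrepr (x : quotmod) : V :=
  repr (x : Quotient.quot (lspan S : zmodClosed V)).

Lemma qreprK x : qpi (qrepr x) = x.
Proof. exact: reprK. Qed.

Lemma qpiD : {morph qpi : x y / x + y}.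
Proof. by move=> x y; rewrite /qpi !piE. Qed.

Definition qscale (c : F) (x : quotmod) : quotmod := qpi (c *: qrepr x).

Lemma qscaleE c x : qscale c (qpi x) = qpi (c *: x).
Proof.
by apply/qpi_eq; rewrite -scalerBr lspanZ//; apply/qpi_eq; rewrite qreprK.
Qed.

Lemma qscaleA a b x : qscale a (qscale b x) = qscale (a * b) x.
Proof. by rewrite -[x]qreprK !qscaleE scalerA. Qed.

Lemma qscale1 : left_id 1 qscale.
Proof. by move=> x; rewrite -[x]qreprK qscaleE scale1r. Qed.

Lemma qscaleDr : right_distributive qscale +%R.
Proof.
by move=> a x y; rewrite -[x]qreprK -[y]qreprK -qpiD !qscaleE -qpiD scalerDr.
Qed.

Lemma qscaleDl x : {morph qscale^~ x : a b / a + b}.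
Proof. by move=> a b; rewrite -[x]qreprK !qscaleE -qpiD scalerDl. Qed.

HB.instance Definition _ := GRing.Zmodule_isLmodule.Build F quotmod
  qscaleA qscale1 qscaleDr qscaleDl.

Lemma qpi_is_linear : linear qpi.
Proof. by move=> c x y; rewrite qpiD -qscaleE. Qed.

HB.instance Definition _ := GRing.isLinear.Build F V quotmod _ qpi qpi_is_linear.

End QuotientModule.

Section TensorProduct.
Variables (F : fieldType) (V W : lmodType F).

Inductive tens_rel : set {malg F[(V * W)%type]} :=
| tens_relDl v v' w : tens_rel (<< (v + v', w) >> - << (v, w) >> - << (v', w) >>)
| tens_relDr v w w' : tens_rel (<< (v, w + w') >> - << (v, w) >> - << (v, w') >>)
| tens_relZl c v w : tens_rel (<< (c *: v, w) >> - c *: << (v, w) >>)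
| tens_relZr c v w : tens_rel (<< (v, c *: w) >> - c *: << (v, w) >>).

Definition tprod : Type := quotmod tens_rel.
HB.instance Definition _ := GRing.Lmodule.on tprod.

Definition tens (v : V) (w : W) : tprod := qpi tens_rel << (v, w) >>.

(* The extension to tprod of a biadditive balanced map f, i.e. the sum
   of the f x_(1) x_(2) of the Sweedler notation; see tlift_sum. *)
Definition tlift (Z : zmodType) (f : V -> W -> Z) (t : tprod) : Z :=
  \sum_(k <- msupp (qrepr t)) f ((qrepr t)@_k *: k.1) k.2.

End TensorProduct.

Notation "x ⊗ y" := (tens x y) (at level 40, left associativity) : ring_scope.

Section TensorTheory.
Variables (F : fieldType) (V W : lmodType F) (Z : zmodType) (f : V -> W -> Z).
Hypothesis fDl : forall v v' w, f (v + v') w = f v w + f v' w.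
Hypothesis fDr : forall v w w', f v (w + w') = f v w + f v w'.
Hypothesis fZ : forall c v w, f (c *: v) w = f v (c *: w).

Let f0l w : f 0 w = 0.
Proof. by apply: (addrI (f 0 w)); rewrite -fDl !addr0. Qed.

Let fNl v w : f (- v) w = - f v w.
Proof. by apply/eqP; rewrite -addr_eq0 -fDl addNr f0l. Qed.

Let g (x : {malg F[(V * W)%type]}) : Z :=
  \sum_(k <- msupp x) f (x@_k *: k.1) k.2.

Let gEw (d : {fset (V * W)%type}) x : (msupp x `<=` d)%fset ->
  g x = \sum_(k <- d) f (x@_k *: k.1) k.2.
Proof.
move=> le; rewrite /g (big_fset_incl _ le) //= => k _ /mcoeff_outdom ->.
by rewrite scale0r f0l.
Qed.

Let gB x y : g (x - y) = g x - g y.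
Proof.
pose d := (msupp x `|` msupp y)%fset.
rewrite (gEw (d := d)) ?msuppB_le// (gEw (d := d) (x := x)) ?fsubsetUl//.
rewrite (gEw (d := d) (x := y)) ?fsubsetUr// -sumrB; apply: eq_bigr => k _.
by rewrite mcoeffB scalerBl fDl fNl.
Qed.

Let g0 : g 0 = 0. Proof. by have := gB 0 0; rewrite !subrr. Qed.
Let gD x y : g (x + y) = g x + g y.
Proof. by have := gB x (0 - y); rewrite (gB 0) g0 !sub0r !opprK. Qed.

Let gU c k : g (c *: << k >>) = f (c *: k.1) k.2.
Proof.
rewrite (gEw (d := [fset k]%fset)); last first.
  by apply: fsubset_trans (msuppZ_le _ _) _; apply: msuppU_le.
by rewrite big_seq_fset1 mcoeffZ mcoeffUU mulr1.
Qed.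

Let gU1 k : g << k >> = f k.1 k.2.
Proof. by rewrite -[<< k >>]scale1r gU scale1r. Qed.

Let gZB c x y a b :
  g (c *: x) = a -> g (c *: y) = b -> g (c *: (x - y)) = a - b.
Proof. by rewrite scalerBr gB => -> ->. Qed.

Let gZU c d k : g (c *: (d *: << k >>)) = f ((c * d) *: k.1) k.2.
Proof. by rewrite scalerA gU. Qed.

Let gker x : x \in lspan (@tens_rel F V W) -> g x = 0.
Proof.
move=> /asboolP[n [c [s [Ss ->]]]].
elim/big_rec: _ => [|i y _ IH]; first exact: g0.
rewrite gD IH addr0; move: (c i) (s i) (Ss i) => d z [].
- move=> v v' w.
  rewrite (gZB (gZB (gU d (v + v', w)) (gU d (v, w))) (gU d (v', w))) /=.
  by rewrite scalerDr fDl addrAC addrK subrr.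
- move=> v w w'.
  rewrite (gZB (gZB (gU d (v, w + w')) (gU d (v, w))) (gU d (v, w'))) /=.
  by rewrite fDr addrAC addrK subrr.
- move=> e v w; rewrite (gZB (gU d (e *: v, w)) (gZU d e (v, w))) /=.
  by rewrite scalerA subrr.
- move=> e v w; rewrite (gZB (gU d (v, e *: w)) (gZU d e (v, w))) /=.
  by rewrite -fZ scalerA mulrC subrr.
Qed.

Lemma tlift_qpi x : tlift f (qpi (@tens_rel F V W) x) = g x.
Proof.
apply/eqP; rewrite -subr_eq0 -gB gker//.
by apply/qpi_eq; rewrite qreprK.
Qed.

Lemma tlift_tens v w : tlift f (v ⊗ w) = f v w.
Proof. by rewrite tlift_qpi gU1. Qed.

Lemma tliftD x y : tlift f (x + y) = tlift f x + tlift f y.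
Proof. by rewrite -[x]qreprK -[y]qreprK -qpiD !tlift_qpi gD. Qed.

Lemma tlift_sum (s : seq (V * W)) :
  tlift f (\sum_(p <- s) p.1 ⊗ p.2) = \sum_(p <- s) f p.1 p.2.
Proof.
elim: s => [|p s IH]; last by rewrite !big_cons tliftD tlift_tens IH.
by rewrite !big_nil -[0](linear0 (qpi (@tens_rel F V W))) tlift_qpi g0.
Qed.

End TensorTheory.

Section FreeAlgebra.
Variables (F : fieldType) (X : choiceType).

(* Monomials of {fmonom X} are words in X. *)
Definition free_alg := {malg F[{fmonom X}]}.

Definition fgen (x : X) : free_alg := << fmu x >>.

Variable e : X -> F.

Definition word_eval (m : {fmonom X}) : F := \prod_(x <- (m : seq X)) e x.

Lemma word_eval_mmorphism : mmorphism word_eval.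
Proof.
split=> [m m'|]; last by rewrite /word_eval fm1 big_nil.
by rewrite /word_eval fmM big_cat.
Qed.

HB.instance Definition _ :=
  monalg.isMultiplicative.Build {fmonom X} F word_eval word_eval_mmorphism.

Definition free_eval : free_alg -> F := mmap idfun word_eval.

End FreeAlgebra.

(* An algebra over F given by generators and relations x = y (prel x y).
   The augmentation paug, extended to a character that respects the relations,
   is only there because MathComp algebras are nonzero; the presented algebra
   does not depend on it. *)
Record presentation (F : fieldType) := Presentation {
  pgen : choiceType;
  prel : free_alg F pgen -> free_alg F pgen -> Prop;
  paug : pgen -> F;
  paugP : forall x y, prel x y -> free_eval paug x = free_eval paug y }.

Section PresentedAlgebra.
Variables (F : fieldType) (P : presentation F).

Local Notation fP := (free_alg F (pgen P)).

(* The span of ideal_gens is the two-sided ideal generated by the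
   differences of the two sides of the relations. *)
Inductive ideal_gens : set fP :=
| IdealGen a x y b : prel x y -> ideal_gens (a * (x - y) * b).

Definition palg : Type := quotmod ideal_gens.
HB.instance Definition _ := GRing.Lmodule.on palg.

Let pip : fP -> palg := qpi ideal_gens.

Let malgCC c (x : fP) : c%:MP * x = x * c%:MP.
Proof.
rewrite [x]monalgE mulr_sumr mulr_suml; apply: eq_bigr => k _.
by rewrite [LHS]fgmulUU [RHS]fgmulUU mul1m mulm1 mulrC.
Qed.

Let scalAr c (x y : fP) : c *: (x * y) = x * (c *: y).
Proof.
by rewrite -[LHS]mul_malgC -[c *: y]mul_malgC [LHS]mulrA malgCC [RHS]mulrA.
Qed.

Let idealMl a x : x \in lspan ideal_gens -> a * x \in lspan ideal_gens.
Proof.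
move=> /asboolP[n [c [s [Ss ->]]]].
rewrite mulr_sumr; elim/big_rec: _ => [|i y _ IH]; first exact: lspan0.
apply: lspanD => //; rewrite -scalAr; apply/lspanZ/lspan_ge.
by case: (Ss i) => b u v d uv; rewrite !mulrA; apply: IdealGen.
Qed.

Let idealMr x a : x \in lspan ideal_gens -> x * a \in lspan ideal_gens.
Proof.
move=> /asboolP[n [c [s [Ss ->]]]].
rewrite mulr_suml; elim/big_rec: _ => [|i y _ IH]; first exact: lspan0.
apply: lspanD => //; rewrite -scalerAl; apply/lspanZ/lspan_ge.
by case: (Ss i) => b u v d uv; rewrite -[_ * d * a]mulrA; apply: IdealGen.
Qed.

Definition palg_mul (x y : palg) : palg := pip (qrepr x * qrepr y).

Let pipM x y : palg_mul (pip x) (pip y) = pip (x * y).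
Proof.
apply/qpi_eq; have -> (a b : fP) : a * b - x * y = (a - x) * b + x * (b - y).
  by rewrite mulrBl mulrBr addrA subrK.
apply: lspanD.
  by apply/idealMr/qpi_eq; rewrite qreprK.
by apply/idealMl/qpi_eq; rewrite qreprK.
Qed.

Let palg_mulA : associative palg_mul.
Proof.
move=> x y z; rewrite -[x]qreprK -[y]qreprK -[z]qreprK.
by rewrite -!/(pip _) !pipM mulrA.
Qed.

Let palg_mul1 : left_id (pip 1) palg_mul.
Proof. by move=> x; rewrite -[x]qreprK -!/(pip _) pipM mul1r. Qed.

Let palg_mulr1 : right_id (pip 1) palg_mul.
Proof. by move=> x; rewrite -[x]qreprK -!/(pip _) pipM mulr1. Qed.

Let palg_mulDl : left_distributive palg_mul +%R.
Proof.
move=> x y z; rewrite -[x]qreprK -[y]qreprK -[z]qreprK -!/(pip _).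
by rewrite -[pip _ + _]qpiD -!/(pip _) !pipM mulrDl [LHS]qpiD.
Qed.

Let palg_mulDr : right_distributive palg_mul +%R.
Proof.
move=> x y z; rewrite -[x]qreprK -[y]qreprK -[z]qreprK -!/(pip _).
by rewrite -[pip _ + _]qpiD -!/(pip _) !pipM mulrDr [LHS]qpiD.
Qed.

Let palg_1neq0 : pip 1 != 0.
Proof.
have ker x : x \in lspan ideal_gens -> free_eval (@paug _ P) x = 0.
  move=> /asboolP[n [c [s [Ss ->]]]]; rewrite /free_eval linear_sum big1// => i _.
  rewrite linearZ; case: (Ss i) => a u v b uv; rewrite !rmorphM rmorphB /=.
  have := paugP uv; rewrite /free_eval => ->.
  by rewrite subrr mulr0 mul0r mulr0.
apply/eqP; rewrite -[0](linear0 (qpi ideal_gens)) => /qpi_eq; rewrite subr0.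
by move=> /ker /eqP; rewrite /free_eval rmorph1 oner_eq0.
Qed.

HB.instance Definition _ := GRing.Zmodule_isNzRing.Build palg
  palg_mulA palg_mul1 palg_mulr1 palg_mulDl palg_mulDr palg_1neq0.

Let palg_scalAl (c : F) (x y : palg) : c *: (x * y) = c *: x * y.
Proof.
rewrite -[x]qreprK -[y]qreprK -!/(pip _) -[RHS]/(palg_mul _ _).
by rewrite -[_ * _]/(palg_mul _ _) pipM -!linearZ [RHS]pipM scalerAl.
Qed.

HB.instance Definition _ := GRing.Lmodule_isLalgebra.Build F palg palg_scalAl.

Let palg_scalAr (c : F) (x y : palg) : c *: (x * y) = x * (c *: y).
Proof.
rewrite -[x]qreprK -[y]qreprK -!/(pip _) -[RHS]/(palg_mul _ _).
by rewrite -[_ * _]/(palg_mul _ _) pipM -!linearZ [RHS]pipM scalAr.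
Qed.

HB.instance Definition _ := GRing.Lalgebra_isAlgebra.Build F palg palg_scalAr.

Definition ppi : fP -> palg := qpi ideal_gens.
HB.instance Definition _ := GRing.Linear.on ppi.

Lemma ppi_monoid_morphism : monoid_morphism ppi.
Proof. by split=> [|x y]; [exact: erefl | exact/esym/pipM]. Qed.

HB.instance Definition _ :=
  GRing.isMonoidMorphism.Build fP palg ppi ppi_monoid_morphism.

Definition pg (x : pgen P) : palg := ppi (fgen F x).

Lemma ppi_rel x y : prel x y -> ppi x = ppi y.
Proof.
move=> xy; apply/qpi_eq/lspan_ge.
by rewrite -[_ - _]mul1r -[X in _ X]mulr1; apply: IdealGen.
Qed.

End PresentedAlgebra.

Section FreeEval.
Variables (F : fieldType) (X : choiceType) (e : X -> F).

Local Notation ev := (free_eval e).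

HB.instance Definition _ := GRing.RMorphism.copy (free_eval e)
  (mmap idfun (word_eval e)).
HB.instance Definition _ := GRing.isScalable.Build F (free_alg F X) F *%R
  (free_eval e) (@mmap_is_linear _ _ (word_eval e)).

Lemma free_evalG x : ev (fgen F x) = e x.
Proof.
rewrite /free_eval mmapU mul1r /word_eval.
by rewrite /fmu fmE /= big_seq1.
Qed.

End FreeEval.

Section HopfStarAlgebras.
Variable F : numClosedFieldType.

Record hopf_star (A : algType F) := HopfStar {
  cop : {linear A -> tprod A A};
  cou : {scalar A};
  ant : {linear A -> A};
  star : A -> A;
  _ : forall a,
    tlift (fun x y => tlift (fun x1 x2 => x1 ⊗ (x2 ⊗ y)) (cop x)) (cop a) =
    tlift (fun x y => x ⊗ cop y) (cop a);
  _ : forall a, tlift (fun x y => cou x *: y) (cop a) = a;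
  _ : forall a, tlift (fun x y => cou y *: x) (cop a) = a;
  _ : forall a, tlift (fun x y => ant x * y) (cop a) = (cou a)%:A;
  _ : forall a, tlift (fun x y => x * ant y) (cop a) = (cou a)%:A;
  _ : forall a b, cop (a * b) =
    tlift (fun x y => tlift (fun x' y' => (x * x') ⊗ (y * y')) (cop b)) (cop a);
  _ : cop 1 = 1 ⊗ 1;
  _ : forall a b, cou (a * b) = cou a * cou b;
  _ : cou 1 = 1;
  _ : forall a b, star (a + b) = star a + star b;
  _ : forall (c : F) a, star (c *: a) = c^* *: star a;
  _ : forall a b, star (a * b) = star b * star a;
  _ : involutive star;
  _ : forall a, cop (star a) = tlift (fun x y => star x ⊗ star y) (cop a) }.

Record hopf_pairing (U A : algType F) (HU : hopf_star U) (HA : hopf_star A)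
    (p : U -> A -> F) : Prop := HopfPairing {
  pairing_linl : forall a (c : F) h k, p (c *: h + k) a = c * p h a + p k a;
  pairing_linr : forall h (c : F) a b, p h (c *: a + b) = c * p h a + p h b;
  pairing_mull : forall h k a,
    p (h * k) a = tlift (fun x y => p h x * p k y) (cop HA a);
  pairing_mulr : forall h a b,
    p h (a * b) = tlift (fun x y => p x a * p y b) (cop HU h);
  pairing_1l : forall a, p 1 a = cou HA a;
  pairing_1r : forall h, p h 1 = cou HU h }.

(* The right action a ◁ h = <h, a_(1)> a_(2) *)
Definition ract (U A : algType F) (HA : hopf_star A) (p : U -> A -> F)
    (a : A) (h : U) : A :=
  tlift (fun x y => p h x *: y) (cop HA a).

End HopfStarAlgebras.

Section Presentations.
Variables (R : realType) (q : R) (l : nat).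

Local Notation C := R[i].
Local Notation qC := (q%:C)%C.
Local Notation qh := ((Num.sqrt q)%:C)%C.

(* Indices start at 0: for 1 <= r <= l and 1 <= i, j <= l + 1 the usual
   K_r, K_r^-1, E_r, F_r have index r - 1 : 'I_l, and u^i_j is
   Au (i - 1) (j - 1). *)

Variant Ugen := gK of 'I_l | gKi of 'I_l | gE of 'I_l | gF of 'I_l.

HB.instance Definition _ := gen_eqMixin Ugen.
HB.instance Definition _ := gen_choiceMixin Ugen.

Definition adj (i j : 'I_l) : bool := (i.+1 == j :> nat) || (j.+1 == i :> nat).
Definition far (i j : 'I_l) : bool := (i.+1 < j)%N || (j.+1 < i)%N.

Section Relations.
Variable T : lalgType C.

Variant Uq_rel (g : Ugen -> T) : T -> T -> Prop :=
| Urel_KKi i : Uq_rel g (g (gK i) * g (gKi i)) 1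
| Urel_KiK i : Uq_rel g (g (gKi i) * g (gK i)) 1
| Urel_KK i j : Uq_rel g (g (gK i) * g (gK j)) (g (gK j) * g (gK i))
| Urel_EK i : Uq_rel g (g (gE i) * g (gK i)) (qC^-1 *: (g (gK i) * g (gE i)))
| Urel_EK_adj i j : adj i j ->
    Uq_rel g (g (gE i) * g (gK j)) (qh *: (g (gK j) * g (gE i)))
| Urel_EK_far i j : far i j ->
    Uq_rel g (g (gE i) * g (gK j)) (g (gK j) * g (gE i))
| Urel_EF i j : Uq_rel g (g (gE i) * g (gF j) - g (gF j) * g (gE i))
    ((i == j)%:R *: ((qC - qC^-1)^-1 *: (g (gK i) ^+ 2 - g (gKi i) ^+ 2)))
| Urel_EE i j : far i j ->
    Uq_rel g (g (gE i) * g (gE j)) (g (gE j) * g (gE i))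
| Urel_EEE i j : adj i j ->
    Uq_rel g (g (gE i) ^+ 2 * g (gE j)
              - (qC + qC^-1) *: (g (gE i) * g (gE j) * g (gE i))
              + g (gE j) * g (gE i) ^+ 2) 0
(* the adjoints of the relations that are not self-adjoint *)
| Urel_KF i : Uq_rel g (g (gK i) * g (gF i)) (qC^-1 *: (g (gF i) * g (gK i)))
| Urel_KF_adj i j : adj i j ->
    Uq_rel g (g (gK j) * g (gF i)) (qh *: (g (gF i) * g (gK j)))
| Urel_KF_far i j : far i j ->
    Uq_rel g (g (gK j) * g (gF i)) (g (gF i) * g (gK j))
| Urel_FF i j : far i j ->
    Uq_rel g (g (gF j) * g (gF i)) (g (gF i) * g (gF j))
| Urel_FFF i j : adj i j ->
    Uq_rel g (g (gF j) * g (gF i) ^+ 2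
              - (qC + qC^-1) *: (g (gF i) * g (gF j) * g (gF i))
              + g (gF i) ^+ 2 * g (gF j)) 0.

Definition inversions (s : 'S_l.+1) : nat :=
  #|[pred p : 'I_l.+1 * 'I_l.+1 | (p.1 < p.2)%N && (s p.2 < s p.1)%N]|.

Variant Aq_rel (u : 'I_l.+1 -> 'I_l.+1 -> T) : T -> T -> Prop :=
| Arel_row (i j k : 'I_l.+1) : (i < j)%N ->
    Aq_rel u (u i k * u j k) (qC *: (u j k * u i k))
| Arel_col (i j k : 'I_l.+1) : (i < j)%N ->
    Aq_rel u (u k i * u k j) (qC *: (u k j * u k i))
| Arel_anti (i j k m : 'I_l.+1) : (i < j)%N -> (k < m)%N ->
    Aq_rel u (u i m * u j k - u j k * u i m) 0
| Arel_diag (i j k m : 'I_l.+1) : (i < j)%N -> (k < m)%N ->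
    Aq_rel u (u i k * u j m - u j m * u i k)
             ((qC - qC^-1) *: (u i m * u j k))
| Arel_det :
    Aq_rel u (\sum_(s : 'S_l.+1)
                (- qC) ^+ inversions s *: \prod_(i < l.+1) u i (s i)) 1.

Variant qspace_rel (z : 'I_l.+1 -> T) : T -> T -> Prop :=
| Qrel (i j : 'I_l.+1) : (i < j)%N -> qspace_rel z (z i * z j - qC *: (z j * z i)) 0.

End Relations.

Definition Uq_aug (x : Ugen) : C :=
  match x with gK _ | gKi _ => 1 | gE _ | gF _ => 0 end.

Definition Aq_aug (p : 'I_l.+1 * 'I_l.+1) : C := (p.1 == p.2)%:R.

Definition qspace_aug (i : 'I_l.+1) : C := 0.

Section Augmentations.
Variables (T : lalgType C) (ev : {lrmorphism T -> C | *%R}).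

Let eN u : ev (- u) = - ev u. Proof. exact: rmorphN. Qed.
Let eD u v : ev (u + v) = ev u + ev v. Proof. exact: rmorphD. Qed.
Let eM u v : ev (u * v) = ev u * ev v. Proof. exact: rmorphM. Qed.
Let eZ c u : ev (c *: u) = c * ev u. Proof. exact: linearZ. Qed.
Let e0 : ev 0 = 0. Proof. exact: rmorph0. Qed.
Let e1 : ev 1 = 1. Proof. exact: rmorph1. Qed.

Lemma Uq_aug_rel g x y : (forall i, ev (g i) = Uq_aug i) ->
  Uq_rel g x y -> ev x = ev y.
Proof.
move=> evg; case=> *; rewrite ?expr2 !(eD, eN, eM, eZ, e0, e1, evg) /=;
  by rewrite ?(mulr0, mul0r, mulr1, subrr, oppr0, addr0).
Qed.

Lemma Aq_aug_rel u x y : (forall i j, ev (u i j) = Aq_aug (i, j)) ->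
  Aq_rel u x y -> ev x = ev y.
Proof.
move=> evu; case=> [i j k ij|i j k ij|i j k m ij km|i j k m ij km|].
- rewrite !(eZ, eM, evu) /Aq_aug /=.
  case: (i =P k) => [<-|_]; case: (j =P _) => [ji|_];
    rewrite ?(mulr0, mul0r)//.
  by rewrite ji ltnn in ij.
- rewrite !(eZ, eM, evu) /Aq_aug /=.
  case: (k =P i) => [->|_]; case: (_ =P j) => [ji|_];
    rewrite ?(mulr0, mul0r)//.
  by rewrite ji ltnn in ij.
- by rewrite !(eN, eD, eM, e0) [X in X - _]mulrC subrr.
- rewrite !(eZ, eN, eD, eM) [X in X - _]mulrC subrr !evu /Aq_aug /=.
  case: (i =P m) => [im|_]; case: (j =P k) => [jk|_];
    rewrite ?(mulr0, mul0r)//.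
  by rewrite im jk in ij; have := ltn_trans ij km; rewrite ltnn.
- rewrite e1 linear_sum (bigD1 1%g)//= eZ rmorph_prod /= big1; last first.
    by move=> i _; rewrite evu /Aq_aug perm1 eqxx.
  rewrite (_ : inversions _ = 0%N) ?expr0 ?mulr1; last first.
    apply/eqP/pred0P => p; rewrite /= !perm1.
    by case: ltngtP.
  rewrite big1 ?addr0// => s s1; rewrite eZ rmorph_prod /=.
  have [i si] : exists i, s i != i.
    apply/existsP; apply: contraNT s1; rewrite negb_exists => /forallP s1.
    by apply/eqP/permP => i; rewrite perm1; apply/eqP; move: (s1 i); rewrite negbK.
  by rewrite (bigD1 i)//= evu /Aq_aug /= eq_sym (negbTE si) mul0r mulr0.
Qed.

Lemma qspace_aug_rel z x y : (forall i, ev (z i) = qspace_aug i) ->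
  qspace_rel z x y -> ev x = ev y.
Proof.
by move=> evz [i j _]; rewrite !(eD, eN, eZ, eM, evz, e0) !mulr0 subrr.
Qed.

End Augmentations.

Definition Uq_pres : presentation C :=
  @Presentation C Ugen (Uq_rel (@fgen C Ugen)) Uq_aug
    (fun x y => Uq_aug_rel (ev := free_eval Uq_aug) (free_evalG Uq_aug)).

Definition Aq_pres : presentation C :=
  @Presentation C ('I_l.+1 * 'I_l.+1)%type
    (Aq_rel (fun i j => @fgen C ('I_l.+1 * 'I_l.+1)%type (i, j))) Aq_aug
    (fun x y => Aq_aug_rel (ev := free_eval Aq_aug)
                  (fun i j => free_evalG Aq_aug (i, j))).

Definition qspace_pres : presentation C :=
  @Presentation C 'I_l.+1 (qspace_rel (@fgen C 'I_l.+1)) qspace_aug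
    (fun x y => qspace_aug_rel (ev := free_eval qspace_aug)
                  (free_evalG qspace_aug)).

(* U_q(su(l+1)), A(SU_q(l+1)) and C<z_1, ..., z_(l+1)> / (z_i z_j - q z_j z_i) *)
Definition Uq : algType C := palg Uq_pres.
Definition Aq : algType C := palg Aq_pres.
Definition qspace : algType C := palg qspace_pres.

Definition UK (i : 'I_l) : Uq := pg (P := Uq_pres) (gK i).
Definition UKi (i : 'I_l) : Uq := pg (P := Uq_pres) (gKi i).
Definition UE (i : 'I_l) : Uq := pg (P := Uq_pres) (gE i).
Definition UF (i : 'I_l) : Uq := pg (P := Uq_pres) (gF i).
Definition Au (i j : 'I_l.+1) : Aq := pg (P := Aq_pres) (i, j).

(* Uq and Aq are presented as algebras. Their Hopf *-structures and the pairing
   are given by data on which the values on the generators are imposed, and are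
   determined by these values; in particular Aq_ant fixes the involution. *)
Record Uq_hopf (H : hopf_star Uq) : Prop := UqHopf {
  Uq_copK : forall i, cop H (UK i) = UK i ⊗ UK i;
  Uq_copE : forall i, cop H (UE i) = UE i ⊗ UK i + UKi i ⊗ UE i;
  Uq_copF : forall i, cop H (UF i) = UF i ⊗ UK i + UKi i ⊗ UF i;
  Uq_couK : forall i, cou H (UK i) = 1;
  Uq_couE : forall i, cou H (UE i) = 0;
  Uq_antK : forall i, ant H (UK i) = UKi i;
  Uq_antE : forall i, ant H (UE i) = - qC *: UE i;
  Uq_starK : forall i, star H (UK i) = UK i;
  Uq_starE : forall i, star H (UE i) = UF i }.

Record Aq_hopf (H : hopf_star Aq) : Prop := AqHopf {
  Aq_cop : forall i j, cop H (Au i j) = \sum_k Au i k ⊗ Au k j;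
  Aq_cou : forall i j, cou H (Au i j) = (i == j)%:R;
  Aq_ant : forall i j, ant H (Au i j) = star H (Au j i) }.

Record Uq_Aq_pairing (HU : hopf_star Uq) (HA : hopf_star Aq)
    (p : Uq -> Aq -> C) : Prop := UqAqPairing {
  pairing_hopf : hopf_pairing HU HA p;
  pairing_K : forall r i j, p (UK r) (Au i j) =
    (i == j)%:R *
    ((Num.sqrt q ^ ((i == r.+1 :> nat)%:Z - (i == r :> nat)%:Z))%:C)%C;
  pairing_E : forall r i j, p (UE r) (Au i j) =
    ((i == r.+1 :> nat) && (j == r :> nat))%:R;
  pairing_F : forall r i j, p (UF r) (Au i j) =
    ((i == r :> nat) && (j == r.+1 :> nat))%:R }.

Definition Az (j : 'I_l.+1) : Aq := Au ord_max j.

Definition qint (n : nat) : R := (q ^+ n - q ^- n) / (q - q^-1).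
Definition qfact (n : nat) : R := \prod_(1 <= k < n.+1) qint k.

Definition qmult (J : 'I_l.+1 -> nat) : R :=
  q ^- (\sum_(r < l.+1) \sum_(s < l.+1 | r < s) J r * J s)%N
  * qfact (\sum_(k < l.+1) J k)%N / \prod_(k < l.+1) qfact (J k).

Section Connection.
Variables (HA : hopf_star Aq) (p : Uq -> Aq -> C).

Local Notation "a ◁ h" := (ract HA p a h) (at level 40, left associativity).

Definition Ktot : Uq := \prod_(i < l) UK i ^+ i.+1.

Definition line_bundle (N : int) : set Aq := [set a |
  (forall i : 'I_l, (i.+1 < l)%N ->
     [/\ a ◁ UK i = a, a ◁ UE i = 0 & a ◁ UF i = 0]) /\
  a ◁ Ktot = (Num.sqrt q ^ (N * l%:Z))%:C%C *: a].

(* F_l F_(l-1) ... F_i *)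
Definition Fdown (i : 'I_l) : Uq := \prod_(k <- rev (enum 'I_l) | (i <= k)%N) UF k.

Definition dbar (a : Aq) : 'rV[Aq]_l := \row_i - (a ◁ Fdown i).

Definition psi (N : nat) (J : {ffun 'I_l.+1 -> 'I_N.+1}) : Aq :=
  (Num.sqrt (qmult (fun k => J k)))%:C%C *: star HA (\prod_(k < l.+1) Az k ^+ J k).

(* Through v ⊗ xi |-> (v_i xi)_i, the connection takes its values in A^l. *)
Definition nabla (N : nat) (xi : Aq) : 'rV[Aq]_l :=
  \row_i (qC ^- N *:
    \sum_(J : {ffun 'I_l.+1 -> 'I_N.+1} | (\sum_(k < l.+1) J k == N)%N)
      star HA (psi J) * dbar (psi J * xi) 0 i).

Definition H0 (N : nat) : set Aq := [set xi | line_bundle N xi /\ nabla N xi = 0].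

(* The direct sum of the H0 N, N >= 0, as the set of the polynomials
   \sum_N xi_N 'X^N with xi_N in H0 N; the product of {poly Aq} is the graded
   product given by the multiplications H0 N1 x H0 N2 -> L_(N1 + N2). *)
Definition hcoord_ring : set {poly Aq} := [set P | forall N, H0 N P`_N].

End Connection.

End Presentations.

(* Main.v *)
Require Import Defs.
From HB Require Import structures.
From mathcomp Require Import all_boot all_order all_algebra.
From mathcomp Require Import perm finmap generic_quotient ring_quotient monalg.
From mathcomp Require Import boolp classical_sets reals complex.
From mathcomp Require Import zify ring.

(** The map sends [z_j] to [z_j 'X], where [z_j] is the last row of the matrix of
    generators [u]; the column relations make it a well defined morphism. The point
    is that the holomorphic sections of degree [N] are exactly the combinations of
    the monomials of degree [N] in the [z_j], and that ordered monomials are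
    linearly independent.

    From the connection to lowest weight vectors. Each [z_j] is killed by all the
    [F_r] and is an eigenvector of all the [K_r], hence so is each monomial [m] in
    the [z_j], and [m] passes through the operators [F_r]: [m] times [b ◁ F] is a
    nonzero multiple, depending only on the degree of [m], of [(m b) ◁ F]
    ([lowest_mulFs]). The entries of the adjoint of [Psi_N] are such monomials, and
    [Psi_N] is normalized, by the sphere relation and the q-multinomial identity
    ([sum_kappa_sqr], [sum_zmon_star]). So the components of the connection at [xi]
    are nonzero multiples of [xi ◁ F_(l-1) ... F_i] ([sandwich], [nablaE]), and its
    kernel in [L_N] consists of the vectors killed by all the [F_r] ([H0P]).

    From lowest weight vectors to polynomials in the [z_j]. Instead of decomposing
    the coordinate algebra into irreducible corepresentations, one tests elements
    by pairing them with words in the [E_r] and [F_r]. A product of generators is a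
    word of entries (row, column); acting by [E_r] or [F_r] moves one entry from
    row [r + 1] to row [r] or back, with positive coefficients ([monomial_letter]).
    Hence a product of letters pairs with a product of generators to a nonnegative
    number, which vanishes exactly when no sequence of such moves makes the word
    diagonal ([pairing_monomial]). Every word [w] has a test word [wordFE w] that
    makes [w] diagonal ([moves_wordFE]); if it also makes [w'] diagonal, then every
    corner of the matrix (rows [< a] and columns [>= b] with [a <= b], or the
    mirror image) contains at most as many entries of [w'] as of [w]
    ([upper_moves], [lower_moves]). For words with the same number of entries in
    each row, equality of all these counts forces equality up to order
    ([perm_eq_words]), so the pairing is triangular.

    A lowest weight vector of weight [N] is a combination of sorted words with [M]
    entries in each row but the last, which has [M + N]: the weights fix the content
    up to [M], the quantum determinant raises [M] to a common value, and the
    quadratic relations sort the words ([lowest_sorted]). It is killed by the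
    [F_r], by the [E_r] except the last one, and by the power [N + 1] of the last
    one, by the representation theory of rank one ([rank_one_nilpotent]).
    Therefore it pairs to zero with every test word except those of words of [N]
    entries of the last row ([lowest_test]). These are dual to the monomials of
    degree [N] in the [z_j]; subtracting the right combination of monomials leaves
    a lowest weight vector that all test words kill, hence 0 by triangularity
    ([lowest_eq0], [lowest_expand]).

    The same duality shows that ordered monomials are independent, which gives
    injectivity ([phi_injective]); surjectivity onto the sections is the previous
    paragraph ([phi_range]). *)

Set Implicit Arguments.
Unset Strict Implicit.
Unset Printing Implicit Defensive.

Import Order.TTheory GRing.Theory Num.Theory.

(** * Words and their moves *)

Section WordMoves.
Variable l : nat.
Local Notation T := ('I_l.+1 * 'I_l.+1)%type.
Implicit Types (w u v : seq T) (x : T) (X : bool * nat) (h : seq (bool * nat)).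

(** A word is the sequence of the indices (row, column) of a product of generators.
    The letter [(true, r)] is [E_r], which moves an entry from row [r + 1] to row
    [r], and [(false, r)] is [F_r], which moves it from row [r] to row [r + 1]. *)
Definition row_move X x : T := (inord (if X.1 then X.2 else X.2.+1), x.2).
Definition movable X x : bool :=
  if X.1 then x.1 == X.2.+1 :> nat else (x.1 == X.2 :> nat) && (X.2 < l).

Fixpoint steps X w : seq (seq T) :=
  if w is x :: w' then
    (if movable X x then [:: row_move X x :: w'] else [::]) ++
    [seq x :: u | u <- steps X w']
  else [::].

Fixpoint moves h w w' : Prop :=
  if h is X :: h' then exists2 u, u \in steps X w & moves h' u w' else w = w'.

Lemma row_moveE X x : movable X x ->
  (row_move X x).1 = (if X.1 then X.2 else X.2.+1) :> nat.
Proof.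
case: X => [[] r]; rewrite /movable /row_move /= => m; rewrite inordK//.
  by have := ltn_ord x.1; rewrite (eqP m) => /ltnW.
by case/andP: m.
Qed.

Lemma stepsP X w u : u \in steps X w ->
  exists a x b, [/\ w = a ++ x :: b, movable X x & u = a ++ row_move X x :: b].
Proof.
elim: w u => [|x w IH] u //=; rewrite mem_cat => /orP[|/mapP[v vs ->]].
  by case: ifP => // m; rewrite inE => /eqP->; exists [::], x, w.
by have [a [y [b [-> m ->]]]] := IH v vs; exists (x :: a), y, b.
Qed.

Lemma moves_cat h1 h2 w w' :
  moves (h1 ++ h2) w w' <-> exists2 u, moves h1 w u & moves h2 u w'.
Proof.
elim: h1 w => [|X h IH] w /=; first by split=> [|[u <-]//]; exists w.
split=> [[v vs /IH[u pu pu']]|[u [v vs pu] pu']]; first by exists u => //; exists v.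
by exists v => //; apply/IH; exists u.
Qed.

Lemma moves_cons h x w w' : moves h w w' -> moves h (x :: w) (x :: w').
Proof.
elim: h w => [|X h IH] w /= => [->//|[u us pu]].
by exists (x :: u); rewrite ?mem_cat ?map_f ?orbT//; apply: IH.
Qed.

Lemma moves_cols h w w' : moves h w w' -> unzip2 w = unzip2 w'.
Proof.
elim: h w => [|X h IH] w /= => [->//|[u /stepsP[a [x [b [-> m uE]]]] /IH <-]].
by rewrite uE /unzip2 !map_cat.
Qed.

(** A letter moves a single entry, so the number of entries in [Q] drops by at most
    the number of letters that can carry an entry out of [Q]. *)
Lemma moves_count_le (Q : pred T) (D : pred (bool * nat)) h w w' :
  (forall X x, X \in h -> movable X x -> Q x -> ~~ Q (row_move X x) -> D X) ->
  moves h w w' -> count Q w <= count Q w' + count D h.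
Proof.
elim: h w => [|X h IH] w HD /= => [->|[u /stepsP[a [x [b [-> m uE]]]] pu]].
  by rewrite addn0.
have HD' Y y : Y \in h -> movable Y y -> Q y -> ~~ Q (row_move Y y) -> D Y.
  by move=> Yh; apply: HD; rewrite inE Yh orbT.
have {IH pu} := IH _ HD' pu; rewrite uE !count_cat /=.
have := HD X x (mem_head _ _) m.
case: (Q x) => //=; last by lia.
case: (Q (row_move X x)) => //=; first by lia.
by move=> /(_ isT isT) ->; lia.
Qed.

Lemma moves_count_mono (Q : pred T) h w w' :
  (forall X x, X \in h -> movable X x -> Q x -> Q (row_move X x)) ->
  moves h w w' -> count Q w <= count Q w'.
Proof.
move=> HQ /(moves_count_le (Q := Q) (D := pred0)); rewrite count_pred0 addn0; apply.
by move=> X x Xh m Qx; rewrite (HQ X).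
Qed.

(** Without letters [F], an entry crosses the line between the rows [r] and [r + 1]
    exactly when the letter [E_r] is used, and never comes back. *)
Lemma moves_row_gt r h w w' : (forall X, X \in h -> X.1) -> moves h w w' ->
  count (fun x => r < x.1) w = count (fun x => r < x.1) w' + count_mem (true, r) h.
Proof.
elim: h w => [|X h IH] w HE /= => [->|[u /stepsP[a [x [b [-> m uE]]]] pu]].
  by rewrite addn0.
have HE' Y : Y \in h -> Y.1 by move=> Yh; apply: HE; rewrite inE Yh orbT.
have {IH pu} := IH _ HE' pu; rewrite uE !count_cat /=.
have := row_moveE m; have := HE X (mem_head _ _).
case: X m uE {HE} => [[] s] //=; rewrite /movable /= => /eqP -> _ _ ->.
by rewrite xpair_eqE /=; case: eqP; lia.
Qed.

(** The test word of [w] moves all the entries of [w] to the diagonal. The block of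
    letters [F] of column [j] takes the entries of that column above the diagonal
    down: before its letters [F_r], the entries that started in the rows [<= r] are
    all in row [r], hence their number [nF w j r]. The columns come in decreasing
    order. Then the block of letters [E] of row [i] takes the entries below the
    diagonal that started in row [i] up, in increasing order of [i]. These orders
    are what makes [upper_moves] and [lower_moves] work. *)
Definition nF w j r := count (fun x => (x.2 == j :> nat) && (x.1 <= r)) w.
Definition nE w i r := count (fun x => (x.1 == i :> nat) && (x.2 <= r)) w.
Definition blockF w j := flatten [seq nseq (nF w j r) (false, r) | r <- iota 0 j].
Definition blockE w i := flatten [seq nseq (nE w i r) (true, r) | r <- rev (iota 0 i)].
Definition wordF w := flatten [seq blockF w j | j <- rev (iota 0 l.+1)].
Definition wordE w := flatten [seq blockE w i | i <- iota 0 l.+1].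
Definition wordFE w := wordF w ++ wordE w.

Let st (f : T -> nat) w : seq T := [seq (inord (f x), x.2) | x <- w].

Lemma moves_st (f g : T -> nat) X w :
  (X.2 < l) -> (forall x, f x <= l) -> 
  (forall x, g x = f x \/
    (if X.1 then f x = X.2.+1 /\ g x = X.2 else f x = X.2 /\ g x = X.2.+1)) ->
  moves (nseq (count (fun x => f x != g x) w) X) (st f w) (st g w).
Proof.
move=> Xl fl fg; elim: w => //= x w IH.
case: eqP => [<-|fgx] /=; first exact: moves_cons.
exists ((inord (g x), x.2) :: st f w); last exact: moves_cons.
rewrite mem_cat; apply/orP; left.
have: g x = (if X.1 then X.2 else X.2.+1) /\ movable X (inord (f x), x.2).
  case: (fg x) => [/esym//|]; rewrite /movable /=.
  case: ifP => _ [fx gx]; rewrite /= !inordK ?ltnS//; split=> //; first exact/eqP.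
  by rewrite fx eqxx.
by move=> [gE ->]; rewrite inE gE.
Qed.

Lemma moves_iota (B : nat -> seq (bool * nat)) (S : nat -> seq T) a n :
  (forall r, a <= r < a + n -> moves (B r) (S r) (S r.+1)) ->
  moves (flatten [seq B r | r <- iota a n]) (S a) (S (a + n)).
Proof.
elim: n a => [|n IH] a H /=; first by rewrite addn0.
apply/moves_cat; exists (S a.+1); first by apply: H; lia.
by rewrite addnS -addSn; apply: IH => r Hr; apply: H; lia.
Qed.

Lemma moves_rev_iota (B : nat -> seq (bool * nat)) (S : nat -> seq T) n :
  (forall r, r < n -> moves (B r) (S r.+1) (S r)) ->
  moves (flatten [seq B r | r <- rev (iota 0 n)]) (S n) (S 0).
Proof.
elim: n => [//|n IH] H; rewrite -[in iota _ _]addn1 iotaD rev_cat map_cat flatten_cat add0n /= cats0.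
apply/moves_cat; exists (S n); first exact: H.
by apply: IH => r Hr; apply: H; lia.
Qed.

Lemma st_eq (f g : T -> nat) w : (forall x, f x = g x) -> st f w = st g w.
Proof. by move=> fg; apply: eq_map => x; rewrite fg. Qed.

Lemma moves_wordFE w : moves (wordFE w) w [seq (x.2, x.2) | x <- w].
Proof.
(* [sF j]: the columns [>= j] have been taken down; [sE i]: the entries that
   started in the rows [< i] have also been taken up. *)
pose sF j := st (fun x => if j <= x.2 then maxn x.1 x.2 else x.1) w.
pose sE i := st (fun x => if x.1 < i then x.2 : nat else maxn x.1 x.2) w.
have wE : w = sF l.+1.
  rewrite /sF /st -[LHS]map_id; apply: eq_map => -[i j] /=.
  by rewrite leqNgt ltn_ord /= inord_val.
have mE : sF 0 = sE 0 by apply: st_eq => x.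
have w'E : [seq (x.2, x.2) | x <- w] = sE l.+1.
  by apply: eq_map => -[i j] /=; rewrite ltn_ord /= inord_val.
rewrite w'E [X in moves _ X]wE; apply/moves_cat; exists (sF 0).
  apply: moves_rev_iota => j jl.
  (* The state before the letters [F_r] of the block of column [j]. *)
  pose s r := st (fun x => if j < x.2 then maxn x.1 x.2 else
                           if x.2 == j :> nat then maxn x.1 r else x.1) w.
  have -> : sF j.+1 = s 0 by apply: st_eq => x; do 3?case: ifP; lia.
  have -> : sF j = s j.
    by apply: st_eq => x; case: ltngtP => // ->.
  rewrite -{2}[j]add0n; apply: moves_iota => r /andP[_]; rewrite add0n => rj.
  rewrite (_ : nF w j r = count (fun x =>
      (if j < x.2 then maxn x.1 x.2 else
       if x.2 == j :> nat then maxn x.1 r else x.1) !=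
      (if j < x.2 then maxn x.1 x.2 else
       if x.2 == j :> nat then maxn x.1 r.+1 else x.1)) w); last first.
    by apply: eq_count => x /=; case: ltngtP => ? /=; lia.
  apply: moves_st => /= [|x|x]; first by lia.
    by have := ltn_ord x.1; have := ltn_ord x.2; do 2?case: ifP; lia.
  by case: ltngtP => ?; lia.
rewrite mE -[sE l.+1]/(sE (0 + l.+1)); apply: moves_iota => i /andP[_]; rewrite add0n => il.
(* The state after the letters [E_r] of the block of row [i]. *)
pose s r := st (fun x => if x.1 < i then x.2 : nat else
                         if x.1 == i :> nat then maxn x.2 r else maxn x.1 x.2) w.
have -> : sE i = s i by apply: st_eq => x; case: ltngtP => // ->; rewrite maxnC.
have -> : sE i.+1 = s 0 by apply: st_eq => x; rewrite ltnS; case: ltngtP => //; lia.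
apply: moves_rev_iota => r ri.
rewrite (_ : nE w i r = count (fun x =>
    (if x.1 < i then x.2 : nat else
     if x.1 == i :> nat then maxn x.2 r.+1 else maxn x.1 x.2) !=
    (if x.1 < i then x.2 : nat else
     if x.1 == i :> nat then maxn x.2 r else maxn x.1 x.2)) w); last first.
  by apply: eq_count => x /=; case: ltngtP => ? /=; lia.
apply: moves_st => /= [|x|x]; first by lia.
  by have := ltn_ord x.1; have := ltn_ord x.2; do 2?case: ifP; lia.
by case: ltngtP => ?; lia.
Qed.

(** The corner counts: the entries in the rows [< a] and the columns [>= b], and in
    the rows [>= a] and the columns [< b]. The corner does not meet the diagonal
    when [a <= b], respectively [b <= a]. *)
Definition upper a b w := count (fun x => (x.1 < a) && (b <= x.2)) w.
Definition lower a b w := count (fun x => (a <= x.1) && (x.2 < b)) w.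
Definition diag_word w := all (fun x => x.1 == x.2) w.

Lemma count_flatten_nseq (e : bool) (r0 : nat) (n : nat -> nat) s :
  count_mem (e, r0) (flatten [seq nseq (n r) (e, r) | r <- s]) =
  \sum_(r <- s | r == r0) n r.
Proof.
elim: s => [|r s IH] /=; first by rewrite big_nil.
rewrite count_cat IH count_nseq big_cons /= xpair_eqE eqxx /=.
by case: eqP => _; rewrite ?mul1n ?mul0n.
Qed.

Lemma mem_wordF w s X :
  X \in flatten [seq blockF w j | j <- s] -> ~~ X.1 /\ exists2 j, j \in s & X.2 < j.
Proof.
case/flatten_mapP => j js /flatten_mapP[r]; rewrite mem_iota add0n => rj.
by rewrite mem_nseq => /andP[_ /eqP ->]; split=> //; exists j.
Qed.

Lemma mem_wordE w s X :
  X \in flatten [seq blockE w i | i <- s] -> X.1 /\ exists2 i, i \in s & X.2 < i.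
Proof.
case/flatten_mapP => j js /flatten_mapP[r]; rewrite mem_rev mem_iota add0n => rj.
by rewrite mem_nseq => /andP[_ /eqP ->]; split=> //; exists j.
Qed.

Lemma count_blockF w j r : r < j -> count_mem (false, r) (blockF w j) = nF w j r.
Proof.
move=> rj; rewrite /blockF count_flatten_nseq /=.
rewrite (big_rem r) ?mem_iota//= eqxx big1_seq ?addn0// => i /andP[/eqP->].
by rewrite mem_rem_uniq ?iota_uniq// inE eqxx.
Qed.

Lemma count_blockE w i r : r < i -> count_mem (true, r) (blockE w i) = nE w i r.
Proof.
move=> rj; rewrite /blockE count_flatten_nseq /=.
rewrite (big_rem r) ?mem_rev ?mem_iota//= eqxx big1_seq ?addn0// => k /andP[/eqP->].
by rewrite mem_rem_uniq ?rev_uniq ?iota_uniq// inE eqxx.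
Qed.

Lemma count_blocksF w (s : seq nat) r : uniq s -> (forall j, j \in s -> r < j) ->
  count_mem (false, r) (flatten [seq blockF w j | j <- s]) =
  count (fun x => ((x.2 : nat) \in s) && (x.1 <= r)) w.
Proof.
elim: s => [|j s IH] /=; first by rewrite count_pred0.
case/andP=> js us H; rewrite count_cat count_blockF ?H ?mem_head// IH//; last first.
  by move=> k ks; rewrite H// inE ks orbT.
rewrite /nF -count_predUI [X in _ + X](_ : _ = 0) ?addn0.
  by apply: eq_count => x /=; rewrite inE -andb_orl.
rewrite -(count_pred0 w); apply: eq_count => x /=.
by case: eqP => //= ->; rewrite (negPf js) /= andbF.
Qed.

Lemma count_blocksE w (s : seq nat) r : uniq s -> (forall j, j \in s -> r < j) ->
  count_mem (true, r) (flatten [seq blockE w j | j <- s]) =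
  count (fun x => ((x.1 : nat) \in s) && (x.2 <= r)) w.
Proof.
elim: s => [|j s IH] /=; first by rewrite count_pred0.
case/andP=> js us H; rewrite count_cat count_blockE ?H ?mem_head// IH//; last first.
  by move=> k ks; rewrite H// inE ks orbT.
rewrite /nE -count_predUI [X in _ + X](_ : _ = 0) ?addn0.
  by apply: eq_count => x /=; rewrite inE -andb_orl.
rewrite -(count_pred0 w); apply: eq_count => x /=.
by case: eqP => //= ->; rewrite (negPf js) /= andbF.
Qed.

(** The entries of [w1] in an upper corner must leave it. The blocks of the columns
    [>= b] contain exactly [upper a b w] letters [F_(a-1)], each of which takes at
    most one entry out of the corner. Later letters take no entry from the rows
    [< b] to the others, so by then the corner must be empty. *)
Lemma upper_moves w w1 w2 a b : a <= b -> moves (wordFE w) w1 w2 -> diag_word w2 ->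
  upper a b w1 <= upper a b w.
Proof.
case: a => [|i] ib; first by rewrite /upper (eq_count (a2 := pred0)) ?count_pred0.
move=> pw d2; have [lb|bl] := ltnP l b.
  rewrite /upper (eq_count (a2 := pred0)) ?count_pred0// => x /=.
  by have := ltn_ord x.2; lia.
move: pw; rewrite /wordFE /wordF -{1}(subnKC (leqW bl)) iotaD rev_cat add0n.
rewrite map_cat flatten_cat -catA => /moves_cat[u p1 p2].
have le1 : upper i.+1 b w1 <= upper i.+1 b u + upper i.+1 b w.
  apply: leq_trans (moves_count_le (D := pred1 (false, i)) _ p1) _.
    move=> [e r] x /mem_wordF[/= e0 _]; case: e e0 => // _.
    move=> m; have := row_moveE m; move: m; rewrite /movable /= => /andP[/eqP -> _] ->.
    by rewrite xpair_eqE /=; lia.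
  rewrite leq_add2l count_blocksF ?rev_uniq ?iota_uniq//.
    by apply: sub_count => x /=; rewrite mem_rev mem_iota ltnS; lia.
  by move=> j; rewrite mem_rev mem_iota; lia.
have le2 : upper b b u <= upper b b w2.
  apply: moves_count_mono p2.
  move=> X x Xh m; have := row_moveE m; move: Xh m; rewrite mem_cat.
  case/orP=> [/mem_wordF|/mem_wordE]; case: X => -[] r [//= _ [j]].
    rewrite mem_rev mem_iota /movable /= => jb rj /andP[/eqP -> _] ->.
    by lia.
  by rewrite /movable /= => _ _ /eqP -> ->; lia.
have le3 : upper i.+1 b u <= upper b b u.
  by apply: sub_count => x /=; lia.
have w20 : upper b b w2 = 0.
  apply/eqP; rewrite -leqn0 leqNgt -has_count; apply/hasPn => x /(allP d2) /eqP ->.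
  by rewrite ltnNge; case: (b <= _).
by lia.
Qed.

(** As for [upper_moves], with the order of the steps reversed: before the blocks of
    letters [E] of the rows [>= a] no entry leaves the rows [>= a], and these
    blocks contain exactly [lower a b w] letters [E_(b-1)]. *)
Lemma lower_moves w w1 w2 a b : b <= a -> moves (wordFE w) w1 w2 -> diag_word w2 ->
  lower a b w1 <= lower a b w.
Proof.
case: b => [|j] ja; first by rewrite /lower (eq_count (a2 := pred0)) ?count_pred0// => x; rewrite andbF.
move=> pw d2; have [la|al] := ltnP l a.
  rewrite /lower (eq_count (a2 := pred0)) ?count_pred0// => x /=.
  by have := ltn_ord x.1; lia.
move: pw; rewrite /wordFE /wordE -{1}(subnKC (leqW al)) iotaD add0n.
rewrite map_cat flatten_cat catA => /moves_cat[u p1 p2].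
have le1 : lower a j.+1 w1 <= lower a j.+1 u.
  apply: moves_count_mono p1.
  move=> X x Xh m; have := row_moveE m; move: Xh m; rewrite mem_cat.
  case/orP=> [/mem_wordF|/mem_wordE]; case: X => -[] r [//= _ [k]].
    by rewrite /movable /= => _ _ /andP[/eqP -> _] ->; lia.
  by rewrite mem_iota /movable /= => jb rj /eqP -> ->; lia.
have le2 : lower j.+1 j.+1 u <= lower j.+1 j.+1 w2 + lower a j.+1 w.
  apply: leq_trans (moves_count_le (D := pred1 (true, j)) _ p2) _.
    move=> [e r] x /mem_wordE[/= e0 _]; case: e e0 => // _.
    move=> m; have := row_moveE m; move: m; rewrite /movable /= => /eqP -> ->.
    by rewrite xpair_eqE /=; lia.
  rewrite leq_add2l count_blocksE ?iota_uniq//.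
    by apply: sub_count => x /=; rewrite mem_iota ltnS; lia.
  by move=> i; rewrite mem_iota; lia.
have le3 : lower a j.+1 u <= lower j.+1 j.+1 u.
  by apply: sub_count => x /=; lia.
have w20 : lower j.+1 j.+1 w2 = 0.
  apply/eqP; rewrite -leqn0 leqNgt -has_count; apply/hasPn => x /(allP d2) /eqP ->.
  by lia.
by lia.
Qed.

Definition mult (i j : 'I_l.+1) w := count_mem (i, j) w.

(** Inclusion and exclusion for the four corners that meet at an entry. *)
Lemma count_entry_upper w (i j : 'I_l.+1) : i < j ->
  mult i j w + upper i j w + upper i.+1 j.+1 w =
  upper i.+1 j w + upper i j.+1 w.
Proof.
move=> ij; rewrite /mult /upper; elim: w => //= -[a b] w; rewrite xpair_eqE /=.
by rewrite -(inj_eq val_inj a i) -(inj_eq val_inj b j) /=; lia.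
Qed.

Lemma count_entry_lower w (i j : 'I_l.+1) : j < i ->
  mult i j w + lower i.+1 j.+1 w + lower i j w =
  lower i j.+1 w + lower i.+1 j w.
Proof.
move=> ij; rewrite /mult /lower; elim: w => //= -[a b] w; rewrite xpair_eqE /=.
by rewrite -(inj_eq val_inj a i) -(inj_eq val_inj b j) /=; lia.
Qed.

Lemma count_row w (i : 'I_l.+1) :
  count (fun x => x.1 == i) w = \sum_(j < l.+1) mult i j w.
Proof.
rewrite /mult; elim: w => [|[a b] w IH] /=; first by rewrite big1.
rewrite big_split -IH /=; congr (_ + _).
case: eqP => [->|ai]; last by rewrite big1// => j _; rewrite xpair_eqE; case: eqP ai.
by rewrite (bigD1 b)//= eqxx big1// => j jb; rewrite xpair_eqE eq_sym (negPf jb) andbF.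
Qed.

(** The corner counts give the multiplicity of each entry off the diagonal, and the
    number of entries in each row then gives the diagonal ones. *)
Lemma perm_eq_words w1 w2 :
  (forall a b, a <= b -> upper a b w1 = upper a b w2) ->
  (forall a b, b <= a -> lower a b w1 = lower a b w2) ->
  (forall i : 'I_l.+1, count (fun x => x.1 == i) w1 = count (fun x => x.1 == i) w2) ->
  perm_eq w1 w2.
Proof.
move=> U L D; have off (i j : 'I_l.+1) : i != j -> mult i j w1 = mult i j w2.
  rewrite -(inj_eq val_inj) /=; case: ltngtP => // ij _.
    have := count_entry_upper w1 ij; have := count_entry_upper w2 ij.
    by rewrite !U; lia.
  have := count_entry_lower w1 ij; have := count_entry_lower w2 ij.
  by rewrite !L; lia.
apply/allP => -[i j] _ /=; apply/eqP; rewrite -2!/(mult i j _).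
have [->|] := eqVneq i j; last exact: off.
have := D j; rewrite !count_row !(bigD1 (P := predT) j)//=.
rewrite (eq_bigr (fun k => mult j k w2)); first by lia.
by move=> k kj; rewrite off// eq_sym.
Qed.

(** Summing the corner counts turns the triangularity of the test words into an
    induction on a natural number. *)
Definition weight w :=
  \sum_(a < l.+1) \sum_(b < l.+1)
    ((if a <= b then upper a b w else 0) + (if b <= a then lower a b w else 0)).

Lemma weight_perm w w' :
  (forall a b, a <= b -> upper a b w' <= upper a b w) ->
  (forall a b, b <= a -> lower a b w' <= lower a b w) ->
  (forall i : 'I_l.+1, count (fun x => x.1 == i) w' = count (fun x => x.1 == i) w) ->
  weight w' <= weight w /\ (weight w <= weight w' -> perm_eq w' w).
Proof.
move=> U L D.
have le (a b : 'I_l.+1) :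
    (if a <= b then upper a b w' else 0) + (if b <= a then lower a b w' else 0) <=
    (if a <= b then upper a b w else 0) + (if b <= a then lower a b w else 0).
  by apply: leq_add; case: ifP => // ab; [apply: U | apply: L].
split=> [|ge]; first by apply: leq_sum => a _; apply: leq_sum.
have eqs (a b : 'I_l.+1) :
    (if a <= b then upper a b w' else 0) + (if b <= a then lower a b w' else 0) =
    (if a <= b then upper a b w else 0) + (if b <= a then lower a b w else 0).
  apply/eqP; rewrite eqn_leq le leqNgt; apply/negP => lt.
  suff : weight w' < weight w by rewrite ltnNge ge.
  rewrite /weight (bigD1 (P := predT) a)//= [X in _ < X](bigD1 (P := predT) a)//=.
  rewrite -addSn; apply: leq_add; last by apply: leq_sum => c _; apply: leq_sum.
  rewrite (bigD1 (P := predT) b)//= [X in _ < X](bigD1 (P := predT) b)//=.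
  by rewrite -addSn; apply: leq_add => //; apply: leq_sum.
apply: perm_eq_words => // a b ab.
- have [bl|lb] := ltnP b l.+1; last first.
    by rewrite /upper !(eq_count (a2 := pred0)) ?count_pred0// => x /=;
      have := ltn_ord x.2; lia.
  have := eqs (Ordinal (leq_ltn_trans ab bl)) (Ordinal bl); rewrite /= ab.
  by have := U a b ab; case: ifP => [ba|_]; [have := L a b ba|]; lia.
- have [al|la] := ltnP a l.+1; last first.
    by rewrite /lower !(eq_count (a2 := pred0)) ?count_pred0// => x /=;
      have := ltn_ord x.1; lia.
  have := eqs (Ordinal al) (Ordinal (leq_ltn_trans ab al)); rewrite /= ab.
  by have := L a b ab; case: ifP => [ba|_]; [have := U a b ba|]; lia.
Qed.

(** * The words of the bottom row *)

Definition bottom (t : seq 'I_l.+1) : seq ('I_l.+1 * 'I_l.+1) :=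
  [seq (ord_max, j) | j <- t].

Lemma flatten_nil (S : Type) (f : nat -> seq S) s :
  (forall r, r \in s -> f r = [::]) -> flatten [seq f r | r <- s] = [::].
Proof.
elim: s => //= r s IH H; rewrite H ?mem_head// IH// => k ks.
by rewrite H// inE ks orbT.
Qed.

Lemma wordF_bottom t : wordF (bottom t) = [::].
Proof.
apply: flatten_nil => j; rewrite mem_rev mem_iota => jl.
apply: flatten_nil => r; rewrite mem_iota => rj.
rewrite /nF /bottom count_map (eq_count (a2 := pred0)) ?count_pred0// => i /=.
by have := ltn_ord (@ord_max l); rewrite leqNgt; case: ltngtP => //=; lia.
Qed.

Lemma nE_bottom t i r : nE (bottom t) i r =
  if i == l then count (fun j : 'I_l.+1 => j <= r) t else 0.
Proof.
rewrite /nE /bottom count_map; case: eqP => [->|il].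
  by apply: eq_count => j /=; rewrite eqxx.
by rewrite (eq_count (a2 := pred0)) ?count_pred0// => j /=; case: eqP => // /esym.
Qed.

Lemma wordE_recr w : wordE w = flatten [seq blockE w i | i <- iota 0 l] ++ blockE w l.
Proof. by rewrite /wordE -addn1 iotaD map_cat flatten_cat /= cats0. Qed.

Lemma wordE_bottom t : wordE (bottom t) = blockE (bottom t) l.
Proof.
rewrite wordE_recr flatten_nil// => i; rewrite mem_iota add0n => il.
apply: flatten_nil => r _; rewrite nE_bottom (_ : i == l = false)//.
by lia.
Qed.

(** Only the counts [nE w l r] enter the test word of such a [w], and diagonal
    entries do not contribute to them. *)
Lemma wordFE_bottom w t : wordF w = [::] ->
  flatten [seq blockE w i | i <- iota 0 l] = [::] ->
  (forall r, r < l -> nE w l r = count (fun j : 'I_l.+1 => j <= r) t) ->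
  wordFE w = wordFE (bottom t).
Proof.
move=> Fw Ew Ht; rewrite /wordFE Fw wordF_bottom wordE_bottom wordE_recr Ew /=.
rewrite /blockE; congr flatten; apply/eq_in_map => r.
by rewrite mem_rev mem_iota add0n nE_bottom eqxx => rl; rewrite Ht.
Qed.

Lemma blockES w i : blockE w i.+1 =
  nseq (nE w i.+1 i) (true, i) ++ flatten [seq nseq (nE w i.+1 r) (true, r) | r <- rev (iota 0 i)].
Proof. by rewrite /blockE -[in iota _ _]addn1 iotaD rev_cat. Qed.

(** The test word of a word of bottom entries has only letters [E], and an entry of
    the bottom row that ends in column [j] needs each [E_r] with [r >= j] once. So
    the numbers of letters [E_r] determine the columns. *)
Lemma bottom_perm t t' u : moves (wordFE (bottom t)) (bottom t') u -> diag_word u ->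
  size t = size t' -> perm_eq t t'.
Proof.
move=> pu du tt'; have cols := moves_cols pu.
have HE X : X \in wordFE (bottom t) -> X.1.
  by rewrite /wordFE wordF_bottom => /mem_wordE[].
have cnt r : r < l -> count (fun j : 'I_l.+1 => j <= r) t = count (fun j : 'I_l.+1 => j <= r) t'.
  move=> rl; have := moves_row_gt r HE pu.
  rewrite {1}/bottom count_map (eq_count (a2 := predT)) ?count_predT; last first.
    by move=> j /=; rewrite rl.
  rewrite /wordFE wordF_bottom wordE_bottom /= count_blockE// nE_bottom eqxx.
  rewrite (eq_in_count (a2 := fun x => r < x.2)); last by move=> x /(allP du)/eqP->.
  have -> : count (fun x => r < x.2) u = count (fun j : 'I_l.+1 => r < j) (unzip2 u).
    by rewrite /unzip2 count_map.
  rewrite -cols /bottom /unzip2 -map_comp map_id -tt'.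
  have := count_predC (fun j : 'I_l.+1 => j <= r) t'; rewrite tt'.
  rewrite (eq_count (a1 := predC _) (a2 := fun j : 'I_l.+1 => r < j)); first by lia.
  by move=> j /=; rewrite ltnNge.
have cnt' r : count (fun j : 'I_l.+1 => j <= r) t = count (fun j : 'I_l.+1 => j <= r) t'.
  have [/cnt//|lr] := ltnP r l.
  by rewrite !(eq_count (a2 := predT)) ?count_predT// => j /=; have := ltn_ord j; lia.
apply/allP => -[j jl] _ /=; apply/eqP.
have cj s : count_mem (Ordinal jl) s = count (fun i : 'I_l.+1 => i <= j) s -
    (if j is j'.+1 then count (fun i : 'I_l.+1 => i <= j') s else 0).
  elim: s => [|i s IH] /=; first by case: (j).
  rewrite IH -(inj_eq val_inj) /=.
  have : (if j is j'.+1 then count (fun i : 'I_l.+1 => i <= j') s else 0) <=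
      count (fun i : 'I_l.+1 => i <= j) s.
    by case: (j) => // j'; apply: sub_count => k /= /leqW.
  case: j {jl IH} => [|j]; first by rewrite leqn0; case: eqP => _; lia.
  by rewrite (leq_eqVlt i j.+1) ltnS; case: eqP => [->|_] /=; lia.
by rewrite !cj cnt'; case: (j) => // j'; rewrite cnt'.
Qed.

End WordMoves.

Local Open Scope ring_scope.

(** * Tensor products and the right action *)

Section Tensors.
Variables (F : fieldType) (V W : lmodType F).
Implicit Type t : tprod V W.

Let qZ (c : F) x : qpi (@tens_rel F V W) (c *: x) = c *: qpi (@tens_rel F V W) x.
Proof. exact: linearZ. Qed.

Lemma tensZl (c : F) (v : V) (w : W) : (c *: v) ⊗ w = c *: (v ⊗ w).
Proof. by rewrite /tens -qZ; apply/qpi_eq/lspan_ge; apply: tens_relZl. Qed.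
Lemma tensZr (c : F) (v : V) (w : W) : v ⊗ (c *: w) = c *: (v ⊗ w).
Proof. by rewrite /tens -qZ; apply/qpi_eq/lspan_ge; apply: tens_relZr. Qed.
Lemma tensDl (v v' : V) (w : W) : (v + v') ⊗ w = v ⊗ w + v' ⊗ w.
Proof.
rewrite /tens -qpiD; apply/qpi_eq/lspan_ge; rewrite opprD addrA.
exact: tens_relDl.
Qed.
Lemma tensDr (v : V) (w w' : W) : v ⊗ (w + w') = v ⊗ w + v ⊗ w'.
Proof.
rewrite /tens -qpiD; apply/qpi_eq/lspan_ge; rewrite opprD addrA.
exact: tens_relDr.
Qed.

Lemma tens_sumP t : exists s : seq (V * W), t = \sum_(k <- s) k.1 ⊗ k.2.
Proof.
exists [seq ((qrepr t)@_k *: k.1, k.2) | k <- msupp (qrepr t)].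
rewrite big_map -{1}[t]qreprK {1}[qrepr t]monalgE linear_sum.
apply: eq_bigr => -[a b] _; rewrite tensZl /= /tens -qZ; congr (qpi _ _).
by apply/malgP => k; rewrite mcoeffZ !mcoeffU mulrnAr mulr1.
Qed.

(** The target is only an abelian group, so the scalar comes out as an additive
    map [m]; this covers scalings by different module structures. *)
Lemma tliftZ (Z : zmodType) (f : V -> W -> Z) (c : F) (m : Z -> Z) t :
  {morph m : x y / x + y} ->
  (forall v v' w, f (v + v') w = f v w + f v' w) ->
  (forall v w w', f v (w + w') = f v w + f v w') ->
  (forall c v w, f (c *: v) w = f v (c *: w)) ->
  (forall v w, f (c *: v) w = m (f v w)) ->
  tlift f (c *: t) = m (tlift f t).
Proof.
move=> mD fDl fDr fZ fm; have [s ->] := tens_sumP t.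
have m0 : m 0 = 0 by apply: (addrI (m 0)); rewrite -mD !addr0.
rewrite tlift_sum// scaler_sumr (big_morph m mD m0).
under [X in tlift _ X]eq_bigr do rewrite -tensZl.
rewrite -(big_map (fun k => (c *: k.1, k.2)) xpredT (fun k => k.1 ⊗ k.2)).
by rewrite tlift_sum// big_map; apply: eq_bigr => k _; apply: fm.
Qed.

Lemma tlift_sumI (Z : zmodType) (f : V -> W -> Z) (I : Type) (r : seq I)
    (g : I -> V) (h : I -> W) :
  (forall v v' w, f (v + v') w = f v w + f v' w) ->
  (forall v w w', f v (w + w') = f v w + f v w') ->
  (forall c v w, f (c *: v) w = f v (c *: w)) ->
  tlift f (\sum_(i <- r) g i ⊗ h i) = \sum_(i <- r) f (g i) (h i).
Proof.
move=> fDl fDr fZ.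
by rewrite -(big_map (fun i => (g i, h i)) xpredT (fun k => k.1 ⊗ k.2))
  tlift_sum// big_map.
Qed.

Section Lift.
Variables (Z : lmodType F) (f : V -> W -> Z).
Hypothesis fDl : forall v v' w, f (v + v') w = f v w + f v' w.
Hypothesis fDr : forall v w w', f v (w + w') = f v w + f v w'.
Hypothesis fZl : forall c v w, f (c *: v) w = c *: f v w.
Hypothesis fZr : forall c v w, f v (c *: w) = c *: f v w.

Let fZ c v w : f (c *: v) w = f v (c *: w). Proof. by rewrite fZl fZr. Qed.

Lemma tlift_linear : linear (tlift f : tprod V W -> Z).
Proof.
move=> c t t'; rewrite tliftD//; congr (_ + _).
by apply: (@tliftZ Z f c ( *:%R c)) => // v w; rewrite ?scalerDr// fZl.
Qed.

End Lift.
End Tensors.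

Section Coassociativity.
Variables (F : fieldType) (A : lmodType F) (cp : {linear A -> tprod A A}).

(** [T3] and [b] stand for the triple tensor product and its tensor map. They are
    kept abstract so that the nested quotient is never unfolded. *)
Variables (T3 : lmodType F) (b : A -> tprod A A -> T3).
Hypothesis bDl : forall v v' t, b (v + v') t = b v t + b v' t.
Hypothesis bDr : forall v t t', b v (t + t') = b v t + b v t'.
Hypothesis bZl : forall c v t, b (c *: v) t = c *: b v t.
Hypothesis bZr : forall c v t, b v (c *: t) = c *: b v t.

Let assoc (y x1 x2 : A) : T3 := b x1 (x2 ⊗ y).

Let aDl y v v' w : assoc y (v + v') w = assoc y v w + assoc y v' w.
Proof. exact: bDl. Qed.
Let aDr y v w w' : assoc y v (w + w') = assoc y v w + assoc y v w'.
Proof. by rewrite /assoc tensDl bDr. Qed.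
Let aZl y c v w : assoc y (c *: v) w = c *: assoc y v w.
Proof. exact: bZl. Qed.
Let aZ y c v w : assoc y (c *: v) w = assoc y v (c *: w).
Proof. by rewrite /assoc tensZl bZl bZr. Qed.

Let assocE y (t : seq (A * A)) : tlift (assoc y) (\sum_(i <- t) i.1 ⊗ i.2) =
  \sum_(i <- t) b i.1 (i.2 ⊗ y).
Proof. exact: tlift_sum. Qed.

Let assocD (v v' w : A) : tlift (assoc w) (cp (v + v')) =
  tlift (assoc w) (cp v) + tlift (assoc w) (cp v').
Proof. by rewrite linearD tliftD. Qed.

Let assocZ c (v w : A) : tlift (assoc w) (cp (c *: v)) =
  c *: tlift (assoc w) (cp v).
Proof.
rewrite linearZ; apply: (@tliftZ _ _ _ T3 (assoc w) c ( *:%R c)) => //.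
exact: scalerDr.
Qed.

Let assocZZ c (v w : A) : tlift (assoc w) (cp (c *: v)) =
  tlift (assoc (c *: w)) (cp v).
Proof.
rewrite assocZ; have [u ->] := tens_sumP (cp v).
by rewrite !assocE scaler_sumr; apply: eq_bigr => i _; rewrite tensZr bZr.
Qed.

Let assocDr (v w w' : A) : tlift (assoc (w + w')) (cp v) =
  tlift (assoc w) (cp v) + tlift (assoc w') (cp v).
Proof.
have [u ->] := tens_sumP (cp v).
by rewrite !assocE -big_split; apply: eq_bigr => i _; rewrite tensDr bDr.
Qed.

Variables (h k : A -> F).
Hypotheses (hL : linear (h : A -> F^o)) (kL : linear (k : A -> F^o)).

Let lD (f : A -> F) (fL : linear (f : A -> F^o)) v w : f (v + w) = f v + f w.
Proof. by have := fL 1 v w; rewrite !scale1r. Qed.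
Let l0 (f : A -> F) (fL : linear (f : A -> F^o)) : f 0 = 0.
Proof. by apply: (addrI (f 0)); rewrite -lD// !addr0. Qed.
Let lZ (f : A -> F) (fL : linear (f : A -> F^o)) c v : f (c *: v) = c * f v.
Proof. by have := fL c v 0; rewrite !addr0 l0// addr0. Qed.

Let kDl (v v' w : A) : k (v + v') *: w = k v *: w + k v' *: w.
Proof. by rewrite lD// scalerDl. Qed.
Let kDr (v w w' : A) : k v *: (w + w') = k v *: w + k v *: w'.
Proof. exact: scalerDr. Qed.
Let kZl c (v w : A) : k (c *: v) *: w = c *: (k v *: w).
Proof. by rewrite lZ// scalerA. Qed.
Let kZ c (v w : A) : k (c *: v) *: w = k v *: (c *: w).
Proof. by rewrite kZl !scalerA mulrC. Qed.

Let g (t : tprod A A) := tlift (fun x y => k x *: y) t.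
Let gE v w : g (v ⊗ w) = k v *: w. Proof. exact: tlift_tens. Qed.
Let gD v w : g (v + w) = g v + g w. Proof. exact: tliftD. Qed.
Let gZ c v : g (c *: v) = c *: g v.
Proof. by apply: (@tliftZ _ _ _ A _ c ( *:%R c)) => //; apply: scalerDr. Qed.

Let gcZ c v w : h (c *: v) *: g (cp w) = h v *: g (cp (c *: w)).
Proof. by rewrite (linearZ_LR cp) gZ lZ// scalerA mulrC. Qed.
Let gcD v w w' : h v *: g (cp (w + w')) = h v *: g (cp w) + h v *: g (cp w').
Proof. by rewrite linearD gD scalerDr. Qed.

Variable G : T3 -> A.
Hypothesis GD : forall t t', G (t + t') = G t + G t'.
Hypothesis GT : forall v t, G (b v t) = h v *: g t.

Let Gsum I (r : seq I) f : G (\sum_(i <- r) f i) = \sum_(i <- r) G (f i).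
Proof.
elim: r => [|i r IH]; last by rewrite !big_cons GD IH.
by rewrite !big_nil; apply: (addrI (G 0)); rewrite -GD !addr0.
Qed.

(** Both sides are the contraction of the iterated coproduct of [a] with [h]
    and [k] in its first two legs. *)
Lemma coassoc_contract a :
  tlift (fun x y => tlift (fun x1 x2 => b x1 (x2 ⊗ y)) (cp x)) (cp a) =
    tlift (fun x y => b x (cp y)) (cp a) ->
  tlift (fun x y => tlift (fun x1 x2 => h x1 * k x2) (cp x) *: y) (cp a) =
    tlift (fun x y => h x *: tlift (fun x' y' => k x' *: y') (cp y)) (cp a).
Proof.
have hkDl v v' w : h (v + v') * k w = h v * k w + h v' * k w.
  by rewrite lD// mulrDl.
have hkDr v w w' : h v * k (w + w') = h v * k w + h v * k w'.
  by rewrite lD// mulrDr.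
have hkZl c v w : h (c *: v) * k w = c * (h v * k w) by rewrite lZ// mulrA.
have hkZr c v w : h v * k (c *: w) = c * (h v * k w) by rewrite lZ// mulrCA.
have hkZ c v w : h (c *: v) * k w = h v * k (c *: w) by rewrite hkZl hkZr.
have [s sE] := tens_sumP (cp a); rewrite sE.
rewrite (tlift_sum (f := fun x y => tlift (assoc y) (cp x))); first last.
- exact: assocZZ.
- exact: assocDr.
- exact: assocD.
rewrite (tlift_sum (f := fun x y => b x (cp y))); first last.
- by move=> c v w; rewrite linearZ bZl bZr.
- by move=> v w w'; rewrite linearD bDr.
- by move=> *; rewrite bDl.
move/(congr1 G); rewrite !Gsum => E.
rewrite tlift_sum; first last.
- move=> c v w; rewrite linearZ /= (tliftZ (m := *%R c))//; last exact: mulrDr.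
  by rewrite scalerA mulrC.
- by move=> v w w'; rewrite scalerDr.
- by move=> v v' w; rewrite linearD tliftD// scalerDl.
rewrite tlift_sum; first last.
- exact: gcZ.
- exact: gcD.
- by move=> v v' w; rewrite lD// scalerDl.
transitivity (\sum_(j <- s) G (tlift (assoc j.2) (cp j.1))).
  apply: eq_bigr => -[x y] _ /=; have [u ->] := tens_sumP (cp x).
  rewrite assocE Gsum tlift_sum// scaler_suml; apply: eq_bigr => i _.
  by rewrite GT gE scalerA.
by rewrite E; apply: eq_bigr => -[x y] _; rewrite GT.
Qed.
End Coassociativity.

Section ProductTensors.
Variables (F : numClosedFieldType) (A : algType F) (T : zmodType) (b : A -> A -> T).
Hypothesis bDl : forall v v' w, b (v + v') w = b v w + b v' w.
Hypothesis bDr : forall v w w', b v (w + w') = b v w + b v w'.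
Hypothesis bZ : forall c v w, b (c *: v) w = b v (c *: w).

Variables (Z : zmodType) (g : T -> Z) (f : A -> A -> Z).
Hypothesis gD : forall x y, g (x + y) = g x + g y.
Hypothesis gb : forall v w, g (b v w) = f v w.

(** The coproduct of a product, contracted by [g]. As in the coassociativity, the
    tensor map [b] is abstract. *)
Lemma tlift_mul_contract (ta tb : tprod A A) (s t : seq (A * A)) :
  ta = \sum_(i <- s) i.1 ⊗ i.2 -> tb = \sum_(j <- t) j.1 ⊗ j.2 ->
  g (tlift (fun x y => tlift (fun x' y' => b (x * x') (y * y')) tb) ta) =
  \sum_(i <- s) \sum_(j <- t) f (i.1 * j.1) (i.2 * j.2).
Proof.
move=> -> ->.
have g0 : g 0 = 0 by apply: (addrI (g 0)); rewrite -gD !addr0.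
have inner x y : tlift (fun x' y' => b (x * x') (y * y'))
    (\sum_(j <- t) j.1 ⊗ j.2) = \sum_(j <- t) b (x * j.1) (y * j.2).
  rewrite tlift_sum//.
  - by move=> v v' w; rewrite mulrDr bDl.
  - by move=> v w w'; rewrite mulrDr bDr.
  - by move=> c v w; rewrite -!scalerAr bZ.
rewrite tlift_sum.
- rewrite (big_morph g gD g0); apply: eq_bigr => i _; rewrite inner.
  by rewrite (big_morph g gD g0); apply: eq_bigr => j _; rewrite gb.
- move=> v v' w; rewrite !inner -big_split; apply: eq_bigr => i _.
  by rewrite mulrDl bDl.
- move=> v w w'; rewrite !inner -big_split; apply: eq_bigr => i _.
  by rewrite mulrDl bDr.
- move=> c v w; rewrite !inner; apply: eq_bigr => i _.
  by rewrite -!scalerAl bZ.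
Qed.
End ProductTensors.

Section HopfAction.
Variables (F : numClosedFieldType) (U A : algType F).
Variables (HU : hopf_star U) (HA : hopf_star A) (p : U -> A -> F).
Hypothesis Hp : hopf_pairing HU HA p.

Local Notation "a ◁ h" := (ract HA p a h) (at level 40, left associativity).

Let pDl h k a : p (h + k) a = p h a + p k a.
Proof. by have := pairing_linl Hp a 1 h k; rewrite scale1r mul1r. Qed.
Let pDr h a b : p h (a + b) = p h a + p h b.
Proof. by have := pairing_linr Hp h 1 a b; rewrite scale1r mul1r. Qed.
Let p0l a : p 0 a = 0.
Proof. by apply: (addrI (p 0 a)); rewrite -pDl !addr0. Qed.
Let p0r h : p h 0 = 0.
Proof. by apply: (addrI (p h 0)); rewrite -pDr !addr0. Qed.
Let pZl c h a : p (c *: h) a = c * p h a.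
Proof. by have := pairing_linl Hp a c h 0; rewrite !addr0 p0l addr0. Qed.
Let pZr c h a : p h (c *: a) = c * p h a.
Proof. by have := pairing_linr Hp h c a 0; rewrite !addr0 p0r addr0. Qed.

Lemma pairing_is_linear h : linear (p h : A -> F^o).
Proof. by move=> c a b; rewrite (pairing_linr Hp). Qed.
Definition pairing_lin h : A -> F^o := p h.
HB.instance Definition _ h :=
  GRing.isLinear.Build F A F^o _ (pairing_lin h) (pairing_is_linear h).

Lemma pairing_sum h I (r : seq I) (P : pred I) (f : I -> A) :
  p h (\sum_(i <- r | P i) f i) = \sum_(i <- r | P i) p h (f i).
Proof. exact: (linear_sum (pairing_lin h)). Qed.

Lemma pairingZ h c a : p h (c *: a) = c * p h a. Proof. exact: pZr. Qed.
Lemma pairing0 h : p h 0 = 0. Proof. exact: p0r. Qed.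
Lemma pairingB h a b : p h (a - b) = p h a - p h b.
Proof. exact: (linearB (pairing_lin h)). Qed.

Let rDl h (v v' w : A) : p h (v + v') *: w = p h v *: w + p h v' *: w.
Proof. by rewrite pDr scalerDl. Qed.
Let rDr h (v w w' : A) : p h v *: (w + w') = p h v *: w + p h v *: w'.
Proof. exact: scalerDr. Qed.
Let rZl h c (v w : A) : p h (c *: v) *: w = c *: (p h v *: w).
Proof. by rewrite pZr scalerA. Qed.
Let rZr h c (v w : A) : p h v *: (c *: w) = c *: (p h v *: w).
Proof. by rewrite !scalerA mulrC. Qed.
Let rZ h c (v w : A) : p h (c *: v) *: w = p h v *: (c *: w).
Proof. by rewrite rZl rZr. Qed.

Let pp_bil h k : [/\ forall x x' y, p h (x + x') * p k y = p h x * p k y + p h x' * p k y,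
  forall x y y', p h x * p k (y + y') = p h x * p k y + p h x * p k y',
  forall c x y, p h (c *: x) * p k y = c * (p h x * p k y)
  & forall c x y, p h x * p k (c *: y) = c * (p h x * p k y)].
Proof.
by split=> *; rewrite ?pDr ?pZr ?mulrDl ?mulrDr ?mulrA// -mulrA mulrCA mulrA.
Qed.

Lemma ract_linear h : linear (ract HA p ^~ h).
Proof.
by move=> c a b; rewrite /ract linearP; apply: tlift_linear.
Qed.
Definition ract_lin h : A -> A := ract HA p ^~ h.
HB.instance Definition _ h :=
  GRing.isLinear.Build F A A _ (ract_lin h) (ract_linear h).

Lemma ract_sum h I (r : seq I) (P : pred I) (f : I -> A) :
  (\sum_(i <- r | P i) f i) ◁ h = \sum_(i <- r | P i) (f i ◁ h).
Proof. exact: (linear_sum (ract_lin h)). Qed.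
Lemma ractZ h c a : (c *: a) ◁ h = c *: (a ◁ h).
Proof. exact: (linearZ_LR (ract_lin h)). Qed.
Lemma ractD h a b : (a + b) ◁ h = a ◁ h + b ◁ h.
Proof. exact: (linearD (ract_lin h)). Qed.
Lemma ract0 h : 0 ◁ h = 0.
Proof. exact: (linear0 (ract_lin h)). Qed.

Let ractE a h s : cop HA a = \sum_(k <- s) k.1 ⊗ k.2 ->
  a ◁ h = \sum_(k <- s) p h k.1 *: k.2.
Proof. by move=> sE; rewrite /ract sE tlift_sum. Qed.

Lemma ract_sumE a h I (r : seq I) (f g : I -> A) :
  cop HA a = \sum_(i <- r) f i ⊗ g i ->
  a ◁ h = \sum_(i <- r) p h (f i) *: g i.
Proof. by move=> E; rewrite /ract E tlift_sumI. Qed.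

Lemma ractPl a c h k : a ◁ (c *: h + k) = c *: (a ◁ h) + a ◁ k.
Proof.
have [s sE] := tens_sumP (cop HA a); rewrite !(ractE _ sE) scaler_sumr -big_split.
by apply: eq_bigr => x _ /=; rewrite (pairing_linl Hp) scalerDl scalerA.
Qed.
Lemma ractDl a h k : a ◁ (h + k) = a ◁ h + a ◁ k.
Proof. by have := ractPl a 1 h k; rewrite !scale1r. Qed.
Lemma ract0l a : a ◁ 0 = 0.
Proof. by apply: (addrI (a ◁ 0)); rewrite -ractDl !addr0. Qed.
Lemma ractZl a c h : a ◁ (c *: h) = c *: (a ◁ h).
Proof. by have := ractPl a c h 0; rewrite ract0l !addr0. Qed.
Lemma ractBl a h k : a ◁ (h - k) = a ◁ h - a ◁ k.
Proof. by rewrite ractDl -scaleN1r ractZl scaleN1r. Qed.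

Lemma pairing_ract h k a : p (h * k) a = p k (a ◁ h).
Proof.
have [b1 b2 b3 b4] := pp_bil h k.
rewrite (pairing_mull Hp); have [s sE] := tens_sumP (cop HA a).
rewrite (ractE _ sE) sE pairing_sum tlift_sum; [|done|done|]; last first.
  by move=> c v w; rewrite b3 b4.
by apply: eq_bigr => x _; rewrite pZr.
Qed.

Lemma ract1r a : a ◁ 1 = a.
Proof.
have [s sE] := tens_sumP (cop HA a); rewrite (ractE _ sE).
have: tlift (fun x y => cou HA x *: y) (cop HA a) = a by case: HA.
rewrite sE tlift_sum.
- by move=> E; rewrite -[RHS]E; apply: eq_bigr => x _; rewrite (pairing_1l Hp).
- by move=> v v' w; rewrite linearD scalerDl.
- by move=> v v' w; rewrite scalerDr.
- by move=> c v w; rewrite linearZ /= scalerA mulrC.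
Qed.

Let gD k t t' : tlift (fun x y : A => p k x *: y) (t + t') =
  tlift (fun x y : A => p k x *: y) t + tlift (fun x y : A => p k x *: y) t'.
Proof. exact: tliftD. Qed.
Let gZ k c t : tlift (fun x y : A => p k x *: y) (c *: t) =
  c *: tlift (fun x y : A => p k x *: y) t.
Proof. by apply: (@tliftZ _ _ _ A _ c ( *:%R c)) => //; apply: scalerDr. Qed.

(** Coassociativity, contracted with [h] and [k] in the first two legs. *)
Lemma ractM a h k : a ◁ (h * k) = (a ◁ h) ◁ k.
Proof.
pose G (t : tprod A (tprod A A)) : A :=
  tlift (fun x t => p h x *: tlift (fun y z : A => p k y *: z) t) t.
have h1 (v v' : A) (t : tprod A A) : p h (v + v') *: tlift (fun y z : A => p k y *: z) t =
    p h v *: tlift (fun y z : A => p k y *: z) t +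
    p h v' *: tlift (fun y z : A => p k y *: z) t by rewrite pDr scalerDl.
have h2 (v : A) (t t' : tprod A A) : p h v *: tlift (fun y z : A => p k y *: z) (t + t') =
    p h v *: tlift (fun y z : A => p k y *: z) t +
    p h v *: tlift (fun y z : A => p k y *: z) t'.
  by rewrite -scalerDr; congr (_ *: _); apply: gD.
have h3 c (v : A) (t : tprod A A) : p h (c *: v) *: tlift (fun y z : A => p k y *: z) t =
    p h v *: tlift (fun y z : A => p k y *: z) (c *: t).
  by rewrite pZr mulrC -scalerA; congr (_ *: _); symmetry; apply: gZ.
have := @coassoc_contract F A (cop HA) _ (@tens F A (tprod A A))
  (@tensDl _ _ _) (@tensDr _ _ _) (@tensZl _ _ _) (@tensZr _ _ _)
  (p h) (p k) (pairing_is_linear h) (pairing_is_linear k) G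
  (tliftD h1 h2 h3) (tlift_tens h1 h2 h3) a.
have coA : tlift (fun x y => tlift (fun x1 x2 => x1 ⊗ (x2 ⊗ y)) (cop HA x)) (cop HA a) =
    tlift (fun x y => x ⊗ cop HA y) (cop HA a) by case: HA.
move=> /(_ coA) E.
have -> : a ◁ (h * k) =
    tlift (fun x y => tlift (fun x1 x2 => p h x1 * p k x2) (cop HA x) *: y) (cop HA a).
  by congr (tlift _ _); apply/funext => x; rewrite (pairing_mull Hp).
rewrite E; have [s sE] := tens_sumP (cop HA a).
rewrite (ractE _ sE) ract_sum sE tlift_sum; first last.
- by move=> c v w; rewrite (linearZ_LR (cop HA)) h3.
- by move=> v w w'; rewrite linearD h2.
- by move=> v v' w; rewrite h1.
by apply: eq_bigr => i _; rewrite ractZ.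
Qed.

(** The product rule of a module algebra: the coproduct is multiplicative, and the
    pairing turns products in [A] into coproducts in [U]. *)
Lemma ract_mul I (r : seq I) (h1 h2 : I -> U) a b h :
  cop HU h = \sum_(i <- r) h1 i ⊗ h2 i ->
  (a * b) ◁ h = \sum_(i <- r) (a ◁ h1 i) * (b ◁ h2 i).
Proof.
move=> hE.
have cM : cop HA (a * b) =
    tlift (fun x y => tlift (fun x' y' => (x * x') ⊗ (y * y')) (cop HA b)) (cop HA a).
  by case: HA.
have [s sE] := tens_sumP (cop HA a); have [t tE] := tens_sumP (cop HA b).
have tZ c (v w : A) : (c *: v) ⊗ w = v ⊗ (c *: w) by rewrite tensZl tensZr.
have abE : (a * b) ◁ h = \sum_(i <- s) \sum_(j <- t) p h (i.1 * j.1) *: (i.2 * j.2).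
  have := @tlift_mul_contract F A (tprod A A) (@tens F A A)
    (@tensDl F A A) (@tensDr F A A) tZ A (tlift (fun x y => p h x *: y))
    (fun x y => p h x *: y) (tliftD (rDl h) (rDr h) (rZ h))
    (tlift_tens (rDl h) (rDr h) (rZ h)) _ _ s t sE tE.
  by rewrite /ract cM.
rewrite abE.
have pE x y : p h (x * y) = \sum_(i <- r) p (h1 i) x * p (h2 i) y.
  rewrite (pairing_mulr Hp) hE.
  rewrite tlift_sumI//.
  - by move=> v v' w; rewrite pDl mulrDl.
  - by move=> v w w'; rewrite pDl mulrDr.
  - by move=> c v w; rewrite !pZl mulrCA mulrA.
under eq_bigr do under eq_bigr do rewrite pE scaler_suml.
under eq_bigr do rewrite exchange_big.
rewrite exchange_big; apply: eq_bigr => i _.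
rewrite (ractE _ sE) (ractE _ tE) mulr_suml; apply: eq_bigr => x _.
rewrite mulr_sumr; apply: eq_bigr => y _.
by rewrite -scalerAl -scalerAr scalerA.
Qed.

Lemma ract1 h : 1 ◁ h = cou HU h *: 1.
Proof.
have E : cop HA 1 = \sum_(i <- [:: tt]) 1 ⊗ 1 by rewrite big_seq1; case: HA.
by rewrite (ract_sumE _ E) big_seq1 (pairing_1r Hp).
Qed.

End HopfAction.

(** * Monomials of the quantum space and the q-multinomial identity *)

Section QuantumSpaceMonomials.
Variables (F : fieldType) (q : F) (n : nat).
Implicit Types (w : seq 'I_n).

(** The scalar by which the product along a word differs from the ordered monomial
    with the same content: each letter passes the smaller letters on its right. *)
Fixpoint kappa w : F :=
  if w is i :: w' then kappa w' * q ^- count (fun s : 'I_n => (s < i)%N) w' else 1.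

Lemma kappa_neq0 w : q != 0 -> kappa w != 0.
Proof.
move=> q0; elim: w => /= [|i w IH]; first exact: oner_neq0.
by rewrite mulf_neq0// invr_neq0// expf_neq0.
Qed.

Variables (A : algType F) (z : 'I_n -> A).
Hypothesis q0 : q != 0.
Hypothesis zz : forall i j : 'I_n, (i < j)%N -> z i * z j = q *: (z j * z i).

Let zjzi (i k : 'I_n) c : (k < i)%N -> z i * z k ^+ c = q ^- c *: (z k ^+ c * z i).
Proof.
move=> ki; elim: c => [|c IH]; first by rewrite !expr0 mulr1 mul1r invr1 scale1r.
have zkzi : z i * z k = q^-1 *: (z k * z i) by rewrite (zz ki) scalerA mulVf// scale1r.
rewrite [in LHS]exprSr mulrA IH -scalerAl -(mulrA (z k ^+ c)) zkzi.
by rewrite -scalerAr scalerA mulrA -exprSr (exprS q) invfM mulrC.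
Qed.

Let insert i (c : 'I_n -> nat) (ks : seq 'I_n) :
  sorted (fun a b : 'I_n => (a < b)%N) ks -> i \in ks ->
  z i * (\prod_(k <- ks) z k ^+ c k) =
  q ^- (\sum_(k <- ks | (k < i)%N) c k)%N *:
    \prod_(k <- ks) z k ^+ ((i == k) + c k).
Proof.
elim: ks => //= k ks IH pk.
have [sk /allP mk] : sorted (fun a b : 'I_n => (a < b)%N) ks /\ all (fun j : 'I_n => (k < j)%N) ks.
  split; first exact: path_sorted pk.
  by apply: order_path_min pk => a b d; apply: ltn_trans.
rewrite inE !big_cons => /orP[/eqP->|iks].
  have -> : (\sum_(j <- ks | (j < k)%N) c j = 0)%N.
    by rewrite big1_seq// => j /andP[jk /mk /=]; lia.
  rewrite ltnn eqxx invr1 scale1r.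
  rewrite mulrA -exprS; congr (_ * _); apply: eq_big_seq => j /mk /=.
  by case: eqP => // ->; lia.
have /= ki := mk _ iks; rewrite ki (negPf (_ : i != k)) ?add0n; last first.
  by apply: contraTneq ki => ->; rewrite ltnn.
rewrite mulrA zjzi// -scalerAl -mulrA IH// -scalerAr scalerA.
by rewrite exprD invfM mulrC.
Qed.

Definition ordmon w : A := \prod_(k < n) z k ^+ count_mem k w.

Lemma prod_ordmon w : \prod_(i <- w) z i = kappa w *: ordmon w.
Proof.
elim: w => [|i w IH] /=.
  by rewrite big_nil /ordmon big1 ?scale1r// => k _; rewrite expr0.
rewrite big_cons IH -scalerAr /ordmon.
have sE : sorted (fun a b : 'I_n => (a < b)%N) (index_enum 'I_n).
  rewrite -[index_enum _]enumT -(@sorted_map _ _ val ltn) val_enum_ord.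
  exact: iota_ltn_sorted.
rewrite insert ?mem_index_enum// scalerA; congr (_ / q ^+ _ *: _).
elim: w {IH} => [|j w IH]; first by rewrite big1.
rewrite /= big_split IH /=; congr (_ + _)%N.
rewrite big_mkcond (bigD1 j)//= eqxx big1 ?addn0.
  by case: (j < i)%N.
by move=> k; rewrite eq_sym => /negPf->; case: ifP.
Qed.

Lemma ordmon_perm w1 w2 : perm_eq w1 w2 -> ordmon w1 = ordmon w2.
Proof. by move/seq.permP=> pw; apply: eq_bigr => k _; rewrite pw. Qed.

End QuantumSpaceMonomials.

Section WordsOfLength.
Variable n : nat.

Fixpoint words (N : nat) : seq (seq 'I_n) :=
  if N is N'.+1 then [seq i :: w | i <- enum 'I_n, w <- words N'] else [:: [::]].

Lemma mem_words N w : (w \in words N) = (size w == N).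
Proof.
elim: N w => [|N IH] [|i w] //=; first by apply/negP => /allpairsP[[? ?] []].
rewrite eqSS -IH; apply/allpairsP/idP => [[[j v] /= [_ vw [_ ->]]]//|wN].
by exists (i, w); rewrite mem_enum.
Qed.

Lemma words_uniq N : uniq (words N).
Proof.
elim: N => //= N IH; apply: allpairs_uniq; rewrite ?enum_uniq//.
by move=> [i w] [j v] _ _ [-> ->].
Qed.

End WordsOfLength.

Section QMultinomial.
Variables (R : realType) (q : R) (l : nat).
Hypothesis q01 : 0 < q < 1.
Local Notation I := 'I_l.+1.
Implicit Types (J : I -> nat).

Let q_gt0 : 0 < q. Proof. by case/andP: q01. Qed.
Let q_neq0 : q != 0. Proof. by rewrite gt_eqF. Qed.
Let den : q - q^-1 != 0.
Proof.
rewrite subr_eq0; apply/negP => /eqP E; have := mulfV q_neq0; rewrite -E => q2.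
by case/andP: q01 => _; rewrite -(expr_lt1 (n := 2))// ?ltW// expr2 q2 ltxx.
Qed.

Lemma qint_neq0 m : (0 < m)%N -> qint q m != 0.
Proof.
move=> m0; rewrite /qint mulf_neq0 ?invr_neq0// subr_eq0; apply/negP => /eqP E.
have := mulfV (expf_neq0 m q_neq0); rewrite -E -expr2 -exprM => /eqP.
rewrite -[X in _ == X](expr1n _ (m * 2)) eqrXn2 ?muln_gt0 ?m0 ?ltW// => /eqP q1.
by move: q01; rewrite q1 ltxx andbF.
Qed.

Lemma qfact_neq0 m : qfact q m != 0.
Proof.
rewrite /qfact prodf_seq_neq0; apply/allP => i; rewrite mem_index_iota => /andP[i0 _].
exact: qint_neq0.
Qed.

Lemma qfactS m : qfact q m.+1 = qfact q m * qint q m.+1.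
Proof. by rewrite /qfact big_nat_recr. Qed.

(** The q-analogue of [j_0 + ... + j_l = n], which underlies Pascal's rule for the
    q-multinomial coefficients. *)
Lemma qint_sum J :
  \sum_(i < l.+1) q ^ ((\sum_(k < l.+1 | (i < k)%N) J k)%:Z
                       - (\sum_(k < l.+1 | (k < i)%N) J k)%:Z) * qint q (J i) =
  qint q (\sum_k J k).
Proof.
(* With [P m] the partial sums and [t] the total, the term of index [i] is the
   difference of the values of [q ^ (t - 2 P m)] at [m = i] and [m = i + 1], up to
   a common factor; the sum telescopes. *)
pose P m := (\sum_(k < l.+1 | (k < m)%N) J k)%N.
have PS (i : I) : P i.+1 = (P i + J i)%N.
  rewrite /P (bigD1 i) ?ltnSn//= addnC; congr (_ + _)%N; apply: eq_bigl => k.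
  by rewrite ltnS ltn_neqAle andbC.
have PT (i : I) : (P i.+1 + \sum_(k < l.+1 | (i < k)%N) J k)%N = (\sum_k J k)%N.
  rewrite /P [RHS](bigID (fun k : I => (k < i.+1)%N)) /=; congr (_ + _)%N.
  by apply: eq_bigl => k; rewrite -leqNgt.
set t := (\sum_k J k)%N in PT *.
have term (i : I) : q ^ ((\sum_(k < l.+1 | (i < k)%N) J k)%:Z
    - (\sum_(k < l.+1 | (k < i)%N) J k)%:Z) * qint q (J i) =
    (q ^ (t%:Z - (P i)%:Z *+ 2) - q ^ (t%:Z - (P i.+1)%:Z *+ 2)) / (q - q^-1).
  rewrite /qint mulrA; congr (_ / _); rewrite mulrBr exprnN exprnP -!expfzDr//.
  rewrite -/(P i); congr (_ ^ _ - _ ^ _); have := PT i; have := PS i; lia.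
rewrite (eq_bigr _ (fun i _ => term i)) -mulr_suml /qint; congr (_ / _).
rewrite -(big_mkord xpredT (fun i => q ^ (t%:Z - (P i)%:Z *+ 2) - q ^ (t%:Z - (P i.+1)%:Z *+ 2))).
rewrite (@telescope_sumr_eq _ 0 l.+1 (fun i => - q ^ (t%:Z - (P i)%:Z *+ 2)))//; last first.
  by move=> i _; rewrite opprK addrC.
rewrite opprK addrC exprnN exprnP; congr (_ ^ _ - _ ^ _).
  by rewrite /P big1 //; lia.
rewrite (_ : P l.+1 = t); last by apply: eq_bigl => k; rewrite ltn_ord.
by lia.
Qed.

Let pairs J := (\sum_(r < l.+1) \sum_(s < l.+1 | (r < s)%N) J r * J s)%N.

Let pairsS J (i : I) : pairs (fun k => (i == k) + J k)%N =
  (pairs J + (\sum_(k < l.+1 | (i < k)%N) J k) + (\sum_(k < l.+1 | (k < i)%N) J k))%N.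
Proof.
pose d (k : I) := (i == k : nat).
have dE (P : pred I) (f : I -> nat) : (\sum_(k | P k) d k * f k = P i * f i)%N.
  rewrite big_mkcond (bigD1 i)//= /d eqxx mul1n big1 ?addn0.
    by case: (P i); rewrite ?mul1n ?mul0n.
  by move=> k; rewrite eq_sym => /negPf->; case: ifP.
transitivity (\sum_(r < l.+1) \sum_(s < l.+1 | (r < s)%N)
    (J r * J s + d r * J s + d s * J r))%N.
  apply: eq_bigr => r _; apply: eq_bigr => s rs.
  rewrite mulnDl !mulnDr -/(d r) -/(d s).
  have -> : (d r * d s = 0)%N.
    rewrite /d; case: eqP => // ir; case: eqP => // si.
    by move: rs; rewrite -ir -si ltnn.
  by rewrite (mulnC (J r)); lia.
under eq_bigr do rewrite !big_split /=.
rewrite !big_split /= -/(pairs J); congr (_ + _ + _)%N.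
  under eq_bigr do rewrite -big_distrr /=.
  by rewrite (dE predT (fun r => \sum_(s < l.+1 | (r < s)%N) J s)%N) mul1n.
under eq_bigr do rewrite (dE (fun s => (_ < s)%N)).
by rewrite [RHS]big_mkcond; apply: eq_bigr => r _; case: (r < i)%N; rewrite ?mul1n.
Qed.

Lemma qmult_ext J J' : J =1 J' -> qmult q J = qmult q J'.
Proof.
move=> E; rewrite /qmult; congr (_ ^- _ * qfact _ _ / _).
- by apply: eq_bigr => r _; apply: eq_bigr => s _; rewrite !E.
- exact: eq_bigr.
- by apply: eq_bigr => r _; rewrite E.
Qed.

Let qmultS J (i : I) :
  qmult q (fun k => (i == k) + J k)%N * qint q (J i).+1 *
    q ^ ((\sum_(k < l.+1 | (i < k)%N) J k)%:Z + (\sum_(k < l.+1 | (k < i)%N) J k)%:Z) =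
  qmult q J * qint q (\sum_k J k).+1.
Proof.
rewrite /qmult -!/(pairs _) pairsS.
have -> : (\sum_(k < l.+1) ((i == k) + J k) = (\sum_k J k).+1)%N.
  by rewrite big_split /= (bigD1 i)//= eqxx big1 // => k; rewrite eq_sym => /negPf->.
have -> : \prod_(k < l.+1) qfact q ((i == k) + J k) =
    (\prod_(k < l.+1) qfact q (J k)) * qint q (J i).+1.
  rewrite (bigD1 i)//= eqxx add1n qfactS [in RHS](bigD1 i)//= mulrAC; congr (_ * _ * _).
  by apply: eq_bigr => k; rewrite eq_sym => /negPf->.
rewrite qfactS exprnN !PoszD !opprD !expfzDr//.
have p0 : \prod_(k < l.+1) qfact q (J k) != 0 by apply/prodf_neq0 => k _; exact: qfact_neq0.
have i0 : qint q (J i).+1 != 0 by exact: qint_neq0.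
set a := (\sum_(k < _ | _) _)%N; set b := (\sum_(k < _ | _) _)%N.
have a0 := expfz_neq0 a q_neq0; have b0 := expfz_neq0 b q_neq0.
have c0 := expfz_neq0 (pairs J) q_neq0.
by rewrite -!invr_expz !exprnP; field; rewrite i0 p0 c0 b0 a0.
Qed.

(** The q-multinomial coefficient counts the words of content [J] weighted by
    [kappa ^+ 2]. Removing the first letter [i] costs the square of the scalar for
    passing the smaller letters, which gives the q-analogue of Pascal's rule. *)
Lemma sum_kappa_sqr N J : (\sum_k J k = N)%N ->
  \sum_(w <- words l.+1 N | [forall k, count_mem k w == J k]) kappa q w ^+ 2 =
  qmult q J.
Proof.
elim: N J => [|N IH] J JN.
  have J0 k : J k = 0%N by apply/eqP; move/eqP: JN; rewrite sum_nat_eq0 => /forallP/(_ k).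
  rewrite /= big_mkcond big_seq1 /= ifT; last by apply/forallP => k; rewrite J0.
  rewrite /qmult; have -> : \prod_(k < l.+1) qfact q (J k) = 1.
    by rewrite big1// => k _; rewrite J0 /qfact big_geq.
  have -> : (\sum_(r < l.+1) \sum_(s < l.+1 | (r < s)%N) J r * J s = 0)%N.
    by rewrite big1// => r _; rewrite big1// => s _; rewrite J0.
  by rewrite expr1n JN expr0 invr1 /qfact big_geq// ?mulr1 ?invr1.
rewrite /= big_mkcond big_allpairs_dep /= big_enum /=.
have q1 : q - q^-1 != 0 by exact: den.
transitivity (\sum_(i < l.+1) qmult q J / qint q N.+1 *
  (q ^ ((\sum_(k < l.+1 | (i < k)%N) J k)%:Z - (\sum_(k < l.+1 | (k < i)%N) J k)%:Z)
   * qint q (J i))); last first.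
  by rewrite -mulr_sumr qint_sum JN divfK// qint_neq0.
apply: eq_bigr => i _; rewrite -big_mkcond /=.
case Ji: (J i) => [|m].
  rewrite big_pred0 => [|w]; first by rewrite /qint !expr0 invr1 subrr mul0r !mulr0.
  by apply/negP => /forallP/(_ i); rewrite eqxx Ji.
pose J' k := (J k - (i == k))%N.
have JE k : J k = ((i == k) + J' k)%N by rewrite /J'; case: eqP => [<-|_]; lia.
have J'N : (\sum_k J' k = N)%N.
  move: JN; rewrite (eq_bigr _ (fun k _ => JE k)) big_split /= (bigD1 i)//= eqxx big1.
    by lia.
  by move=> k; rewrite eq_sym => /negPf->.
have cond w : [forall k, (i == k) + count_mem k w == J k]%N = [forall k, count_mem k w == J' k].
  by apply: eq_forallb => k; rewrite JE eqn_add2l.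
rewrite (eq_bigl _ _ cond).
have off (P : pred I) : ~~ P i -> (\sum_(k < l.+1 | P k) J k = \sum_(k < l.+1 | P k) J' k)%N.
  move=> Pi; apply: eq_bigr => k Pk; rewrite JE (negPf (_ : i != k))//.
  by apply: contraNneq Pi => ->.
have term w : [forall k, count_mem k w == J' k] ->
    (kappa q w / q ^+ count (fun s : I => (s < i)%N) w) ^+ 2 =
    q ^- ((\sum_(k < l.+1 | (k < i)%N) J k) * 2) * kappa q w ^+ 2.
  move=> /forallP cw; rewrite exprMn mulrC exprVn -exprM; congr (q ^- (_ * 2) * _).
  rewrite off ?ltnn// -(eq_bigr _ (fun k _ => eqP (cw k))).
  elim: w {cw} => [|j w IHw]; first by rewrite big1.
  rewrite /= big_split IHw /=; congr (_ + _)%N.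
  rewrite big_mkcond (bigD1 j)//= eqxx big1 ?addn0; first by case: (j < i)%N.
  by move=> k; rewrite eq_sym => /negPf->; case: ifP.
rewrite (eq_bigr _ term) -mulr_sumr IH//.
have := qmultS J' i; rewrite J'N -(qmult_ext JE).
have -> : (J' i).+1 = m.+1 by have := JE i; rewrite Ji eqxx; lia.
rewrite -off ?ltnn// -off ?ltnn//.
set a := (\sum_(k < _ | _) _)%N; set b := (\sum_(k < _ | _) _)%N => E.
have N0 : qint q N.+1 != 0 by exact: qint_neq0.
have -> : qmult q J' = qmult q J * qint q m.+1 * q ^ (a%:Z + b%:Z) / qint q N.+1.
  by rewrite E mulfK.
rewrite !expfzDr// -invr_expz exprnN -[(b * 2)%N]/(muln b 2) muln2 -addnn PoszD opprD expfzDr//.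
rewrite -!invr_expz; have b0 := expfz_neq0 b q_neq0.
by field; rewrite N0 b0.
Qed.

Lemma qmult_ge0 J : 0 <= qmult q J.
Proof.
rewrite -(sum_kappa_sqr (erefl _)); apply: sumr_ge0 => w _.
exact: sqr_ge0.
Qed.

End QMultinomial.

(** * Eigenvectors and straightening *)

Section EigenFilter.
Variables (F : fieldType) (V : lmodType F) (I : Type) (v : I -> V).

(** Eigenvectors of different eigenvalues are independent, for vectors [v i] that
    are given as a family with possible repetitions and zeros. *)
Lemma eigen_vanish (D : V -> V) (mu : I -> F) (la : F) (r : seq I) (y : V) :
  {morph D : x y / x + y} -> (forall c x, D (c *: x) = c *: D x) ->
  (forall i, D (v i) = mu i *: v i) -> D y = la *: y ->
  all (fun i => mu i != la) r -> y = \sum_(i <- r) v i -> y = 0.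
Proof.
move=> DD DZ Dv; have D0 : D 0 = 0 by rewrite -(scale0r 0) DZ !scale0r.
elim: r v Dv y => [|i r IH] v' Dv' y Dy; first by rewrite big_nil.
rewrite /= => /andP[mi mr]; rewrite big_cons => yE.
have Dsum : D (\sum_(j <- r) v' j) = \sum_(j <- r) mu j *: v' j.
  rewrite (big_morph D DD D0); exact: eq_bigr.
(* Applying [D - mu i] removes the first summand and multiplies [y] by
   [la - mu i], so [y] is also the sum of the rescaled remaining ones. *)
pose v2 j := ((mu j - mu i) / (la - mu i)) *: v' j.
have li : la - mu i != 0 by rewrite subr_eq0 eq_sym.
apply: (IH v2 _ y Dy mr).
  by move=> j; rewrite /v2 DZ Dv' !scalerA mulrC.
apply: (scalerI li); rewrite scaler_sumr.
under eq_bigr do rewrite /v2 scalerA mulrCA mulfV// mulr1.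
rewrite scalerBl -Dy [in LHS]yE DD Dv' Dsum scalerDr opprD addrACA subrr add0r.
by rewrite scaler_sumr -sumrB; apply: eq_bigr => j _; rewrite scalerBl.
Qed.

(** The summands of the other eigenvalues add up to an eigenvector to which
    [eigen_vanish] applies. *)
Lemma eigen_filter (D : V -> V) (mu : I -> F) (la : F) (r : seq I) (P : pred I) :
  {morph D : x y / x + y} -> (forall c x, D (c *: x) = c *: D x) ->
  (forall i, D (v i) = mu i *: v i) ->
  D (\sum_(i <- r | P i) v i) = la *: (\sum_(i <- r | P i) v i) ->
  \sum_(i <- r | P i) v i = \sum_(i <- r | P i && (mu i == la)) v i.
Proof.
move=> DD DZ Dv; have D0 : D 0 = 0 by rewrite -(scale0r 0) DZ !scale0r.
rewrite [in X in X -> _](bigID (fun i => mu i == la)) /= DD scalerDr.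
have -> : D (\sum_(i <- r | P i && (mu i == la)) v i) =
    la *: (\sum_(i <- r | P i && (mu i == la)) v i).
  rewrite (big_morph D DD D0) scaler_sumr; apply: eq_bigr => i /andP[_ /eqP <-].
  exact: Dv.
move/addrI => Dy; rewrite (bigID (fun i => mu i == la)) /=.
rewrite [X in _ + X](eigen_vanish (r := [seq i <- r | P i && (mu i != la)]) DD DZ Dv Dy) ?addr0//.
  by apply/all_filterP; rewrite -filter_predI; apply: eq_filter => i /=; case: (_ != _); rewrite ?andbF.
by rewrite big_filter.
Qed.

End EigenFilter.

Section Straightening.
Variables (F : fieldType) (q : F) (l : nat) (A : algType F).
Local Notation I := 'I_l.+1.
Local Notation T := (I * I)%type.
Variable u : I -> I -> A.
Hypothesis q0 : q != 0.
Hypothesis u_row : forall i j k : I, (i < j)%N -> u i k * u j k = q *: (u j k * u i k).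
Hypothesis u_col : forall i j k : I, (i < j)%N -> u k i * u k j = q *: (u k j * u k i).
Hypothesis u_anti : forall i j k m : I, (i < j)%N -> (k < m)%N ->
  u i m * u j k - u j k * u i m = 0.
Hypothesis u_diag : forall i j k m : I, (i < j)%N -> (k < m)%N ->
  u i k * u j m - u j m * u i k = (q - q^-1) *: (u i m * u j k).

Local Notation mon w := (\prod_(x <- w) u x.1 x.2).

(** The position in the row by row order of the matrix; [wcode] below reads a word
    as a number in base [base], which exceeds all the codes, so that it increases
    with the lexicographic order of words of equal length. *)
Definition code (x : T) : nat := (x.1 * l.+1 + x.2)%N.
Definition code_le (x y : T) := (code x <= code y)%N.

Let base := (l.+1 * l.+1)%N.
Let code_lt x : (code x < base)%N.
Proof. by case: x => i j; rewrite /code /base /=; have := ltn_ord i; have := ltn_ord j; nia. Qed.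

Lemma code_inj : injective code.
Proof.
case=> [i j] [i' j']; rewrite /code /= => E.
have jE : j = j' :> nat.
  have := congr1 (modn^~ l.+1) E.
  by rewrite /= !modnMDl !modn_small.
have iE : i = i' :> nat by move: E; rewrite jE => /addIn/eqP; rewrite eqn_mul2r => /eqP.
by congr (_, _); apply: val_inj.
Qed.

Let wcode (w : seq T) := foldl (fun acc x => (acc * base + code x)%N) 0%N w.

Let foldl_lt a b (w : seq T) : (a < b)%N ->
  (foldl (fun acc x => acc * base + code x) a w < foldl (fun acc x => acc * base + code x) b w)%N.
Proof.
elim: w a b => //= x w IH a b ab; apply: IH; rewrite ltn_add2r ltn_mul2r ab andbT.
by rewrite /base muln_gt0.
Qed.

Let wcode_lt a b x y x' y' : (code x' < code x)%N ->
  (wcode (a ++ x' :: y' :: b) < wcode (a ++ x :: y :: b))%N.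
Proof.
move=> xx; rewrite /wcode !foldl_cat /=; apply: foldl_lt.
by have := code_lt y'; set c := foldl _ _ _; nia.
Qed.

(** The defining relations exchange two entries in the wrong order. The new first
    entry has a smaller code, and the rows are exchanged in all the terms. *)
Let swap (x y : T) : (code y < code x)%N ->
  exists2 ks : seq (F * (T * T)),
    u x.1 x.2 * u y.1 y.2 =
      \sum_(k <- ks) k.1 *: (u k.2.1.1 k.2.1.2 * u k.2.2.1 k.2.2.2)
    & forall k, k \in ks -> [/\ (code k.2.1 < code x)%N, k.2.1.1 = y.1 & k.2.2.1 = x.1].
Proof.
case: x y => [i2 c2] [i1 c1] /= lt.
have scal : forall a b : A, b = q *: a -> a = q^-1 *: b.
  by move=> a b ->; rewrite scalerA mulVf// scale1r.
have one c k : k \in [:: (c, ((i1, c1), (i2, c2)))] ->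
    [/\ (code k.2.1 < code (i2, c2))%N, k.2.1.1 = i1 & k.2.2.1 = i2].
  by rewrite inE => /eqP ->.
case: (ltngtP i1 i2) => [ii|ii|/val_inj ii]; first last.
- subst i2; move: (lt); rewrite /code /= ltn_add2l => cc.
  exists [:: (q^-1, ((i1, c1), (i1, c2)))]; last exact: one.
  by rewrite big_seq1 /=; apply/scal/u_col.
- by move: lt; rewrite /code /=; have := ltn_ord c1; have := ltn_ord c2; nia.
case: (ltngtP c1 c2) => [cc|cc|/val_inj cc].
- exists [:: (1, ((i1, c1), (i2, c2))); (- (q - q^-1), ((i1, c2), (i2, c1)))].
    rewrite big_cons big_seq1 /= scale1r scaleNr -u_diag//.
    by rewrite opprB addrC subrK.
  move=> k; rewrite !inE => /orP[] /eqP -> /=; split=> //.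
  by rewrite /code /=; have := ltn_ord c1; have := ltn_ord c2; nia.
- exists [:: (1, ((i1, c1), (i2, c2)))]; last exact: one.
  by rewrite big_seq1 /= scale1r; apply/esym/subr0_eq; apply: u_anti.
- subst c2; exists [:: (q^-1, ((i1, c1), (i2, c1)))]; last exact: one.
  by rewrite big_seq1 /=; apply/scal/u_row.
Qed.

Let unsorted (w : seq T) : ~~ sorted code_le w ->
  exists a x y b, w = a ++ x :: y :: b /\ (code y < code x)%N.
Proof.
elim: w => //= x [|y w] //= IH; rewrite negb_and => /orP[|/IH].
  by rewrite -ltnNge => yx; exists [::], x, y, w.
by move=> [a [x' [y' [b [-> lt]]]]]; exists (x :: a), x', y', b.
Qed.

(** The defining relations rewrite a word that is not sorted into words that are
    smaller for the lexicographic order and have the same rows. *)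
Lemma straighten (w : seq T) : exists2 ks : seq (F * seq T),
  mon w = \sum_(k <- ks) k.1 *: mon k.2
  & forall k, k \in ks -> sorted code_le k.2 /\ perm_eq (unzip1 k.2) (unzip1 w).
Proof.
have [n] := ubnP (wcode w); elim: n w => // n IH w; rewrite ltnS => wn.
have [sw|/unsorted[a [x [y [b [wE yx]]]]]] := boolP (sorted code_le w).
  exists [:: (1, w)]; first by rewrite big_seq1 scale1r.
  by move=> k; rewrite inE => /eqP->.
have [ks kE kP] := swap yx.
have H k : k \in ks -> exists ks' : seq (F * seq T),
    mon (a ++ k.2.1 :: k.2.2 :: b) = \sum_(k' <- ks') k'.1 *: mon k'.2 /\
    forall k', k' \in ks' -> sorted code_le k'.2 /\ perm_eq (unzip1 k'.2) (unzip1 w).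
  move=> kks; have [lt r1 r2] := kP _ kks.
  have [|ks' E' P'] := IH (a ++ k.2.1 :: k.2.2 :: b).
    by apply: leq_trans wn; rewrite wE; apply: wcode_lt.
  exists ks'; split=> // k' /P'[-> pk]; split=> //; apply: perm_trans pk _.
  rewrite wE /unzip1 !map_cat /= r1 r2 perm_cat2l.
  by rewrite -[X in perm_eq X]/([:: y.1; x.1] ++ map fst b) -[X in perm_eq _ X]/([:: x.1; y.1] ++ map fst b) perm_cat2r (perm_catC [:: y.1] [:: x.1]).
have wE' : mon w = \sum_(k <- ks) k.1 *: mon (a ++ k.2.1 :: k.2.2 :: b).
  rewrite wE big_cat !big_cons /= mulrA mulrA -(mulrA _ (u x.1 x.2)) kE.
  rewrite mulr_sumr mulr_suml; apply: eq_bigr => k _.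
  by rewrite big_cat !big_cons /= -scalerAr -scalerAl !mulrA.
rewrite {}wE' {kE kP yx wE}; elim: ks H => [|k ks IHk] H.
  by exists [::]; rewrite ?big_nil.
have [|ks2 E2 P2] := IHk; first by move=> k' k'ks; apply: H; rewrite inE k'ks orbT.
have [ks1 [E1 P1]] := H k (mem_head _ _).
exists ([seq (k.1 * k'.1, k'.2) | k' <- ks1] ++ ks2).
  rewrite big_cons E1 E2 big_cat big_map /= scaler_sumr; congr (_ + _).
  by apply: eq_bigr => k' _; rewrite scalerA.
by move=> k'; rewrite mem_cat => /orP[/mapP[k'' /P1 H1 ->]|/P2].
Qed.

End Straightening.

(** * Lowest weight vectors among the quantum matrices *)

Section QNumbers.
Variables (F : fieldType) (t : F).
Hypotheses (t0 : t != 0) (d0 : t - t^-1 != 0).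
Definition qnum (m : int) : F := (t ^ m - t ^ (- m)) / (t - t^-1).

Lemma qnum1 : qnum 1 = 1. Proof. exact: divff. Qed.

(** The induction step for [E^k F] in rank one, with [N] the lowest weight. *)
Lemma qnum_rec (N k : nat) :
  qnum k.+1%:Z * qnum (N%:Z - k%:Z) + qnum (N%:Z - (k.+1 *+ 2)%:Z) =
  qnum k.+2%:Z * qnum (N%:Z - k.+1%:Z).
Proof.
rewrite /qnum !opprB mulr2n !PoszD.
have -> : t ^ k.+2 = t ^ k * t * t by rewrite -!exprnP !exprSr.
have -> : t ^ k.+1 = t ^ k * t by rewrite -!exprnP exprSr.
rewrite !opprD !addrA !expfzDr// -!invr_expz.
have -> : t ^ k.+2 = t ^ k * t * t by rewrite -!exprnP !exprSr.
have -> : t ^ k.+1 = t ^ k * t by rewrite -!exprnP exprSr.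
have x0 := expfz_neq0 (k : int) t0; have y0 := expfz_neq0 (N : int) t0.
set x := t ^ k in x0 *; set y := t ^ N in y0 *.
have d1 : t ^+ 2 - 1 != 0.
  apply: contraNneq d0 => /eqP; rewrite subr_eq0 => /eqP t2.
  by rewrite subr_eq0; apply/eqP/(mulfI t0); rewrite mulfV// -expr2.
by field; rewrite t0 x0 y0 d1.
Qed.
End QNumbers.

(** The counit axiom applied to the coproduct reads [x = e(x) k + x]. *)
Lemma cou_skew_primitive (F : numClosedFieldType) (U : algType F) (H : hopf_star U)
    (k k' x : U) : k * k' = 1 -> cou H k = 1 ->
  cop H x = x ⊗ k + k' ⊗ x -> cou H x = 0.
Proof.
move=> kk ck cx.
have cM a b : cou H (a * b) = cou H a * cou H b by case: (H).
have c1 : cou H 1 = 1 by case: (H).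
have ck' : cou H k' = 1 by have := cM k k'; rewrite kk c1 ck mul1r => <-.
have : tlift (fun x y => cou H x *: y) (cop H x) = x by case: (H).
have hl (a b w : U) : cou H (a + b) *: w = cou H a *: w + cou H b *: w.
  by rewrite linearD scalerDl.
have hr (a b w : U) : cou H a *: (b + w) = cou H a *: b + cou H a *: w.
  by rewrite scalerDr.
have hz c (a w : U) : cou H (c *: a) *: w = cou H a *: (c *: w).
  by rewrite linearZ /= !scalerA mulrC.
rewrite cx (tliftD hl hr hz) !(tlift_tens hl hr hz) ck' scale1r.
move=> /(canRL (addrK _)); rewrite subrr => /(congr1 (cou H)).
by rewrite linearZ /= ck mulr1 linear0.
Qed.

Section QuantumMatrices.
Variables (F : numClosedFieldType) (s : F) (l : nat).
Hypothesis s01 : 0 < s < 1.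
Local Notation q := (s ^+ 2).
Local Notation I := 'I_l.+1.
Local Notation T := (I * I)%type.
Variables (U A : algType F) (HU : hopf_star U) (HA : hopf_star A) (p : U -> A -> F).
Hypothesis Hp : hopf_pairing HU HA p.
Variables (u : I -> I -> A) (UK UKi UE UF : 'I_l -> U).

Local Notation "a ◁ h" := (ract HA p a h) (at level 40, left associativity).

Hypothesis u_cop : forall i j, cop HA (u i j) = \sum_k u i k ⊗ u k j.
Hypothesis u_cou : forall i j, cou HA (u i j) = (i == j)%:R.
Hypothesis KKi : forall r, UK r * UKi r = 1.
Hypothesis copK : forall r, cop HU (UK r) = UK r ⊗ UK r.
Hypothesis copE : forall r, cop HU (UE r) = UE r ⊗ UK r + UKi r ⊗ UE r.
Hypothesis copF : forall r, cop HU (UF r) = UF r ⊗ UK r + UKi r ⊗ UF r.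
Hypothesis couK : forall r, cou HU (UK r) = 1.
Hypothesis couE : forall r, cou HU (UE r) = 0.
Hypothesis couF : forall r, cou HU (UF r) = 0.
Hypothesis pK : forall r i j, p (UK r) (u i j) =
  (i == j)%:R * s ^ ((i == r.+1 :> nat)%:Z - (i == r :> nat)%:Z).
Hypothesis pE : forall r i j, p (UE r) (u i j) =
  ((i == r.+1 :> nat) && (j == r :> nat))%:R.
Hypothesis pF : forall r i j, p (UF r) (u i j) =
  ((i == r :> nat) && (j == r.+1 :> nat))%:R.

Hypothesis EK : forall r, UE r * UK r = q^-1 *: (UK r * UE r).
Hypothesis EF : forall r, UE r * UF r - UF r * UE r =
  (q - q^-1)^-1 *: (UK r ^+ 2 - UKi r ^+ 2).

Let s_gt0 : 0 < s. Proof. by case/andP: s01. Qed.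
Let s_neq0 : s != 0. Proof. by rewrite gt_eqF. Qed.

Definition monomial (w : seq T) : A := \prod_(x <- w) u x.1 x.2.

Lemma monomial_cons x w : monomial (x :: w) = u x.1 x.2 * monomial w.
Proof. by rewrite /monomial big_cons. Qed.
Lemma monomial_cat w1 w2 : monomial (w1 ++ w2) = monomial w1 * monomial w2.
Proof. by rewrite /monomial big_cat. Qed.

Lemma ract_u i j h : u i j ◁ h = \sum_k p h (u i k) *: u k j.
Proof. by rewrite (ract_sumE Hp _ (u_cop i j)). Qed.

Lemma ractMK a b r : (a * b) ◁ UK r = (a ◁ UK r) * (b ◁ UK r).
Proof.
have cK : cop HU (UK r) = \sum_(i <- [:: UK r]) i ⊗ i by rewrite big_seq1.
by rewrite (ract_mul Hp _ _ cK) big_seq1.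
Qed.

Lemma ractME a b r : (a * b) ◁ UE r = (a ◁ UE r) * (b ◁ UK r) + (a ◁ UKi r) * (b ◁ UE r).
Proof.
have cE : cop HU (UE r) = \sum_(i <- [:: (UE r, UK r); (UKi r, UE r)]) i.1 ⊗ i.2.
  by rewrite big_cons big_seq1.
by rewrite (ract_mul Hp _ _ cE) big_cons big_seq1.
Qed.

Lemma ractMF a b r : (a * b) ◁ UF r = (a ◁ UF r) * (b ◁ UK r) + (a ◁ UKi r) * (b ◁ UF r).
Proof.
have cE : cop HU (UF r) = \sum_(i <- [:: (UF r, UK r); (UKi r, UF r)]) i.1 ⊗ i.2.
  by rewrite big_cons big_seq1.
by rewrite (ract_mul Hp _ _ cE) big_cons big_seq1.
Qed.

(** The exponent of [s] in the eigenvalue of [K_r] at a single generator. *)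
Definition Kexp (r : 'I_l) (x : T) : int := (x.1 == r.+1 :> nat)%:Z - (x.1 == r :> nat)%:Z.
Definition Kweight r (w : seq T) : int := \sum_(x <- w) Kexp r x.

Lemma u_K i j r : u i j ◁ UK r = s ^ Kexp r (i, j) *: u i j.
Proof.
rewrite ract_u (bigD1 i)//= pK eqxx mul1r big1 ?addr0// => k ki.
by rewrite pK eq_sym (negPf ki) mul0r scale0r.
Qed.

Lemma monomial_K w r : monomial w ◁ UK r = s ^ Kweight r w *: monomial w.
Proof.
elim: w => [|x w IH].
  by rewrite /monomial /Kweight !big_nil (ract1 Hp) couK expr0z.
rewrite monomial_cons ractMK IH u_K -scalerAl -scalerAr scalerA -expfzDr//.
by rewrite /Kweight big_cons; case: x.
Qed.

Lemma ract_Ki a c r : c != 0 -> a ◁ UK r = c *: a -> a ◁ UKi r = c^-1 *: a.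
Proof.
move=> c0 aK; have := ractM Hp a (UK r) (UKi r).
rewrite KKi (ract1r Hp) aK (ractZ Hp) => E.
by rewrite [in RHS]E scalerA mulVf// scale1r.
Qed.

Lemma monomial_Ki w r : monomial w ◁ UKi r = s ^ (- Kweight r w) *: monomial w.
Proof. by rewrite -invr_expz; apply: ract_Ki (monomial_K w r); rewrite expfz_neq0. Qed.

(** A letter out of range stands for 0: it moves no entry. *)
Definition Uletter (X : bool * nat) : U :=
  if insub X.2 is Some r then if X.1 then UE r else UF r else 0.

Lemma u_letter x X : u x.1 x.2 ◁ Uletter X =
  if movable X x then u (row_move X x).1 (row_move X x).2 else 0.
Proof.
case: X => e r; rewrite /Uletter /movable /row_move /=; case: insubP => [r' rl <-|rl].
  case: e; rewrite ract_u.
    case: eqP => x1.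
      have rl' : (r' < l.+1)%N := ltnW (ltn_ord r').
      rewrite (bigD1 (Ordinal rl'))//= pE x1 !eqxx scale1r big1 ?addr0.
        by congr (u _ _); apply: val_inj; rewrite /= inordK.
      move=> k; rewrite -(inj_eq val_inj)/= pE => /negPf->.
      by rewrite andbF scale0r.
    by rewrite big1// => k _; rewrite pE; case: eqP x1; rewrite ?scale0r.
  rewrite ltn_ord andbT; case: eqP => x1.
    have rl' : (r'.+1 < l.+1)%N := ltn_ord r'.
    rewrite (bigD1 (Ordinal rl'))//= pF x1 !eqxx scale1r big1 ?addr0.
      by congr (u _ _); apply: val_inj; rewrite /= inordK.
    move=> k; rewrite -(inj_eq val_inj)/= pF => /negPf->.
    by rewrite andbF scale0r.
  by rewrite big1// => k _; rewrite pF; case: eqP x1; rewrite ?scale0r.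
rewrite (ract0l Hp); case: e => /=; last by rewrite (negPf rl) andbF.
case: eqP => // x1; have := ltn_ord x.1; rewrite x1 ltnS => rl'.
by rewrite rl' in rl.
Qed.

Lemma ract1_letter X : 1 ◁ Uletter X = 0.
Proof.
rewrite /Uletter; case: insubP => [r _ _|_]; last exact: (ract0l Hp).
by case: ifP => _; rewrite (ract1 Hp) ?couE ?couF scale0r.
Qed.

(** A generator [E_r] or [F_r] of the enveloping algebra acts on a monomial as a
    twisted derivation, and all the twists are powers of [s > 0]. *)
Lemma monomial_letter X w : exists2 ks : seq (F * seq T),
  [seq k.2 | k <- ks] = steps X w /\ (forall k, k \in ks -> 0 < k.1)
  & monomial w ◁ Uletter X = \sum_(k <- ks) k.1 *: monomial k.2.
Proof.
elim: w => [|x w [ks [kE kpos] IH]].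
  by exists [::]; rewrite // /monomial !big_nil ract1_letter.
have [Xl|Xl] := boolP (X.2 < l)%N; last first.
  exists [::]; last first.
    by rewrite big_nil /Uletter insubN// (ract0l Hp).
  split=> //; elim: (x :: w) => //= y v <- /=.
  rewrite cats0 /movable (negPf Xl) andbF; case: X.1 => //.
  by case: eqP => // yX; have := ltn_ord y.1; rewrite yX ltnS (negPf Xl).
pose r := Ordinal Xl.
exists ((if movable X x then [:: (s ^ Kweight r w, row_move X x :: w)] else [::]) ++
  [seq (s ^ (- Kweight r [:: x]) * k.1, x :: k.2) | k <- ks]).
  split.
    rewrite map_cat /= -kE -!map_comp; congr (_ ++ _); case: ifP => //.
  move=> k; rewrite mem_cat => /orP[|/mapP[k' /kpos k'0 ->]]; last first.
    by rewrite /= mulr_gt0// exprz_gt0.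
  by case: ifP => // _; rewrite inE => /eqP->; rewrite /= exprz_gt0.
have Leib a b : (a * b) ◁ Uletter X =
    (a ◁ Uletter X) * (b ◁ UK r) + (a ◁ UKi r) * (b ◁ Uletter X).
  rewrite /Uletter (insubT (fun n => n < l)%N Xl) /=.
  by case: ifP => _; rewrite ?ractME ?ractMF.
rewrite monomial_cons Leib IH u_letter monomial_K.
have := monomial_Ki [:: x] r; rewrite /monomial big_seq1 => ->.
rewrite big_cat big_map /=; congr (_ + _).
  case: ifP => _; last by rewrite big_nil mul0r.
  by rewrite big_seq1 /= big_cons -scalerAr.
rewrite -scalerAl mulr_sumr scaler_sumr; apply: eq_bigr => k _.
by rewrite big_cons -scalerAr scalerA.
Qed.

Definition Uword (h : seq (bool * nat)) : U := \prod_(X <- h) Uletter X.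
Definition reach h (w : seq T) := exists2 w', moves h w w' & diag_word w'.

Lemma cou_monomial w : cou HA (monomial w) = (diag_word w)%:R.
Proof.
have cM a b : cou HA (a * b) = cou HA a * cou HA b by case: HA.
have c1 : cou HA 1 = 1 by case: HA.
elim: w => [|x w IH]; first by rewrite /monomial big_nil c1.
by rewrite monomial_cons cM IH u_cou -natrM mulnb.
Qed.

(** As all the coefficients of [monomial_letter] are positive, nothing cancels, and
    the counit keeps exactly the diagonal words. *)
Lemma pairing_monomial h w :
  0 <= p (Uword h) (monomial w) /\ (p (Uword h) (monomial w) != 0 <-> reach h w).
Proof.
elim: h w => [|X h IH] w.
  rewrite /Uword big_nil (pairing_1l Hp) cou_monomial; split; first by rewrite ler0n.
  case: (boolP (diag_word w)) => dw; first by rewrite oner_eq0; split=> // _; exists w.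
  by rewrite eqxx; split=> // -[w' <- dw']; rewrite dw' in dw.
rewrite /Uword big_cons (pairing_ract Hp).
have [ks [kE kpos] ->] := monomial_letter X w.
have E : p (\prod_(Y <- h) Uletter Y) (\sum_(k <- ks) k.1 *: monomial k.2) =
    \sum_(k <- ks) k.1 * p (Uword h) (monomial k.2).
  by rewrite (pairing_sum Hp); apply: eq_bigr => k _; rewrite (pairingZ Hp).
have pos k : k \in ks -> 0 <= k.1 * p (Uword h) (monomial k.2).
  by move=> /kpos k0; apply: mulr_ge0; [apply: ltW | case: (IH k.2)].
rewrite {}E big_seq; split; first by apply: sumr_ge0 => k; apply: pos.
rewrite psumr_eq0//; split.
  case/allPn => k kks; rewrite kks implyTb mulf_eq0 negb_or => /andP[_ /(IH k.2).2[w' pw dw]].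
  by exists w' => //; exists k.2 => //; rewrite -kE map_f.
move=> [w' /= [v vs pv] dw]; move: vs; rewrite -kE => /mapP[k kks vE].
apply/allPn; exists k => //; rewrite kks implyTb mulf_neq0//.
  by rewrite gt_eqF// kpos.
by apply/(IH k.2).2; exists w'; rewrite -?vE.
Qed.

Let q_neq0 : q != 0. Proof. by rewrite expf_neq0. Qed.
Let expz_neq1 (m : int) : m != 0 -> s ^ m != 1.
Proof.
have s_unit : s \in Num.real by rewrite gtr0_real.
have pos n : s ^+ n.+1 != 1.
  by rewrite -(expr1n _ n.+1) eqrXn2 ?ltW//; case/andP: s01 => _; rewrite lt_neqAle => /andP[].
case: m => [[//|n]|n] _; first exact: pos.
by rewrite NegzE -invr_expz invr_eq1; exact: pos.
Qed.

Let den_neq0 : q - q^-1 != 0.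
Proof.
rewrite subr_eq0; apply/negP => /eqP E; have := mulfV q_neq0; rewrite -E => /eqP.
by rewrite -expr2 -exprM; apply/negP; exact: (expz_neq1 (m := 4)).
Qed.

Let qnum_neq0 m : m != 0 -> qnum q m != 0.
Proof.
move=> m0; rewrite mulf_neq0 ?invr_neq0// subr_eq0; apply/negP => /eqP E.
have := mulfV (expfz_neq0 m q_neq0); rewrite invr_expz -E -expfzDr// => /eqP.
rewrite -[q]/(s ^ 2) exprz_exp; apply/negP/expz_neq1; lia.
Qed.

(** * Rank one *)

Section RankOne.
Variables (r : 'I_l) (N : nat) (a : A).
Hypotheses (aF : a ◁ UF r = 0) (aK : a ◁ UK r = s ^+ N *: a).

Let e k := iter k (fun b => b ◁ UE r) a.

Let eK k : e k ◁ UK r = (s ^+ N * q ^- k) *: e k.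
Proof.
elim: k => [|k IH]; first by rewrite expr0 invr1 mulr1 /e /= aK.
rewrite /= -(ractM Hp) EK (ractZl Hp) (ractM Hp) IH (ractZ Hp) scalerA.
by congr (_ *: _); rewrite (exprS q k) (invfM q) mulrCA.
Qed.

Let eEF b c : c != 0 -> b ◁ UK r = c *: b ->
  (b ◁ UE r) ◁ UF r = (b ◁ UF r) ◁ UE r + ((q - q^-1)^-1 * (c ^+ 2 - c ^- 2)) *: b.
Proof.
move=> c0 bK; have bKi := ract_Ki c0 bK.
have E : UE r * UF r = UF r * UE r + (q - q^-1)^-1 *: (UK r ^+ 2 - UKi r ^+ 2).
  by rewrite -EF addrC subrK.
rewrite -(ractM Hp) E (ractDl Hp) (ractM Hp) (ractZl Hp) (ractBl Hp) (expr2 (UK r)) (expr2 (UKi r)).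
rewrite !(ractM Hp) bK bKi !(ractZ Hp) bK bKi !scalerA -scalerBl scalerA (expr2 c).
by rewrite (invfM c).
Qed.

(** The usual formula in rank one: [F] takes [a ◁ E^(k+1)] to the multiple
    [[k + 1] [N - k]] of [a ◁ E^k]. *)
Let eF k : e k.+1 ◁ UF r = (qnum q k.+1 * qnum q (N%:Z - k%:Z)) *: e k.
Proof.
have step k' d : (e k' ◁ UF r) ◁ UE r = d *: e k' ->
    e k'.+1 ◁ UF r = (d + qnum q (N%:Z - (k' *+ 2)%:Z)) *: e k'.
  move=> dE; have := eEF (c := s ^+ N * q ^- k') _ (eK k').
  rewrite mulf_neq0 ?invr_neq0 ?expf_neq0// => /(_ isT) ->.
  rewrite dE -scalerDl; congr ((_ + _) *: _); rewrite mulrC /qnum; congr (_ / _).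
  have E : (s ^+ N * q ^- k') ^+ 2 = q ^ (N%:Z - (k' *+ 2)%:Z).
    have -> : (s ^+ N * q ^- k') ^+ 2 = (s ^+ N) ^+ 2 * (q ^- k') ^+ 2 by exact: exprMn.
    have -> : (s ^+ N) ^+ 2 = q ^ N by rewrite -exprM mulnC exprM.
    have -> : (q ^- k') ^+ 2 = q ^ (- (k' *+ 2)%:Z).
      by rewrite (exprVn (q ^+ k')) -(exprM q) (exprnN q) -mulr_natr.
    by rewrite -expfzDr.
  by rewrite E -invr_expz.
elim: k => [|k IH].
  rewrite (step 0%N 0); last by rewrite /e /= aF (ract0 Hp) scale0r.
  by rewrite add0r subr0 qnum1// mul1r.
rewrite (step k.+1 (qnum q k.+1 * qnum q (N%:Z - k%:Z))); last by rewrite IH (ractZ Hp).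
by rewrite qnum_rec.
Qed.

(** In a locally finite module a lowest weight vector of weight [N] generates the
    representation of dimension [N + 1]. *)
Lemma rank_one_nilpotent K : iter K (fun b => b ◁ UE r) a = 0 ->
  iter N.+1 (fun b => b ◁ UE r) a = 0.
Proof.
rewrite -/(e K) -/(e N.+1); elim: K => [e0|K IH eK0].
  by rewrite /e; elim: N.+1 => //= n ->; rewrite (ract0 Hp).
have [NK|KN] := ltnP N K; last first.
  have -> : N.+1 = (N - K + K.+1)%N by lia.
  by rewrite /e iterD -/(e K.+1) eK0; elim: (N - K)%N => //= n ->; rewrite (ract0 Hp).
(* For [K > N] the coefficient [[K + 1] [N - K]] is nonzero, so a vanishing
   power of [E] may be lowered down to [N + 1]. *)
apply: IH; have := eF K; rewrite eK0 (ract0 Hp) => /esym/eqP.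
rewrite scaler_eq0 mulf_eq0 (negPf (qnum_neq0 _))// (negPf (qnum_neq0 _)); last by lia.
by move/eqP.
Qed.

End RankOne.

Lemma Uletter_E (r : 'I_l) : Uletter (true, r : nat) = UE r.
Proof. by rewrite /Uletter /= insubT//= => rl; congr UE; apply: val_inj. Qed.
Lemma Uletter_F (r : 'I_l) : Uletter (false, r : nat) = UF r.
Proof. by rewrite /Uletter /= insubT//= => rl; congr UF; apply: val_inj. Qed.

Let iterE (r : 'I_l) K (I : Type) (ks : seq I) (c : I -> F) (v : I -> A) :
  iter K (fun b => b ◁ UE r) (\sum_(k <- ks) c k *: v k) =
  \sum_(k <- ks) c k *: iter K (fun b => b ◁ UE r) (v k).
Proof.
elim: K => //= K ->; rewrite (ract_sum Hp).
by apply: eq_bigr => k _; rewrite (ractZ Hp).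
Qed.

(** Each [E_r] takes one entry out of the row [r + 1]. *)
Lemma monomial_E_nilpotent (r : 'I_l) w K :
  (count (fun x : T => x.1 == r.+1 :> nat) w < K)%N ->
  iter K (fun b => b ◁ UE r) (monomial w) = 0.
Proof.
elim: K w => // K IH w wK; rewrite iterSr -Uletter_E.
have [ks [kE _] ->] := monomial_letter (true, r : nat) w.
rewrite Uletter_E iterE big_seq big1// => k kks; rewrite IH ?scaler0//.
have : k.2 \in steps (true, r : nat) w by rewrite -kE map_f.
move=> /stepsP[a [x [b [wE m kE']]]]; move: wK; rewrite wE kE' !count_cat /=.
have := row_moveE m; move: m; rewrite /movable /= => -> ->.
by case: eqP; lia.
Qed.

Lemma E_nilpotent (r : 'I_l) (ks : seq (F * seq T)) :
  exists K, iter K (fun b => b ◁ UE r) (\sum_(k <- ks) k.1 *: monomial k.2) = 0.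
Proof.
exists (\sum_(k <- ks) size k.2).+1; rewrite iterE big_seq big1// => k kks.
rewrite monomial_E_nilpotent ?scaler0// ltnS; apply: leq_trans (count_size _ _) _.
by rewrite (big_rem k)//= leq_addr.
Qed.

(** * Expansion of lowest weight vectors *)

Hypothesis u_row : forall i j k : I, (i < j)%N -> u i k * u j k = q *: (u j k * u i k).
Hypothesis u_col : forall i j k : I, (i < j)%N -> u k i * u k j = q *: (u k j * u k i).
Hypothesis u_anti : forall i j k m : I, (i < j)%N -> (k < m)%N ->
  u i m * u j k - u j k * u i m = 0.
Hypothesis u_diag : forall i j k m : I, (i < j)%N -> (k < m)%N ->
  u i k * u j m - u j m * u i k = (q - q^-1) *: (u i m * u j k).
Variable det_terms : seq (F * (I -> I)).
Hypothesis u_det : \sum_(t <- det_terms) t.1 *: \prod_(i < l.+1) u i (t.2 i) = 1.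
Hypothesis u_span : forall a, exists ks : seq (F * seq T),
  a = \sum_(k <- ks) k.1 *: monomial k.2.
Hypothesis l_gt0 : (0 < l)%N.

(** The last field determines the eigenvalue of the last [K_r], see [lowest_Klast];
    without a condition on the last [E_r], the vector generates the analogue of the
    space of polynomials of degree [N] in [l + 1] variables. *)
Record lowest N (a : A) : Prop := Lowest {
  lowestK : forall r : 'I_l, (r.+1 < l)%N -> a ◁ UK r = a;
  lowestE : forall r : 'I_l, (r.+1 < l)%N -> a ◁ UE r = 0;
  lowestF : forall r : 'I_l, a ◁ UF r = 0;
  lowestT : a ◁ (\prod_(i < l) UK i ^+ i.+1) = s ^ (N%:Z * l%:Z) *: a }.

Definition row_count (i : nat) (w : seq T) := count (fun x : T => x.1 == i :> nat) w.
Definition has_content M N (w : seq T) :=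
  forall i : I, row_count i w = if i == l :> nat then (M + N)%N else M.

Lemma KweightE r w : Kweight r w = (row_count r.+1 w)%:Z - (row_count r w)%:Z.
Proof.
rewrite /Kweight /Kexp sumrB; congr (_ - _).
  by rewrite /row_count -sumn_count sumnE big_map -natz natr_sum; apply: eq_bigr => x _; rewrite natz.
by rewrite /row_count -sumn_count sumnE big_map -natz natr_sum; apply: eq_bigr => x _; rewrite natz.
Qed.

Lemma ractX a h c n : a ◁ h = c *: a -> a ◁ (h ^+ n) = c ^+ n *: a.
Proof.
move=> ah; elim: n => [|n IH]; first by rewrite !expr0 (ract1r Hp) scale1r.
by rewrite !exprS (ractM Hp) ah (ractZ Hp) IH scalerA.
Qed.

Lemma ract_prod (J : Type) (r : seq J) a (h : J -> U) (c : J -> F) :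
  (forall i, a ◁ h i = c i *: a) -> a ◁ (\prod_(i <- r) h i) = (\prod_(i <- r) c i) *: a.
Proof.
move=> ah; elim: r => [|i r IH]; first by rewrite !big_nil (ract1r Hp) scale1r.
by rewrite !big_cons (ractM Hp) ah (ractZ Hp) IH scalerA.
Qed.

Definition Ktot_weight w : int := \sum_(r < l) Kweight r w * r.+1%:Z.

Lemma monomial_Ktot w :
  monomial w ◁ (\prod_(i < l) UK i ^+ i.+1) = s ^ Ktot_weight w *: monomial w.
Proof.
rewrite (@ract_prod _ _ _ _ (fun i : 'I_l => s ^ (Kweight i w * i.+1%:Z))); last first.
  by move=> i; rewrite (ractX _ (monomial_K w i)) -exprz_exp.
congr (_ *: _); rewrite /Ktot_weight; elim/big_rec2: _ => [|i x y _ ->]; first by rewrite expr0z.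
by rewrite expfzDr.
Qed.

Let expz_inj (m n : int) : s ^ m = s ^ n -> m = n.
Proof.
move=> E; apply/eqP; rewrite -subr_eq0; apply/negPn/negP => /expz_neq1/eqP; apply.
by rewrite expfzDr// E -expfzDr// subrr expr0z.
Qed.

(** The weight of [K_r] is the difference of the numbers of entries in the rows
    [r + 1] and [r]. *)
Lemma content_of_weights N w : (forall r : 'I_l, (r.+1 < l)%N -> Kweight r w = 0) ->
  Ktot_weight w = N%:Z * l%:Z -> exists M, has_content M N w.
Proof.
move=> K0 KT; exists (row_count 0 w).
have eqr i : (i < l)%N -> row_count i w = row_count 0 w.
  elim: i => // i IH il; rewrite -IH; last by lia.
  by have := K0 (Ordinal (ltnW il)) il; rewrite KweightE /=; lia.
move=> i; case: eqP => [->|il]; last by apply: eqr; have := ltn_ord i; lia.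
move: KT; rewrite /Ktot_weight.
have l1 : (l.-1 < l)%N by lia.
rewrite (bigD1 (Ordinal l1))//= big1 => [|r]; last first.
  rewrite -(inj_eq val_inj) /= => rl; rewrite K0 ?mul0r//.
  by have := ltn_ord r; lia.
rewrite addr0 KweightE /= prednK// (eqr l.-1)//.
have l0 : l%:Z != 0 by lia.
by move=> /(mulIf l0); lia.
Qed.

(** Words are eigenvectors of the [K_r], so only the words of the right weights
    contribute to a lowest weight vector. *)
Lemma lowest_contents N a : lowest N a -> exists ks : seq (F * seq T),
  a = \sum_(k <- ks) k.1 *: monomial k.2 /\
  forall k, k \in ks -> exists M, has_content M N k.2.
Proof.
move=> [aK _ _ aT]; have [ks aE] := u_span a.
have rsum h : {morph (fun b => b ◁ h) : x y / x + y} by move=> x y; exact: (ractD Hp).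
have rscal h c b : (c *: b) ◁ h = c *: (b ◁ h) by exact: (ractZ Hp).
have KZ (r : 'I_l) (k : F * seq T) :
    (k.1 *: monomial k.2) ◁ UK r = s ^ Kweight r k.2 *: (k.1 *: monomial k.2).
  by rewrite (ractZ Hp) monomial_K !scalerA mulrC.
(* The weights of [K_0, ..., K_(n-1)] are filtered one after another. *)
have H n : (n <= l)%N -> a = \sum_(k <- ks | all (fun r : 'I_l =>
    (r.+1 < l)%N && (r < n)%N ==> (s ^ Kweight r k.2 == 1)) (enum 'I_l)) k.1 *: monomial k.2.
  elim: n => [_|n IH nl].
    rewrite {1}aE; apply: eq_bigl => k; apply/esym/allP => r _.
    by rewrite ltn0 andbF.
  have [ln|nl'] := leqP l n.+1.
    rewrite {1}IH ?(ltnW nl)//; apply: eq_bigl => k; apply: eq_all => r.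
    by case: (ltnP r.+1 l) => //= rl; congr (_ ==> _); lia.
  have {}IH := IH (ltnW nl).
  have aKn := aK (Ordinal nl) nl'.
  rewrite {1}IH in aKn; rewrite {1}IH.
  rewrite (eigen_filter (la := 1) (mu := fun k : F * seq T => s ^ Kweight (Ordinal nl) k.2) (rsum _) (rscal _) (KZ _)).
    apply: eq_bigl => k; apply/idP/idP.
      move=> /andP[/allP Hk kn]; apply/allP => r rl; apply/implyP => /andP[rl' rn].
      have [rn'|] := ltnP r n; first by have := Hk r rl; rewrite rl' rn'.
      move=> nr; rewrite (_ : r = Ordinal nl)//; apply: val_inj => /=; lia.
    move=> /allP Hk; apply/andP; split.
      apply/allP => r rl; apply/implyP => /andP[rl' rn].
      by have := Hk r rl; rewrite rl' (leqW rn).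
    by have := Hk (Ordinal nl); rewrite mem_enum /= nl' ltnSn => /(_ isT).
  by rewrite scale1r {1}aKn.
have {}H := H l (leqnn _).
have KTZ (k : F * seq T) :
    (k.1 *: monomial k.2) ◁ (\prod_(i < l) UK i ^+ i.+1) =
    s ^ Ktot_weight k.2 *: (k.1 *: monomial k.2).
  by rewrite (ractZ Hp) monomial_Ktot !scalerA mulrC.
have aT' := aT; rewrite {1 2}H in aT'.
have := eigen_filter (mu := fun k : F * seq T => s ^ Ktot_weight k.2)
  (rsum _) (rscal _) KTZ aT'; rewrite -H => aE2.
exists [seq k <- ks | all (fun r : 'I_l => (r.+1 < l)%N && (r < l)%N ==>
  (s ^ Kweight r k.2 == 1)) (enum 'I_l) && (s ^ Ktot_weight k.2 == s ^ (N%:Z * l%:Z))].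
split; first by rewrite big_filter.
move=> k; rewrite mem_filter => /andP[/andP[/allP K0 /eqP/expz_inj KT] _].
apply: content_of_weights KT => r rl; apply: expz_inj; rewrite expr0z; apply/eqP.
by have := K0 r; rewrite mem_enum rl ltn_ord => /(_ isT).
Qed.

(** Multiplying by the quantum determinant, which is 1, adds one entry to each
    row; so all the words can be given the same length. *)
Lemma raise_content M N w : has_content M N w -> exists ks : seq (F * seq T),
  monomial w = \sum_(k <- ks) k.1 *: monomial k.2 /\
  forall k, k \in ks -> has_content M.+1 N k.2.
Proof.
move=> cw; pose dw (t : F * (I -> I)) := w ++ [seq (i, t.2 i) | i <- enum 'I_l.+1].
exists [seq (t.1, dw t) | t <- det_terms]; split.
  rewrite -[LHS]mulr1 -u_det mulr_sumr big_map; apply: eq_bigr => t _.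
  rewrite -scalerAr /dw monomial_cat; congr (_ *: (_ * _)).
  by rewrite /monomial big_map enumT.
move=> k /mapP[t _ ->] i; rewrite /row_count count_cat -/(row_count i w) cw /=.
rewrite count_map (eq_count (a2 := pred1 i)); last by move=> j; rewrite /= -(inj_eq val_inj).
rewrite count_uniq_mem ?enum_uniq// mem_enum /=; case: ifP; lia.
Qed.

Lemma lincomb_lincomb (P Q : seq T -> Prop) (ks : seq (F * seq T)) :
  (forall w, P w -> exists ks' : seq (F * seq T),
     monomial w = \sum_(k <- ks') k.1 *: monomial k.2 /\
     forall k, k \in ks' -> Q k.2) ->
  (forall k, k \in ks -> P k.2) -> exists ks' : seq (F * seq T),
  \sum_(k <- ks) k.1 *: monomial k.2 = \sum_(k <- ks') k.1 *: monomial k.2 /\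
  forall k, k \in ks' -> Q k.2.
Proof.
move=> PQ; elim: ks => [|k ks IH] ksP; first by exists [::]; rewrite !big_nil.
have [|ks2 [E2 P2]] := IH; first by move=> k' k'ks; apply: ksP; rewrite inE k'ks orbT.
have [ks1 [E1 P1]] := PQ _ (ksP k (mem_head _ _)).
exists ([seq (k.1 * k'.1, k'.2) | k' <- ks1] ++ ks2); split.
  rewrite big_cons E2 big_cat big_map /= E1 scaler_sumr; congr (_ + _).
  by apply: eq_bigr => k' _; rewrite scalerA.
by move=> k'; rewrite mem_cat => /orP[/mapP[k'' /P1 H1 ->]|/P2].
Qed.

Lemma raise_contents M M' N w : (M <= M')%N -> has_content M N w ->
  exists ks : seq (F * seq T),
  monomial w = \sum_(k <- ks) k.1 *: monomial k.2 /\
  forall k, k \in ks -> has_content M' N k.2.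
Proof.
move=> /subnK <-; move: (M' - M)%N => n; elim: n w => [|n IH] w cw.
  exists [:: (1, w)]; rewrite big_seq1 scale1r; split=> // k.
  by rewrite inE => /eqP ->.
have [ks [-> ksP]] := IH _ cw.
exact: (lincomb_lincomb (@raise_content _ _) ksP).
Qed.

Lemma straighten_content M N w : has_content M N w -> exists ks : seq (F * seq T),
  monomial w = \sum_(k <- ks) k.1 *: monomial k.2 /\
  forall k, k \in ks -> sorted (@code_le l) k.2 /\ has_content M N k.2.
Proof.
move=> cw; have [ks wE ksP] := straighten q_neq0 u_row u_col u_anti u_diag w.
exists ks; split=> // k /ksP[sk pk]; split=> // i; rewrite -cw /row_count.
have := seq.permP pk (fun j : I => j == i :> nat); rewrite /unzip1 !count_map.
by move=> <-.
Qed.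

Lemma lowest_sorted N a : lowest N a -> exists M (ks : seq (F * seq T)),
  a = \sum_(k <- ks) k.1 *: monomial k.2 /\
  forall k, k \in ks -> sorted (@code_le l) k.2 /\ has_content M N k.2.
Proof.
move=> /lowest_contents[ks [-> ksP]]; exists (\sum_(k <- ks) size k.2)%N.
have ksM k : k \in ks -> exists2 M, (M <= \sum_(k <- ks) size k.2)%N & has_content M N k.2.
  move=> kks; have [M cM] := ksP k kks; exists M => //.
  have := cM ord0; rewrite /= (_ : 0%N == l = false) => [<-|]; last by lia.
  by rewrite (big_rem k)//=; apply: leq_trans (count_size _ _) (leq_addr _ _).
have [ks2 [-> ks2P]] := lincomb_lincomb
  (P := fun w => exists2 M, (M <= \sum_(k <- ks) size k.2)%N & has_content M N w)
  (fun w '(ex_intro2 M le cM) => raise_contents le cM) ksM.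
have [ks3 [-> ks3P]] := lincomb_lincomb (Q := fun w => sorted (@code_le l) w /\ has_content _ N w)
  (@straighten_content _ _) ks2P.
by exists ks3.
Qed.

(** * Test words and lowest weight vectors *)

Lemma pairing_letter X h a : p (Uword (X :: h)) a = p (Uword h) (a ◁ Uletter X).
Proof. by rewrite /Uword big_cons (pairing_ract Hp). Qed.

Lemma pairing_letters X n h a :
  p (Uword (nseq n X ++ h)) a = p (Uword h) (iter n (fun b => b ◁ Uletter X) a).
Proof. by elim: n a => //= n IH a; rewrite pairing_letter IH -iterSr. Qed.

Let lowest_F N a (X : bool * nat) : lowest N a -> ~~ X.1 -> a ◁ Uletter X = 0.
Proof.
case: X => [[] r]//= la _; rewrite /Uletter /=; case: insubP => [r' _ _|_].
  exact: lowestF la _.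
exact: (ract0l Hp).
Qed.

Let lowest_E N a (X : bool * nat) : lowest N a -> X.1 -> (X.2.+1 < l)%N -> a ◁ Uletter X = 0.
Proof.
case: X => [[] r]//= la _ rl; rewrite /Uletter /=; case: insubP => [r' _ r'E|_].
  by apply: lowestE la _ _; rewrite r'E.
exact: (ract0l Hp).
Qed.

(** The definition gives the eigenvalue of the product of the [K_r] with exponents
    [r + 1], which is only that of the power [l] of the last [K_r]; the expansion in
    words gives the root. *)
Lemma lowest_Klast N a (r : 'I_l) : lowest N a -> r.+1 = l :> nat -> a ◁ UK r = s ^+ N *: a.
Proof.
move=> /lowest_sorted[M [ks [-> ksP]]] rl; rewrite (ract_sum Hp) scaler_sumr.
rewrite big_seq [RHS]big_seq; apply: eq_bigr => k /ksP[_ ck].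
rewrite (ractZ Hp) monomial_K scalerA mulrC -scalerA; congr (_ *: (_ *: _)).
rewrite KweightE (_ : row_count r.+1 k.2 = M + N)%N; last by rewrite rl; have := ck ord_max; rewrite /= eqxx.
have := ck (widen_ord (leqnSn l) r); rewrite /= (_ : r == l :> nat = false); last by lia.
by move=> ->; rewrite PoszD [X in X - _]addrC addrK.
Qed.

(** If the test word of [w] starts with a letter that kills [a], the pairing is zero.
    Otherwise its letters are only those of the block of the bottom row. If it has
    more than [N] letters [E_(l-1)], the pairing is zero again; if not, it is also
    the test word of a word of [N] bottom entries. *)
Lemma lowest_test N a (w : seq T) : lowest N a ->
  (forall t, t \in words l.+1 N -> sorted (fun i j : I => (i <= j)%N) t ->
     p (Uword (wordFE (bottom t))) a = 0) ->
  p (Uword (wordFE w)) a = 0.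
Proof.
move=> la Ht.
case Fw: (wordF w) => [|X h]; last first.
  have XF : ~~ X.1.
    have /mem_wordF[//] : X \in wordF w by rewrite Fw mem_head.
  by rewrite /wordFE Fw /= pairing_letter (lowest_F la XF) (pairing0 Hp).
case Ew: (flatten [seq blockE w i | i <- iota 0 l]) => [|X h]; last first.
  have /mem_wordE[XE [k]] : X \in flatten [seq blockE w i | i <- iota 0 l].
    by rewrite Ew mem_head.
  rewrite mem_iota add0n /= => il Xi.
  rewrite /wordFE Fw wordE_recr Ew /= pairing_letter (lowest_E la XE) ?(pairing0 Hp)//.
  by lia.
pose l' := l.-1; have lE : l = l'.+1 by rewrite prednK.
have l'l : (l' < l)%N by rewrite lE.
pose b := nE w l l'.
have [Nb|bN] := ltnP N b.
  rewrite /wordFE Fw wordE_recr Ew /= [X in blockE w X]lE blockES -lE -/b.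
  have -> : b = (N.+1 + (b - N.+1))%N by lia.
  rewrite addnC pairing_letters iterD.
  pose r := Ordinal l'l; have [ks aE] := u_span a; have [K eK] := E_nilpotent r ks.
  rewrite -aE in eK.
  have := rank_one_nilpotent (lowestF la r) (@lowest_Klast N a r la (esym lE)) eK.
  rewrite -(Uletter_E r) /= -/l' => ->.
  rewrite (_ : iter _ _ 0 = 0) ?(pairing0 Hp)//.
  by elim: (b - _)%N => //= n ->; exact: (ract0 Hp).
(* The columns of the entries of [w] in the bottom row left of the diagonal,
   completed by diagonal entries to [N] columns. *)
pose t0 := (map snd (filter (fun x : T => (x.1 == l :> nat) && (x.2 < l)%N) w)) ++ nseq (N - b) ord_max.
pose le (i j : I) := (i <= j)%N.
have bE : size (map snd (filter (fun x : T => (x.1 == l :> nat) && (x.2 < l)%N) w)) = b.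
  rewrite size_map size_filter /b /nE; apply: eq_count => x /=.
  by congr (_ && _); apply/idP/idP; lia.
pose t := sort le t0.
have tE : wordFE w = wordFE (bottom t).
  apply: wordFE_bottom => // r rl; have /seq.permP -> : perm_eq t t0 by rewrite perm_sort.
  rewrite /t0 count_cat count_map count_filter count_nseq /= leqNgt rl mul0n addn0.
  by apply: eq_count => x /=; case: eqP; lia.
rewrite tE; apply: Ht; last by apply: sort_sorted => i j; exact: leq_total.
by rewrite mem_words /t size_sort size_cat bE size_nseq subnKC.
Qed.

(** The test word of [w] moves [w] itself to the diagonal. *)
Lemma pairing_test (w : seq T) : p (Uword (wordFE w)) (monomial w) != 0.
Proof.
apply/(pairing_monomial _ _).2; exists [seq (x.2, x.2) | x <- w]; first exact: moves_wordFE.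
by apply/allP => x /mapP[y _ ->]; rewrite /= eqxx.
Qed.

(** The test words are triangular with respect to the corner counts, so the
    coefficients of a vector killed by all of them vanish by induction. *)
Lemma lowest_eq0 N a : lowest N a ->
  (forall t, t \in words l.+1 N -> sorted (fun i j : I => (i <= j)%N) t ->
     p (Uword (wordFE (bottom t))) a = 0) -> a = 0.
Proof.
move=> la Ht; have [M [ks [aE ksP]]] := lowest_sorted la.
pose ws := undup [seq k.2 | k <- ks].
pose c w := \sum_(k <- ks | k.2 == w) k.1.
have aE' : a = \sum_(w <- ws) c w *: monomial w.
  rewrite aE /c; under [RHS]eq_bigr do rewrite scaler_suml.
  rewrite (exchange_big_dep predT)//= big_seq [RHS]big_seq; apply: eq_bigr => k kks.
  have kws : k.2 \in ws by rewrite mem_undup map_f.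
  rewrite big_mkcond (bigD1_seq k.2)//= ?undup_uniq// eqxx big1 ?addr0//.
  by move=> w; rewrite eq_sym => /negPf ->.
have wsP w : w \in ws -> sorted (@code_le l) w /\ has_content M N w.
  by rewrite mem_undup => /mapP[k /ksP kP ->].
suff c0 w : w \in ws -> c w = 0.
  by rewrite aE' big_seq big1// => w /c0 ->; rewrite scale0r.
have [n] := ubnP (weight w); elim: n w => // n IH w; rewrite ltnS => wn wws.
have := lowest_test w la Ht; rewrite [X in p _ X]aE' (pairing_sum Hp).
rewrite (bigD1_seq w)//= ?undup_uniq// big_seq_cond big1 ?addr0; last first.
  move=> w' /andP[w'ws w'w]; rewrite (pairingZ Hp).
  have [->|p0] := eqVneq (p (Uword (wordFE w)) (monomial w')) 0; first by rewrite mulr0.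
  suff -> : c w' = 0 by rewrite mul0r.
  (* The words [w'] that pair with the test word of [w] have smaller corner counts,
     so their coefficients vanish already. *)
  have [v mv dv] := (pairing_monomial _ _).2.1 p0.
  have [||i|lt eqp] := @weight_perm l w w'.
  - by move=> x y xy; apply: upper_moves mv dv.
  - by move=> x y xy; apply: lower_moves mv dv.
  - by have := (wsP _ wws).2 i; have := (wsP _ w'ws).2 i; rewrite /row_count => -> ->.
  apply: IH => //; apply: leq_trans wn; rewrite ltn_neqAle lt andbT.
  apply: contra w'w => /eqP ww'; apply/eqP.
  apply: (sorted_eq (leT := @code_le l)) => //.
  - by move=> x y z; apply: leq_trans.
  - by move=> x y /anti_leq/code_inj.
  - by case: (wsP _ w'ws).
  - by case: (wsP _ wws).
  - by apply: eqp; rewrite ww'.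
move=> /eqP; rewrite (pairingZ Hp) mulf_eq0 (negPf (pairing_test w)) orbF.
by move/eqP.
Qed.

Lemma lowest_lin N (ks : seq (F * A)) : (forall k, k \in ks -> lowest N k.2) ->
  lowest N (\sum_(k <- ks) k.1 *: k.2).
Proof.
move=> H; split=> [r rl|r rl|r|]; rewrite (ract_sum Hp) ?scaler_sumr.
- rewrite big_seq [RHS]big_seq; apply: eq_bigr => k /H lk.
  by rewrite (ractZ Hp) (lowestK lk).
- by rewrite big_seq big1// => k /H lk; rewrite (ractZ Hp) (lowestE lk)// scaler0.
- by rewrite big_seq big1// => k /H lk; rewrite (ractZ Hp) (lowestF lk)// scaler0.
- rewrite big_seq [RHS]big_seq; apply: eq_bigr => k /H lk.
  by rewrite (ractZ Hp) (lowestT lk) !scalerA mulrC.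
Qed.

Lemma lowest_bottom t : lowest (size t) (monomial (bottom t)).
Proof.
have steps0 X : (~~ X.1) || (X.2.+1 < l)%N -> monomial (bottom t) ◁ Uletter X = 0.
  move=> HX; have [ks [kE _] ->] := monomial_letter X (bottom t).
  suff : steps X (bottom t) = [::] by rewrite -kE; case: ks {kE} => //; rewrite big_nil.
  elim: t {ks kE} => //= j t ->; rewrite cats0 /movable /=.
  by case: X HX => [[] r] /= HX; case: eqP => //= E; [lia | rewrite -E ltnn].
have rc i : (i < l)%N -> row_count i (bottom t) = 0%N.
  move=> il; rewrite /row_count /bottom count_map (eq_count (a2 := pred0)) ?count_pred0//.
  by move=> j /=; lia.
have rl : row_count l (bottom t) = size t.
  rewrite /row_count /bottom count_map (eq_count (a2 := predT)) ?count_predT//.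
  by move=> j /=; rewrite eqxx.
split=> [r lr|r lr|r|].
- by rewrite monomial_K KweightE !rc// subrr expr0z scale1r.
- by rewrite -Uletter_E steps0//= lr.
- by rewrite -Uletter_F steps0.
rewrite monomial_Ktot; congr (s ^ _ *: _).
have l1 : (l.-1 < l)%N by lia.
rewrite /Ktot_weight (bigD1 (Ordinal l1))//= big1 => [|r].
  by rewrite addr0 KweightE /= prednK// rl rc// subr0.
rewrite -(inj_eq val_inj) /= => rl1; rewrite KweightE !rc ?subrr ?mul0r//.
by have := ltn_ord r; lia.
Qed.

Lemma pairing_bottom (t t' : seq I) : size t = size t' ->
  p (Uword (wordFE (bottom t))) (monomial (bottom t')) != 0 -> perm_eq t t'.
Proof.
by move=> tt' /(pairing_monomial _ _).2[v mv dv]; exact: bottom_perm mv dv tt'.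
Qed.

(** The coordinates dual to the monomials of ordered bottom words: the pairing of the
    test words with these monomials is diagonal by [pairing_bottom]. *)
Definition bottom_coef (t : seq I) (a : A) : F :=
  p (Uword (wordFE (bottom t))) a / p (Uword (wordFE (bottom t))) (monomial (bottom t)).

(** The difference of the two sides is a lowest weight vector that pairs to zero with
    the test words of all bottom words. *)
Lemma lowest_expand N a : lowest N a ->
  a = \sum_(t <- words l.+1 N | sorted (fun i j : I => (i <= j)%N) t)
        bottom_coef t a *: monomial (bottom t).
Proof.
move=> la; apply/eqP; rewrite -subr_eq0; apply/eqP.
set S := \sum_(t <- _ | _) _.
have SE : S = \sum_(k <- [seq (bottom_coef t a, monomial (bottom t)) |
   t <- words l.+1 N & sorted (fun i j : I => (i <= j)%N) t]) k.1 *: k.2.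
  by rewrite big_map big_filter.
have lS : lowest N S.
  rewrite SE; apply: lowest_lin => k /mapP[t]; rewrite mem_filter mem_words.
  by move=> /andP[_ /eqP <-] -> /=; exact: lowest_bottom.
apply: (@lowest_eq0 N).
  have -> : a - S = \sum_(k <- [:: (1, a); (-1, S)]) k.1 *: k.2.
    by rewrite big_cons big_seq1 scale1r scaleN1r.
  by apply: lowest_lin => k; rewrite !inE => /orP[] /eqP ->.
move=> t tN st; rewrite (pairingB Hp) /S (pairing_sum Hp).
rewrite big_mkcond (bigD1_seq t)//= ?words_uniq// st big_seq_cond big1 ?addr0.
  by rewrite (pairingZ Hp) /bottom_coef divfK ?subrr// pairing_test.
move=> t' /andP[t'N tt']; case: ifP => // st'; rewrite (pairingZ Hp).
have [->|/pairing_bottom pt] := eqVneq (p (Uword (wordFE (bottom t))) (monomial (bottom t'))) 0.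
  by rewrite mulr0.
case/eqP: tt'; apply: (sorted_eq (leT := fun i j : I => (i <= j)%N)) => //.
- by move=> x y z; apply: leq_trans.
- by move=> x y /anti_leq/val_inj.
- by rewrite perm_sym pt// (eqP (_ : size t == N)) -?mem_words// (eqP (_ : size t' == N)) -?mem_words.
Qed.

(** The eigenvalue of [K_r] at a lowest weight vector [m]. As [m] is killed by
    [F_r], only the term [K_r^-1 ⊗ F_r] of the coproduct of [F_r] acts on a product
    [m b], and this is the scalar by which [m] passes through [F_r]. *)
Definition twist N (r : 'I_l) : F := if r.+1 == l :> nat then s ^+ N else 1.

Lemma twist_neq0 N r : twist N r != 0.
Proof. by rewrite /twist; case: ifP => _; rewrite ?oner_neq0// expf_neq0. Qed.

Lemma lowest_mulF N m b r : lowest N m ->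
  m * (b ◁ UF r) = twist N r *: ((m * b) ◁ UF r).
Proof.
move=> lm; have mK : m ◁ UK r = twist N r *: m.
  rewrite /twist; case: eqP => rl; first by rewrite (lowest_Klast lm).
  by rewrite scale1r (lowestK lm)//; have := ltn_ord r; lia.
rewrite ractMF (lowestF lm) mul0r add0r (ract_Ki (twist_neq0 _ _) mK).
by rewrite -scalerAl scalerA mulfV ?twist_neq0// scale1r.
Qed.

Lemma lowest_mulFs N m b (rs : seq 'I_l) : lowest N m ->
  m * (b ◁ \prod_(r <- rs) UF r) =
  (\prod_(r <- rs) twist N r) *: ((m * b) ◁ \prod_(r <- rs) UF r).
Proof.
move=> lm; elim: rs b => [|r rs IH] b; first by rewrite !big_nil !(ract1r Hp) scale1r.
rewrite !big_cons !(ractM Hp) IH (lowest_mulF _ _ lm) (ractZ Hp) scalerA.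
by rewrite mulrC.
Qed.

Lemma bottom_coef_sum t (J : Type) (r : seq J) (c : J -> F) (a : J -> A) :
  bottom_coef t (\sum_(j <- r) c j *: a j) = \sum_(j <- r) c j * bottom_coef t (a j).
Proof.
rewrite /bottom_coef (pairing_sum Hp) mulr_suml; apply: eq_bigr => j _.
by rewrite (pairingZ Hp) mulrA.
Qed.

Lemma bottom_coef0 t : bottom_coef t 0 = 0.
Proof. by rewrite /bottom_coef (pairing0 Hp) mul0r. Qed.

Lemma monomial_bottom t : monomial (bottom t) = \prod_(j <- t) u ord_max j.
Proof. by rewrite /monomial /bottom big_map. Qed.

(** * Duality with the quantum space *)

Section CoordinateRing.
Variables (B : algType F) (y : I -> B).
Hypothesis y_rel : forall i j : I, (i < j)%N -> y i * y j = q *: (y j * y i).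
Hypothesis y_span : forall b, exists ks : seq (F * seq I),
  b = \sum_(k <- ks) k.1 *: \prod_(i <- k.2) y i.
Variable phi : {rmorphism B -> {poly A}}.
Hypothesis phi_y : forall i, phi (y i) = (u ord_max i)%:P * 'X.
Hypothesis phiZ : forall c b, phi (c *: b) = map_poly ( *:%R c) (phi b).

Let leI (i j : I) := (i <= j)%N.

Lemma phi_word w : phi (\prod_(i <- w) y i) = (monomial (bottom w))%:P * 'X^(size w).
Proof.
elim: w => [|i w IH].
  by rewrite big_nil rmorph1 /monomial big_nil expr0 mulr1.
rewrite big_cons rmorphM /= phi_y IH monomial_cons polyCM exprS.
by rewrite -!mulrA; congr (_ * _); rewrite mulrA (commr_polyX (monomial _)%:P) -mulrA.
Qed.

Let phi_coef N (ks : seq (F * seq I)) :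
  (phi (\sum_(k <- ks) k.1 *: \prod_(i <- k.2) y i))`_N =
  \sum_(k <- ks) k.1 *: (if size k.2 == N then monomial (bottom k.2) else 0).
Proof.
rewrite raddf_sum coef_sum; apply: eq_bigr => k _.
rewrite /= phiZ coef_map_id0 ?scaler0// phi_word coefCM coefXn eq_sym.
by case: eqP => _; rewrite ?mulr1 ?mulr0.
Qed.

(** Reordering a word costs the same scalar in [B] as for the bottom row. *)
Lemma word_expand w : \prod_(i <- w) y i =
  \sum_(t <- words l.+1 (size w) | sorted leI t)
     bottom_coef t (monomial (bottom w)) *: \prod_(i <- t) y i.
Proof.
pose t0 := sort leI w.
have leI_total : total leI by move=> i j; exact: leq_total.
have st0 : sorted leI t0 by exact: sort_sorted.
have t0w : perm_eq t0 w by rewrite perm_sort.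
have t0N : t0 \in words l.+1 (size w) by rewrite mem_words size_sort.
have uz : forall i j : I, (i < j)%N ->
    u ord_max i * u ord_max j = q *: (u ord_max j * u ord_max i).
  by move=> i j; exact: u_col.
have k0 := kappa_neq0 t0 q_neq0.
have zE : monomial (bottom w) = (kappa q w / kappa q t0) *: monomial (bottom t0).
  rewrite !monomial_bottom (prod_ordmon q_neq0 uz) (prod_ordmon q_neq0 uz t0).
  by rewrite scalerA divfK// (ordmon_perm _ t0w).
rewrite [RHS]big_mkcond [RHS](bigD1_seq t0)//= ?words_uniq// st0.
rewrite [X in _ = _ + X]big_seq_cond [X in _ = _ + X]big1 ?addr0.
  rewrite zE /bottom_coef (pairingZ Hp) mulfK ?pairing_test//.
  rewrite (prod_ordmon q_neq0 y_rel) (prod_ordmon q_neq0 y_rel t0).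
  by rewrite scalerA divfK// (ordmon_perm _ t0w).
move=> t /andP[tN tt0]; case: ifP => // st.
have [p0|/pairing_bottom pt] := eqVneq (p (Uword (wordFE (bottom t))) (monomial (bottom w))) 0.
  by rewrite /bottom_coef p0 mul0r scale0r.
case/eqP: tt0; apply: (sorted_eq (leT := leI)) => //.
- by move=> a b c; apply: leq_trans.
- by move=> a b /anti_leq/val_inj.
- apply: perm_trans (pt _) _; last by rewrite perm_sym.
  by apply/eqP; rewrite -mem_words.
Qed.

(** The coefficient of [phi b] in degree [N] determines, through [bottom_coef], the
    coefficients of [b] at the ordered words of length [N]. *)
Lemma phi_injective : injective phi.
Proof.
move=> a b ab; apply/eqP; rewrite -subr_eq0; apply/eqP.
have : phi (a - b) = 0 by rewrite rmorphB ab subrr.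
move: (a - b) => {ab a b} b; have [ks ->] := y_span b => phi0.
pose M := (\sum_(k <- ks) size k.2).+1.
have kM k : k \in ks -> (size k.2 < M)%N.
  by move=> kks; rewrite ltnS (big_rem k)//= leq_addr.
transitivity (\sum_(k <- ks) k.1 *: \sum_(N < M) \sum_(t <- words l.+1 N | sorted leI t)
   bottom_coef t (if size k.2 == N then monomial (bottom k.2) else 0) *:
     \prod_(i <- t) y i).
  rewrite big_seq [RHS]big_seq; apply: eq_bigr => k /kM kks; congr (_ *: _).
  rewrite [RHS](bigD1 (Ordinal kks))//= eqxx -word_expand.
  rewrite [X in _ = _ + X]big1 ?addr0// => N.
  rewrite -(inj_eq val_inj) /= eq_sym => /negPf ->.
  by rewrite big1// => t _; rewrite bottom_coef0 scale0r.
under eq_bigr do rewrite scaler_sumr.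
rewrite exchange_big big1// => N _.
under eq_bigr do rewrite scaler_sumr.
rewrite exchange_big big1// => t _.
under eq_bigr do rewrite scalerA.
by rewrite -scaler_suml -bottom_coef_sum -phi_coef phi0 coef0 bottom_coef0 scale0r.
Qed.

Lemma phi_range P : (exists b, phi b = P) <-> forall N, lowest N P`_N.
Proof.
split=> [[b <-] N|lP].
  have [ks ->] := y_span b; rewrite phi_coef.
  rewrite -(big_map (fun k : F * seq I =>
     (k.1, if size k.2 == N then monomial (bottom k.2) else 0)) xpredT (fun k => k.1 *: k.2)).
  apply: (lowest_lin) => k /mapP[[c w] _ ->] /=; case: eqP => [<-|_].
    exact: lowest_bottom.
  suff : lowest N (\sum_(k <- [::] : seq (F * A)) k.1 *: k.2) by rewrite big_nil.
  exact: lowest_lin.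
exists (\sum_(N < size P) \sum_(t <- words l.+1 N | sorted leI t)
   bottom_coef t P`_N *: \prod_(i <- t) y i).
rewrite raddf_sum -[RHS]coefK poly_def; apply: eq_bigr => N _.
rewrite {2}(lowest_expand (lP N)) raddf_sum scaler_suml big_seq_cond [RHS]big_seq_cond.
apply: eq_bigr => t /andP[]; rewrite mem_words => /eqP tN _ /=.
rewrite phiZ phi_word tN -mul_polyC; apply/polyP => m.
by rewrite coef_map_id0 ?scaler0// !coefCM -scalerAl.
Qed.

End CoordinateRing.

End QuantumMatrices.

(** * Algebras given by generators and relations *)

Section PresentedAlgebraTheory.
Variables (F : fieldType) (P : presentation F).
Local Notation fP := (free_alg F (pgen P)).
Local Notation pi := (@ppi F P).

Lemma free_word (w : seq (pgen P)) :
  << FMonom w >> = \prod_(x <- w) fgen F x :> fP.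
Proof.
elim: w => [|x w IH].
  rewrite big_nil /= -[RHS]/(malgC 1); congr << _ *g _ >>.
  by apply/eqP; rewrite fmP fm1.
rewrite big_cons -IH [RHS]fgmulUU mulr1; congr << _ *g _ >>.
by apply/eqP; rewrite fmP fmM fmU.
Qed.

Lemma ppi_surj (a : palg P) : exists x : fP, a = pi x.
Proof. by exists (qrepr a); rewrite /ppi qreprK. Qed.

Lemma palg_span (a : palg P) : exists ks : seq (F * seq (pgen P)),
  a = \sum_(k <- ks) k.1 *: \prod_(x <- k.2) pg (P := P) x.
Proof.
have [x ->] := ppi_surj a.
exists [seq (x@_m, fmonom_val m) | m <- msupp x].
rewrite big_map {1}[x]monalgE raddf_sum; apply: eq_bigr => -[w] _ /=.
have -> : << x@_(FMonom w) *g FMonom w >> = x@_(FMonom w) *: << FMonom w >> :> fP.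
  by apply/malgP => k; rewrite mcoeffZ !mcoeffU mulrnAr mulr1.
rewrite linearZ; congr (_ *: _); rewrite free_word rmorph_prod.
by [].
Qed.

Section Lift.
Variables (B : nzRingType) (f : {rmorphism F -> B}) (e : pgen P -> B).
Hypothesis f_central : forall c b, f c * b = b * f c.

Definition word_lift (m : {fmonom (pgen P)}) : B := \prod_(x <- (m : seq (pgen P))) e x.

Lemma word_lift_mmorphism : mmorphism word_lift.
Proof.
split=> [m m'|]; last by rewrite /word_lift fm1 big_nil.
by rewrite /word_lift fmM big_cat.
Qed.
HB.instance Definition _ :=
  monalg.isMultiplicative.Build {fmonom (pgen P)} B word_lift word_lift_mmorphism.

Definition free_lift : fP -> B := mmap f word_lift.

Lemma free_lift_additive : additive free_lift.
Proof. exact: mmap_is_additive. Qed.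
HB.instance Definition _ := GRing.isAdditive.Build fP B free_lift free_lift_additive.

Lemma free_lift_multiplicative : multiplicative free_lift.
Proof. by apply: commr_mmap_is_multiplicative => g m m'; exact: f_central. Qed.
Lemma free_liftM x y : free_lift (x * y) = free_lift x * free_lift y.
Proof. by case: free_lift_multiplicative => + _; apply. Qed.
Lemma free_lift1 : free_lift 1 = 1. Proof. by case: free_lift_multiplicative. Qed.
Lemma free_liftB x y : free_lift (x - y) = free_lift x - free_lift y.
Proof. exact: raddfB. Qed.
Lemma free_lift0 : free_lift 0 = 0. Proof. exact: raddf0. Qed.

Lemma free_liftZ c x : free_lift (c *: x) = f c * free_lift x.
Proof. exact: mmapZ. Qed.

Lemma free_liftG x : free_lift (fgen F x) = e x.
Proof.
rewrite /free_lift [LHS]mmapU /word_lift fmU big_seq1.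
by rewrite -[RHS]mul1r; congr (_ * _); exact: (rmorph1 f).
Qed.

Hypothesis e_rel : forall x y, prel x y -> free_lift x = free_lift y.

Definition presented_lift (a : palg P) : B := free_lift (qrepr a).

Lemma presented_lift_ppi x : presented_lift (pi x) = free_lift x.
Proof.
apply/eqP; rewrite -subr_eq0 -raddfB; apply/eqP.
have : qrepr (pi x) - x \in lspan (@ideal_gens F P).
  by apply/qpi_eq; rewrite qreprK.
move=> /asboolP[n [c [s [Ss ->]]]]; rewrite raddf_sum big1// => i _ /=.
rewrite free_liftZ; case: (Ss i) => a y z b yz.
by rewrite !free_liftM raddfB /= (e_rel yz) subrr mulr0 mul0r mulr0.
Qed.

Lemma presented_lift_additive : additive presented_lift.
Proof.
move=> a b; have [x ->] := ppi_surj a; have [y ->] := ppi_surj b.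
by rewrite -raddfB !presented_lift_ppi raddfB.
Qed.
Lemma presented_lift_multiplicative : multiplicative presented_lift.
Proof.
split; last by have -> : 1 = pi 1 by []; rewrite presented_lift_ppi free_lift1.
move=> a b; have [x ->] := ppi_surj a; have [y ->] := ppi_surj b.
by rewrite -rmorphM !presented_lift_ppi free_liftM.
Qed.

(** The universal property of an algebra given by generators and relations; the
    target is a ring with a central copy of the scalars. *)
Lemma presented_liftP : exists phi : {rmorphism palg P -> B},
  (forall x, phi (pg (P := P) x) = e x) /\ (forall c a, phi (c *: a) = f c * phi a).
Proof.
pose H1 := GRing.isAdditive.Build _ _ presented_lift presented_lift_additive.
pose H2 := GRing.isMultiplicative.Build _ _ presented_lift presented_lift_multiplicative.
pose phi : {rmorphism palg P -> B} := HB.pack presented_lift H1 H2.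
exists phi; split=> [x|c a].
  by rewrite -[LHS]/(presented_lift _) /pg presented_lift_ppi free_liftG.
have [x ->] := ppi_surj a.
by rewrite -linearZ -[LHS]/(presented_lift _) -[phi _]/(presented_lift _)
  !presented_lift_ppi free_liftZ.
Qed.

End Lift.
End PresentedAlgebraTheory.

(** * The quantum projective space *)

(** The relations pass from the free algebra to the presented one. The projection is
    replaced by an abstract morphism so that the quotient is never unfolded. *)
Section RelationTransfer.
Variables (R : realType) (q : R) (l : nat) (T B : lalgType R[i]).
Variable phi : {lrmorphism T -> B}.
Local Notation I := 'I_l.+1.
Local Notation qC := (q%:C)%C.

Let pM x y : phi (x * y) = phi x * phi y. Proof. exact: rmorphM. Qed.
Let pZ c x : phi (c *: x) = c *: phi x. Proof. exact: linearZ. Qed.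
Let pB x y : phi (x - y) = phi x - phi y. Proof. exact: rmorphB. Qed.
Let p0 : phi 0 = 0. Proof. exact: rmorph0. Qed.
Let p1 : phi 1 = 1. Proof. exact: rmorph1. Qed.

Lemma Aq_rel_transfer (u : I -> I -> T) (v : I -> I -> B) :
  (forall i j, phi (u i j) = v i j) ->
  (forall x y, Aq_rel q u x y -> phi x = phi y) ->
  [/\ forall i j k : I, (i < j)%N -> v i k * v j k = qC *: (v j k * v i k),
      forall i j k : I, (i < j)%N -> v k i * v k j = qC *: (v k j * v k i),
      forall i j k m : I, (i < j)%N -> (k < m)%N -> v i m * v j k - v j k * v i m = 0,
      forall i j k m : I, (i < j)%N -> (k < m)%N ->
        v i k * v j m - v j m * v i k = (qC - qC^-1) *: (v i m * v j k)
    & \sum_(t : 'S_l.+1) (- qC) ^+ inversions t *: \prod_(i < l.+1) v i (t i) = 1].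
Proof.
move=> uv H; split=> [i j k ij|i j k ij|i j k m ij km|i j k m ij km|].
- by have := H _ _ (Arel_row q u k ij); rewrite pZ !pM !uv.
- by have := H _ _ (Arel_col q u k ij); rewrite pZ !pM !uv.
- by have := H _ _ (Arel_anti q u ij km); rewrite pB p0 !pM !uv.
- by have := H _ _ (Arel_diag q u ij km); rewrite pB pZ !pM !uv.
- have := H _ _ (Arel_det q u); rewrite raddf_sum p1 => E; rewrite -[RHS]E.
  apply: eq_bigr => t _ /=; rewrite pZ rmorph_prod; congr (_ *: _).
  by apply: eq_bigr => i _; exact: (esym (uv _ _)).
Qed.

Lemma Uq_rel_transfer (g : Ugen l -> T) (h : Ugen l -> B) :
  (forall x, phi (g x) = h x) ->
  (forall x y, Uq_rel q g x y -> phi x = phi y) ->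
  [/\ forall r, h (gK r) * h (gKi r) = 1,
      forall r, h (gE r) * h (gK r) = qC^-1 *: (h (gK r) * h (gE r))
    & forall r, h (gE r) * h (gF r) - h (gF r) * h (gE r) =
        (qC - qC^-1)^-1 *: (h (gK r) ^+ 2 - h (gKi r) ^+ 2)].
Proof.
move=> gh H; split=> r.
- by have := H _ _ (Urel_KKi q g r); rewrite pM p1 !gh.
- by have := H _ _ (Urel_EK q g r); rewrite pZ !pM !gh.
- have := H _ _ (Urel_EF q g r r); rewrite eqxx scale1r.
  by rewrite pB pZ pB !rmorphXn /= !pM !gh.
Qed.

Lemma qspace_rel_transfer (z : I -> T) (y : I -> B) :
  (forall i, phi (z i) = y i) ->
  (forall a b, qspace_rel q z a b -> phi a = phi b) ->
  forall i j : I, (i < j)%N -> y i * y j = qC *: (y j * y i).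
Proof.
move=> zy H i j ij; have := H _ _ (Qrel q z ij).
by rewrite pB pZ p0 !pM !zy => /subr0_eq.
Qed.

End RelationTransfer.

Lemma scaleN_comp (K : pzRingType) (V : lmodType K) (a b : K) (x y : V) :
  y = b *: x -> a *: (- y) = (- (a * b)) *: x.
Proof. by move=> ->; rewrite scalerN scaleNr scalerA. Qed.

Section ScalarPolynomials.
Variables (K : fieldType) (A : algType K).

(** The action of the scalars by [map_poly] is the multiplication by a central
    constant, so that [presented_liftP] applies to the target [{poly A}]. *)
Definition scalar_poly : K -> {poly A} := polyC \o in_alg A.
HB.instance Definition _ := GRing.RMorphism.on scalar_poly.

Lemma scalar_poly_central c P : scalar_poly c * P = P * scalar_poly c.
Proof. by apply/polyP => i; rewrite coefCM coefMC /= mulr_algl mulr_algr. Qed.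

Lemma scalar_polyE c P : scalar_poly c * P = map_poly ( *:%R c) P.
Proof. by apply/polyP => i; rewrite coefCM coef_map_id0 ?scaler0//= mulr_algl. Qed.

Lemma mul_polyCX (a b : A) : a%:P * 'X * (b%:P * 'X) = (a * b)%:P * 'X ^+ 2.
Proof. by rewrite polyCM -!mulrA; congr (_ * _); rewrite mulrA -(commr_polyX b%:P) -mulrA expr2. Qed.

Lemma polyCX_rel c (a b : A) : a * b = c *: (b * a) ->
  a%:P * 'X * (b%:P * 'X) = scalar_poly c * (b%:P * 'X * (a%:P * 'X)).
Proof.
move=> ab; rewrite !mul_polyCX scalar_polyE ab; apply/polyP => k.
by rewrite coef_map_id0 ?scaler0// !coefCM -scalerAl.
Qed.

End ScalarPolynomials.

Lemma qspace_rel_respected (R : realType) (q : R) (l : nat) (T : lalgType R[i])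
    (B : nzRingType) (L : T -> B) (f : R[i] -> B) (z : 'I_l.+1 -> T) :
  (forall a b, L (a * b) = L a * L b) -> (forall a b, L (a - b) = L a - L b) ->
  (forall c a, L (c *: a) = f c * L a) -> L 0 = 0 ->
  (forall i j : 'I_l.+1, (i < j)%N -> L (z i) * L (z j) = f (q%:C)%C * (L (z j) * L (z i))) ->
  forall a b, qspace_rel q z a b -> L a = L b.
Proof. by move=> LM LB LZ L0 Lz a b [i j ij]; rewrite LB LZ !LM Lz// L0 subrr. Qed.

(** The antipode axiom at the diagonal generator [u i i]; for the last row this is the
    sphere relation. *)
Lemma row_unitary (F : numClosedFieldType) (n : nat) (A : algType F) (HA : hopf_star A)
    (u : 'I_n -> 'I_n -> A) :
  (forall i j, cop HA (u i j) = \sum_k u i k ⊗ u k j) ->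
  (forall i j, cou HA (u i j) = (i == j)%:R) ->
  (forall i j, ant HA (u i j) = star HA (u j i)) ->
  forall i, \sum_k u i k * star HA (u i k) = 1.
Proof.
move=> uc ue ua i.
have : tlift (fun x y => x * ant HA y) (cop HA (u i i)) = (cou HA (u i i))%:A.
  by case: (HA).
rewrite uc ue eqxx scale1r tlift_sumI => [<-||| ]; last first.
- by move=> c v w; rewrite linearZ /= -scalerAl -scalerAr.
- by move=> v w w'; rewrite linearD mulrDr.
- by move=> v v' w; rewrite mulrDl.
by apply: eq_bigr => k _; rewrite ua.
Qed.

Section ProjectorIdentity.
Variables (R : realType) (q : R) (l : nat) (A : algType R[i]) (HA : hopf_star A).
Local Notation I := 'I_l.+1.
Local Notation C := R[i].
Local Notation qC := (q%:C)%C.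
Variable z : I -> A.
Hypothesis q01 : 0 < q < 1.
Hypothesis zz : forall i j : I, (i < j)%N -> z i * z j = qC *: (z j * z i).
Hypothesis z_sphere : \sum_i z i * star HA (z i) = 1.

Let starZ (c : C) a : star HA (c *: a) = c^* *: star HA a. Proof. by case: (HA). Qed.
Let starM a b : star HA (a * b) = star HA b * star HA a. Proof. by case: (HA). Qed.
Let starK : involutive (star HA). Proof. by case: (HA). Qed.
Let star1 : star HA 1 = 1.
Proof. by rewrite -[LHS]mul1r -{1}[1]starK -starM mul1r starK. Qed.

Let conjR (x : R) : ((x%:C)%C : C)^* = (x%:C)%C.
Proof.
case: (leP 0 x) => x0.
  by apply: conj_Creal; rewrite ger0_real// -[0]/((0 : R)%:C)%C lecR.
by apply: conj_Creal; rewrite ltr0_real// -[0]/((0 : R)%:C)%C ltcR.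
Qed.

Lemma kappa_complex (w : seq I) : kappa qC w = ((kappa q w)%:C)%C.
Proof.
elim: w => [|i w IH] /=; first by rewrite (rmorph1 (real_complex R)).
by rewrite IH (rmorphM (real_complex R)) (fmorphV (real_complex R)) (rmorphXn (real_complex R)).
Qed.

(** The sphere relation [sum_i z_i z_i^star = 1], inserted [N] times in itself. *)
Lemma sum_words_star N :
  \sum_(w <- words l.+1 N) (\prod_(i <- w) z i) * star HA (\prod_(i <- w) z i) = 1.
Proof.
elim: N => [|N IH]; first by rewrite big_seq1 big_nil star1 mulr1.
rewrite /= big_allpairs_dep /= big_enum /= -[RHS]z_sphere; apply: eq_bigr => i _.
rewrite -[X in _ = X * _]mulr1 -[X in _ = _ * X * _]IH mulr_sumr mulr_suml; apply: eq_bigr => w _.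
by rewrite big_cons starM !mulrA.
Qed.

Let q_neq0 : qC != 0.
Proof. by rewrite fmorph_eq0 gt_eqF//; case/andP: q01. Qed.

Definition zmon (J : I -> nat) : A := \prod_(k < l.+1) z k ^+ J k.

(** The words of length [N] are grouped by their content [J]; the squares of the
    scalars [kappa] of the words of content [J] add up to [qmult q J]. *)
Lemma sum_zmon_star N :
  \sum_(J : {ffun I -> 'I_N.+1} | (\sum_(k < l.+1) J k == N)%N)
    ((qmult q (fun k => J k))%:C)%C *: (zmon (fun k => J k) * star HA (zmon (fun k => J k))) = 1.
Proof.
rewrite -(sum_words_star N).
pose cnt (w : seq I) : {ffun I -> 'I_N.+1} := [ffun k => inord (count_mem k w)].
have cntE w k : w \in words l.+1 N -> cnt w k = count_mem k w :> nat.
  by rewrite mem_words => /eqP wN; rewrite ffunE inordK// ltnS -wN count_size.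
have cnt_sum w : (\sum_k count_mem k w = size w)%N.
  elim: w => [|i w IHw] /=; first by rewrite big1.
  by rewrite big_split IHw /= (bigD1 i)//= eqxx big1// => k; rewrite eq_sym => /negPf->.
rewrite [RHS]big_seq.
rewrite (partition_big cnt (fun J => \sum_(k < l.+1) J k == N)%N) /=; last first.
  move=> w wN; rewrite (eq_bigr _ (fun k _ => cntE w k wN)) cnt_sum.
  by move: wN; rewrite mem_words.
apply: eq_bigr => J /eqP JN; rewrite -(sum_kappa_sqr q01 JN).
rewrite rmorph_sum scaler_suml /= big_seq_cond [RHS]big_seq_cond.
have cond w : (w \in words l.+1 N) && [forall k, count_mem k w == J k] =
    (w \in words l.+1 N) && ((w \in words l.+1 N) && (cnt w == J)).
  case wN: (w \in words l.+1 N) => //=; apply/forallP/eqP => [H|<- k].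
    by apply/ffunP => k; apply: val_inj; rewrite /= cntE// (eqP (H k)).
  by rewrite cntE.
rewrite (eq_bigl _ _ cond); apply: eq_bigr => w /andP[_ /andP[wN /eqP wJ]].
have -> : \prod_(i <- w) z i = (kappa q w)%:C%C *: zmon (fun k => J k).
  rewrite (prod_ordmon q_neq0 zz) kappa_complex /ordmon /zmon; congr (_ *: _).
  by apply: eq_bigr => k _; rewrite -wJ cntE.
by rewrite starZ conjR -scalerAl -scalerAr scalerA rmorphXn expr2.
Qed.

Variables (N : nat) (D : A -> A) (la : C).
Hypothesis DD : forall a b, D (a + b) = D a + D b.
Hypothesis DZ : forall (c : C) a, D (c *: a) = c *: D a.
Hypothesis zD : forall t b, size t = N ->
  (\prod_(i <- t) z i) * D b = la *: D ((\prod_(i <- t) z i) * b).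

(** Since the entries of [Psi^dagger] commute with [D] up to one scalar, the
    sandwich of [D] between [Psi^dagger] and [Psi] is a multiple of [D]. *)
Lemma sandwich (xi : A) :
  let Psi (J : {ffun I -> 'I_N.+1}) : A :=
    (Num.sqrt (qmult q (fun k => J k)))%:C%C *: star HA (zmon (fun k => J k)) in
  \sum_(J : {ffun I -> 'I_N.+1} | (\sum_(k < l.+1) J k == N)%N)
    star HA (Psi J) * D (Psi J * xi) = la *: D xi.
Proof.
move=> Psi; have D0 : D 0 = 0 by rewrite -(scale0r 0) DZ !scale0r.
rewrite -{2}[xi]mul1r -(sum_zmon_star N) mulr_suml (big_morph D DD D0) scaler_sumr.
apply: eq_bigr => J /eqP JN; rewrite /Psi starZ conjR starK -!scalerAl !DZ -scalerAr.
have mE : zmon (fun k => J k) =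
    \prod_(i <- flatten [seq nseq (J k) k | k <- index_enum I]) z i.
  by rewrite big_flatten big_map; apply: eq_bigr => k _; rewrite big_nseq iter_mulr_1.
have mN : size (flatten [seq nseq (J k) k | k <- index_enum I]) = N.
  by rewrite size_flatten /shape -map_comp sumnE big_map -[RHS]JN; apply: eq_bigr => k _; rewrite /= size_nseq.
rewrite {1}mE zD// -mE !scalerA mulrA -rmorphM /= -expr2 sqr_sqrtr; last exact: qmult_ge0.
by congr (_ *: _); exact: mulrC.
Qed.

End ProjectorIdentity.

Section QuantumProjectiveSpace.
Variables (R : realType) (q : R) (l : nat).
Variables (HU : hopf_star (Uq q l)) (HA : hopf_star (Aq q l)).
Variable p : Uq q l -> Aq q l -> R[i].
Hypotheses (q01 : 0 < q < 1) (l_gt0 : (0 < l)%N).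
Hypotheses (HUq : Uq_hopf HU) (HAq : Aq_hopf HA) (Hpair : Uq_Aq_pairing HU HA p).

Local Notation C := R[i].
Local Notation I := 'I_l.+1.
Local Notation T := (I * I)%type.
Local Notation "a ◁ h" := (ract HA p a h) (at level 40, left associativity).
Local Notation A := (Aq q l).

Let Hp := pairing_hopf Hpair.
Let s : C := (Num.sqrt q)%:C%C.
Let qC : C := q%:C%C.

Let q_gt0 : 0 < q. Proof. by case/andP: q01. Qed.

Let s2 : s ^+ 2 = qC.
Proof. by rewrite /s -(rmorphXn (real_complex R)) sqr_sqrtr// ltW. Qed.

Let s01 : 0 < s < 1.
Proof.
rewrite /s -[0]/((0 : R)%:C)%C -[1]/((1 : R)%:C)%C !ltcR sqrtr_gt0 q_gt0 /=.
by rewrite -[X in _ < X]sqrtr1 ltr_sqrt//; case/andP: q01.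
Qed.

Let s2V : s ^- 2 = qC^-1. Proof. by rewrite s2. Qed.

Lemma Au_relations :
  [/\ forall i j k : I, (i < j)%N -> Au q i k * Au q j k = qC *: (Au q j k * Au q i k),
      forall i j k : I, (i < j)%N -> Au q k i * Au q k j = qC *: (Au q k j * Au q k i),
      forall i j k m : I, (i < j)%N -> (k < m)%N ->
        Au q i m * Au q j k - Au q j k * Au q i m = 0,
      forall i j k m : I, (i < j)%N -> (k < m)%N ->
        Au q i k * Au q j m - Au q j m * Au q i k = (qC - qC^-1) *: (Au q i m * Au q j k)
    & \sum_(t : 'S_l.+1) (- qC) ^+ inversions t *: \prod_(i < l.+1) Au q i (t i) = 1].
Proof.
exact: (@Aq_rel_transfer R q l _ (Aq q l) (@ppi C (Aq_pres q l)) _ (@Au R q l)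
  (fun i j => erefl) (@ppi_rel C (Aq_pres q l))).
Qed.

Lemma U_relations :
  [/\ forall r, UK q r * UKi q r = 1 :> Uq q l,
      forall r, UE q r * UK q r = qC^-1 *: (UK q r * UE q r) :> Uq q l
    & forall r, UE q r * UF q r - UF q r * UE q r =
        (qC - qC^-1)^-1 *: (UK q r ^+ 2 - UKi q r ^+ 2) :> Uq q l].
Proof.
exact: (@Uq_rel_transfer R q l _ (Uq q l) (@ppi C (Uq_pres q l)) _
  (pg (P := Uq_pres q l)) (fun x => erefl) (@ppi_rel C (Uq_pres q l))).
Qed.

Let UKKi r : UK q r * UKi q r = 1 :> Uq q l. Proof. by case: U_relations. Qed.

Lemma couF r : cou HU (UF q r) = 0.
Proof. exact: (cou_skew_primitive (UKKi r) (Uq_couK HUq r) (Uq_copF HUq r)). Qed.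

Let u_row (i j k : I) : (i < j)%N -> Au q i k * Au q j k = s ^+ 2 *: (Au q j k * Au q i k).
Proof. by rewrite s2; case: Au_relations => H _ _ _ _; exact: H. Qed.
Let u_col (i j k : I) : (i < j)%N -> Au q k i * Au q k j = s ^+ 2 *: (Au q k j * Au q k i).
Proof. by rewrite s2; case: Au_relations => _ H _ _ _; exact: H. Qed.
Let u_anti (i j k m : I) : (i < j)%N -> (k < m)%N ->
  Au q i m * Au q j k - Au q j k * Au q i m = 0.
Proof. by case: Au_relations => _ _ H _ _; exact: H. Qed.
Let u_diag (i j k m : I) : (i < j)%N -> (k < m)%N ->
  Au q i k * Au q j m - Au q j m * Au q i k = (s ^+ 2 - s ^- 2) *: (Au q i m * Au q j k).
Proof. by rewrite s2V s2; case: Au_relations => _ _ _ H _; exact: H. Qed.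
Let EK r : UE q r * UK q r = s ^- 2 *: (UK q r * UE q r) :> Uq q l.
Proof. by rewrite s2V; case: U_relations. Qed.
Let EF r : UE q r * UF q r - UF q r * UE q r =
  (s ^+ 2 - s ^- 2)^-1 *: (UK q r ^+ 2 - UKi q r ^+ 2) :> Uq q l.
Proof. by rewrite s2V s2; case: U_relations. Qed.

(** A term of the quantum determinant is recorded as its coefficient and its choice of
    a column in each row: only the rows of the entries matter. *)
Definition det_terms : seq (C * (I -> I)) :=
  [seq ((- qC) ^+ inversions t, fun i => t i) | t : 'S_l.+1].

Let u_det : \sum_(t <- det_terms) t.1 *: \prod_(i < l.+1) Au q i (t.2 i) = 1.
Proof. by rewrite big_image /=; case: Au_relations. Qed.

Let pK (r : 'I_l) (i j : I) : p (UK q r) (Au q i j) =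
  (i == j)%:R * s ^ ((i == r.+1 :> nat)%:Z - (i == r :> nat)%:Z).
Proof. by rewrite (pairing_K Hpair) (fmorphXz (real_complex R)). Qed.

Let u_span (a : A) : exists ks : seq (C * seq T),
  a = \sum_(k <- ks) k.1 *: monomial (@Au R q l) k.2.
Proof.
have [ks ->] := palg_span a; exists ks; apply: eq_bigr => k _; congr (_ *: _).
by apply: eq_bigr => -[i j] _.
Qed.

Local Notation lowest := (lowest s HA p (@UK R q l) (@UE R q l) (@UF R q l)).

Let lowest_zmon t : lowest (size t) (\prod_(j <- t) Az q j).
Proof.
rewrite -(monomial_bottom (@Au R q l)).
exact: (lowest_bottom s01 Hp (Aq_cop HAq) UKKi (Uq_copK HUq) (Uq_copE HUq) (Uq_copF HUq)
  (Uq_couK HUq) (Uq_couE HUq) couF pK (pairing_E Hpair) (pairing_F Hpair) l_gt0).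
Qed.

Let z_sphere : \sum_i Az q i * star HA (Az q i) = 1.
Proof. exact: (row_unitary (Aq_cop HAq) (Aq_cou HAq) (Aq_ant HAq)). Qed.

Let down_seq (i : 'I_l) : seq 'I_l := filter (fun k : 'I_l => (i <= k)%N) (rev (enum 'I_l)).

Let FdownE i : Fdown q i = \prod_(k <- down_seq i) UF q k :> Uq q l.
Proof. by rewrite /Fdown big_filter. Qed.

Let mulFs N m b (rs : seq 'I_l) : lowest N m ->
  m * (b ◁ \prod_(r <- rs) UF q r) =
  (\prod_(r <- rs) twist s N r) *: ((m * b) ◁ \prod_(r <- rs) UF q r).
Proof.
exact: (lowest_mulFs s01 Hp (Aq_cop HAq) UKKi (Uq_copK HUq) (Uq_copF HUq) (Uq_couK HUq)
  pK u_row u_col u_anti u_diag u_det u_span l_gt0).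
Qed.

(** The sections [psi] are the adjoints of monomials in the [z_j], and these pass
    through the product of the [F_r]. *)
Lemma nablaE N xi i : exists2 la : C, la != 0 &
  nabla HA p N xi 0 i = la *: (xi ◁ Fdown q i).
Proof.
pose rs := down_seq i.
pose D b := b ◁ Fdown q i.
have DD a b : D (a + b) = D a + D b by exact: (ractD Hp).
have DZ (c : C) a : D (c *: a) = c *: D a by exact: (ractZ Hp).
have zD t b : size t = N -> (\prod_(i <- t) Az q i) * D b =
    (\prod_(r <- rs) twist s N r) *: D ((\prod_(i <- t) Az q i) * b).
  by move=> tN; rewrite /D FdownE; apply: mulFs; rewrite -tN; exact: lowest_zmon.
have zz (j k : I) : (j < k)%N -> Az q j * Az q k = qC *: (Az q k * Az q j).
  by case: Au_relations => _ H _ _ _; exact: H.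
have E := sandwich q01 zz z_sphere DD DZ zD xi.
exists (- (qC ^- N * \prod_(r <- rs) twist s N r)).
  rewrite oppr_eq0 mulf_neq0 ?invr_neq0 ?expf_neq0//.
    by rewrite fmorph_eq0 gt_eqF.
  rewrite prodf_seq_neq0; apply/allP => r _; apply: twist_neq0 => //.
have dE a : dbar HA p a 0 i = - D a by rewrite mxE.
rewrite mxE (eq_bigr (fun J : {ffun I -> 'I_N.+1} =>
  - (star HA (psi HA J) * D (psi HA J * xi)))) => [|J _]; last first.
  by rewrite dE mulrN.
rewrite sumrN.
have psiE (J : {ffun I -> 'I_N.+1}) : psi HA J =
    (Num.sqrt (qmult q (fun k => J k)))%:C%C *: star HA (zmon (@Az R q l) (fun k => J k)).
  by rewrite /psi /zmon; reflexivity.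
cbv zeta in E; rewrite -(eq_bigr _ (fun J _ =>
  congr2 (fun x y => star HA x * D (y * xi)) (psiE J) (psiE J))) in E.
by have E' := scaleN_comp (qC ^- N) E; exact: E'.
Qed.

(** The last component of the connection is a multiple of [xi ◁ F_(l-1)], and every
    component begins with this operator. *)
Lemma H0P N xi : H0 HA p N xi <-> lowest N xi.
Proof.
have powE : (Num.sqrt q ^ (N%:Z * l%:Z))%:C%C = s ^ (N%:Z * l%:Z).
  exact: (fmorphXz (real_complex R)).
have l1 : (l.-1 < l)%N by rewrite prednK.
pose i1 := Ordinal l1.
have F1 : Fdown q i1 = UF q i1 :> Uq q l.
  rewrite FdownE (_ : down_seq i1 = [:: i1]) ?big_seq1//.
  rewrite /down_seq filter_rev (eq_filter (a2 := pred1 i1)) => [|k].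
    by rewrite filter_pred1_uniq ?enum_uniq ?mem_enum.
  rewrite /= -(inj_eq val_inj) /=; have := ltn_ord k; lia.
split=> [[[line tot] nab]|low].
  have F0 : xi ◁ UF q i1 = 0.
    have [la la0] := nablaE N xi i1; rewrite nab mxE F1 => /esym/eqP.
    by rewrite scaler_eq0 (negPf la0) => /eqP.
  split=> [r rl|r rl|r|].
  - by case: (line r rl).
  - by case: (line r rl).
  - have [rl|lr] := ltnP r.+1 l; first by case: (line r rl).
    by rewrite (_ : r = i1)//; apply: val_inj => /=; have := ltn_ord r; lia.
  - by rewrite -powE -tot.
split; first split.
- move=> r rl; split; [exact: lowestK low r rl|exact: lowestE low r rl|exact: lowestF low r].
- by rewrite powE; exact: lowestT low.
apply/rowP => i; have [la _ ->] := nablaE N xi i; rewrite mxE FdownE.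
have : i \in down_seq i.
  by rewrite mem_filter leqnn mem_rev mem_enum.
case: (down_seq i) => // k ks _.
by rewrite big_cons (ractM Hp) (lowestF low k) (ract0 Hp) scaler0.
Qed.

Lemma coordinate_ring : exists phi : {rmorphism qspace q l -> {poly Aq q l}},
  [/\ forall (c : R[i]) x, phi (c *: x) = map_poly ( *:%R c) (phi x),
      injective phi
    & range phi = hcoord_ring HA p].
Proof.
pose e (i : I) : {poly A} := (Az q i)%:P * 'X.
have e_rel (i j : I) : (i < j)%N -> e i * e j = scalar_poly A qC * (e j * e i).
  move=> ij; apply: (@polyCX_rel C A qC); case: Au_relations => _ H _ _ _; exact: H.
pose L := free_lift (P := qspace_pres q l) (scalar_poly A) e.
have LM := free_liftM (P := qspace_pres q l) e (@scalar_poly_central C A).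
have LB := free_liftB (P := qspace_pres q l) (scalar_poly A) e.
have LZ := free_liftZ (P := qspace_pres q l) (scalar_poly A) e.
have L0 := free_lift0 (P := qspace_pres q l) (scalar_poly A) e.
have Le i : L (fgen C i) = e i by exact: free_liftG.
have Lz (i j : I) : (i < j)%N -> L (fgen C i) * L (fgen C j) =
    scalar_poly A qC * (L (fgen C j) * L (fgen C i)) by rewrite !Le; exact: e_rel.
have Lrel := qspace_rel_respected LM LB LZ L0 Lz.
have [phi [phi_e phiZ]] := @presented_liftP C (qspace_pres q l) {poly A} (scalar_poly A)
  e (@scalar_poly_central C A) Lrel.
have y_rel (i j : I) : (i < j)%N ->
    pg (P := qspace_pres q l) i * pg (P := qspace_pres q l) j =
    s ^+ 2 *: (pg (P := qspace_pres q l) j * pg (P := qspace_pres q l) i).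
  rewrite s2.
  exact: (@qspace_rel_transfer R q l _ (qspace q l) (@ppi C (qspace_pres q l)) _
    (pg (P := qspace_pres q l)) (fun i => erefl) (@ppi_rel C (qspace_pres q l))).
have phiZ' (c : C) b : phi (c *: b) = map_poly ( *:%R c) (phi b).
  by rewrite phiZ scalar_polyE.
exists phi; split=> //.
  exact: (phi_injective s01 Hp (Aq_cop HAq) (Aq_cou HAq) UKKi (Uq_copK HUq) (Uq_copE HUq)
    (Uq_copF HUq) (Uq_couK HUq) (Uq_couE HUq) couF pK (pairing_E Hpair) (pairing_F Hpair)
    u_col y_rel (@palg_span C (qspace_pres q l)) phi_e phiZ').
have ran P : (exists b, phi b = P) <-> forall N, lowest N P`_N.
  exact: (phi_range s01 Hp (Aq_cop HAq) (Aq_cou HAq) UKKi (Uq_copK HUq) (Uq_copE HUq)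
    (Uq_copF HUq) (Uq_couK HUq) (Uq_couE HUq) couF pK (pairing_E Hpair) (pairing_F Hpair)
    EK EF u_row u_col u_anti u_diag u_det u_span l_gt0
    (@palg_span C (qspace_pres q l)) phi_e phiZ').
apply/seteqP; split=> [P [b _ bP] N|P HP].
  by apply/H0P; apply: (ran P).1; exists b.
have [|b bP] := (ran P).2; first by move=> N; apply/H0P; exact: HP.
by exists b.
Qed.

End QuantumProjectiveSpace.

Local Open Scope classical_set_scope.

Theorem theorem5p1 (R : realType) (q : R) (l : nat)
    (HU : hopf_star (Uq q l)) (HA : hopf_star (Aq q l))
    (p : Uq q l -> Aq q l -> R[i]) :
  0 < q < 1 -> (0 < l)%N ->
  Uq_hopf HU -> Aq_hopf HA -> Uq_Aq_pairing HU HA p ->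
  exists phi : {rmorphism qspace q l -> {poly Aq q l}},
    [/\ forall (c : R[i]) x, phi (c *: x) = map_poly ( *:%R c) (phi x),
        injective phi
      & range phi = hcoord_ring HA p].
Proof. by move=> q01 l0 HUq HAq Hpair; exact: (coordinate_ring q01 l0 HUq HAq Hpair). Qed.
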